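(* Let $\mathcal{D}$ be a separable, unital, strongly self-absorbing $C^*$-algebra. Suppose that $\mathcal{D}$ is quasidiagonal, that it has cancellation of projections and that $[\mathbf{1}_{\mathcal{D}}]\in nK_0(\mathcal{D})^+$ for all $n\geq 1$. Then $\mathcal{D}$ is isomorphic to the universal UHF algebra $\mathcal{Q}$ with $K_0(\mathcal{Q})\cong\mathbb{Q}$.
   Context: $\mathcal{Q}$ is the universal UHF algebra, i.e. the UHF algebra in whose supernatural number every prime occurs with infinite multiplicity. $K_0(\mathcal{D})^+$ is the set of classes in $K_0(\mathcal{D})$ of projections in matrix algebras over $\mathcal{D}$, and $nK_0(\mathcal{D})^+=\{nx: x\in K_0(\mathcal{D})^+\}$. $\mathcal{D}$ has cancellation of projections if any two projections in matrix algebras over $\mathcal{D}$ having the same class in $K_0(\mathcal{D})$ are Murray–von Neumann equivalent. Quasidiagonality is the usual notion: a separable $C^*$-algebra is quasidiagonal if it has a faithful representation $\pi$ on a separable Hilbert space $H$ admitting an increasing sequence of finite rank projections $p_n\in B(H)$ converging strongly to $\mathbf{1}_H$ with $\|[p_n,\pi(d)]\|\to 0$ for all $d$. Two $*$-homomorphisms $\sigma,\gamma:C\to B$ with $B$ unital are approximately unitarily equivalent, $\sigma\approx_{\mathrm{u}}\gamma$, if there is a sequence $(u_n)_{n\in\mathbb{N}}$ of unitaries in $B$ with $\|u_n\sigma(c)u_n^*-\gamma(c)\|\to 0$ for every $c\in C$. A separable unital $C^*$-algebra $\mathcal{D}$ is strongly self-absorbing if $\mathcal{D}\neq\mathbb{C}$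 and there is an isomorphism $\varphi:\mathcal{D}\to\mathcal{D}\otimes\mathcal{D}$ such that $\varphi\approx_{\mathrm{u}}\mathrm{id}_{\mathcal{D}}\otimes\mathbf{1}_{\mathcal{D}}$, where $\mathrm{id}_{\mathcal{D}}\otimes\mathbf{1}_{\mathcal{D}}$ is the map $d\mapsto d\otimes\mathbf{1}_{\mathcal{D}}$. Strongly self-absorbing $C^*$-algebras are known to be simple and nuclear, so $C^*$-tensor products with $\mathcal{D}$ are unambiguous. *)

(* Defs.v *)
From HB Require Import structures.
From mathcomp Require Import all_boot all_order all_algebra.
From mathcomp Require Import complex.
From mathcomp Require Import all_classical all_reals all_analysis.
Import numFieldNormedType.Exports.
Set Implicit Arguments. Unset Strict Implicit. Unset Printing Implicit Defensive.
Import Order.TTheory GRing.Theory Num.Theory.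
Local Open Scope ring_scope.
Local Open Scope classical_set_scope.
Local Open Scope quotient_scope.

HB.mixin Record isStarAlgebra (R : realType) A of GRing.Algebra R[i] A := {
  star : A -> A;
  starK : involutive star;
  starD : {morph star : a b / a + b};
  starZ : forall (z : R[i]) (a : A), star (z *: a) = z^* *: star a;
  starM : forall a b : A, star (a * b) = star b * star a
}.

#[short(type="starAlgType")]
HB.structure Definition StarAlgebra (R : realType) :=
  {A of isStarAlgebra R A & GRing.Algebra R[i] A}.

(* Unital C*-algebras, with 1 != 0 as in every algType.  MathComp has no common
   refinement of its ring and normed-module hierarchies below numDomainType, so
   the norm is a separate R-valued function and not the notation `|a|. *)
HB.mixin Record isCstarAlgebra (R : realType) A of StarAlgebra R A := {
  cnorm : A -> R;
  cnorm0_eq0 : forall a : A, cnorm a = 0 -> a = 0;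
  cnormD_le : forall a b : A, cnorm (a + b) <= cnorm a + cnorm b;
  cnormZ : forall (z : R[i]) (a : A),
    cnorm (z *: a) = Normc.normc z * cnorm a;
  cnormM_le : forall a b : A, cnorm (a * b) <= cnorm a * cnorm b;
  cnorm_starM : forall a : A, cnorm (star a * a) = cnorm a ^+ 2;
  cnorm_complete : forall u : nat -> A,
    (forall e : R, 0 < e -> exists N, forall m n, (N <= m)%N -> (N <= n)%N ->
       cnorm (u m - u n) < e) ->
    exists l : A, cnorm (u n - l) @[n --> \oo] --> (0 : R)
}.

#[short(type="cstarAlgType")]
HB.structure Definition CstarAlgebra (R : realType) :=
  {A of isCstarAlgebra R A & StarAlgebra R A}.

(* The inner product is linear in its first variable. *)
HB.mixin Record isHilbert (R : realType) H of CompleteNormedModule R[i] H := {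
  inner : H -> H -> R[i];
  innerDl : forall x y z : H, inner (x + y) z = inner x z + inner y z;
  innerZl : forall (c : R[i]) (x y : H), inner (c *: x) y = c * inner x y;
  innerC : forall x y : H, inner y x = (inner x y)^*;
  inner_norm : forall x : H, inner x x = `|x| ^+ 2
}.

#[short(type="hilbertType")]
HB.structure Definition Hilbert (R : realType) :=
  {H of isHilbert R H & CompleteNormedModule R[i] H}.

Section Adjoint.
Context {R : realType} {A : starAlgType R}.

Lemma star0 : star 0 = 0 :> A.
Proof. by have := starZ 0 (0 : A); rewrite !scale0r => ->; rewrite rmorph0 scale0r. Qed.

Lemma star1 : star 1 = 1 :> A.
Proof. by rewrite -[star 1]mulr1 -{2}[1](starK) -starM mulr1 starK. Qed.

Lemma star_sum I (r : seq I) (P : pred I) (F : I -> A) :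
  star (\sum_(i <- r | P i) F i) = \sum_(i <- r | P i) star (F i).
Proof. exact: (big_morph _ starD star0). Qed.

Definition adjmx m n (M : 'M[A]_(m, n)) : 'M[A]_(n, m) := (map_mx star M)^T.

Lemma adjmxK m n (M : 'M[A]_(m, n)) : adjmx (adjmx M) = M.
Proof. by apply/matrixP => i j; rewrite !mxE starK. Qed.

Lemma adjmxM m n k (M : 'M[A]_(m, n)) (N : 'M[A]_(n, k)) :
  adjmx (M *m N) = adjmx N *m adjmx M.
Proof.
apply/matrixP => i j; rewrite !mxE star_sum; apply: eq_bigr => l _.
by rewrite !mxE starM.
Qed.

Lemma adjmx0 m n : adjmx (0 : 'M[A]_(m, n)) = 0.
Proof. by apply/matrixP => i j; rewrite !mxE star0. Qed.

Lemma adjmx1 n : adjmx (1%:M : 'M[A]_n) = 1%:M.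
Proof.
apply/matrixP => i j; rewrite !mxE eq_sym.
by case: (_ == _); rewrite ?star1 ?star0.
Qed.

Lemma adj_block_mx m1 m2 n1 n2 (M1 : 'M[A]_(m1, n1)) (M2 : 'M[A]_(m1, n2))
    (M3 : 'M[A]_(m2, n1)) (M4 : 'M[A]_(m2, n2)) :
  adjmx (block_mx M1 M2 M3 M4)
  = block_mx (adjmx M1) (adjmx M3) (adjmx M2) (adjmx M4).
Proof. by rewrite /adjmx map_block_mx tr_block_mx. Qed.

Lemma adj_col_mx m1 m2 n (M1 : 'M[A]_(m1, n)) (M2 : 'M[A]_(m2, n)) :
  adjmx (col_mx M1 M2) = row_mx (adjmx M1) (adjmx M2).
Proof. by rewrite /adjmx map_col_mx tr_col_mx. Qed.

End Adjoint.

HB.instance Definition _ (R : realType) :=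
  @isStarAlgebra.Build R (R[i])^o (@Num.conj R[i]) (@conjCK R[i])
    (rmorphD Num.conj) (fun z a => rmorphM Num.conj z a)
    (fun a b => etrans (rmorphM Num.conj a b) (mulrC _ _)).

Section MatrixStar.
Context {R : realType} (n : nat).

Definition conjtr (M : 'M[R[i]]_n.+1) : 'M[R[i]]_n.+1 := (map_mx Num.conj M)^T.

Lemma conjtrK : involutive conjtr.
Proof. by move=> M; apply/matrixP => i j; rewrite !mxE conjCK. Qed.

Lemma conjtrD : {morph conjtr : M N / M + N}.
Proof. by move=> M N; apply/matrixP => i j; rewrite !mxE rmorphD. Qed.

Lemma conjtrZ (z : R[i]) (M : 'M[R[i]]_n.+1) :
  conjtr (z *: M) = z^* *: conjtr M.
Proof. by apply/matrixP => i j; rewrite !mxE rmorphM. Qed.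

Lemma conjtrM (M N : 'M[R[i]]_n.+1) : conjtr (M * N) = conjtr N * conjtr M.
Proof.
apply/matrixP => i j; rewrite !mxE rmorph_sum; apply: eq_bigr => l _.
by rewrite !mxE rmorphM mulrC.
Qed.

HB.instance Definition _ :=
  isStarAlgebra.Build R 'M[R[i]]_n.+1 conjtrK conjtrD conjtrZ conjtrM.

End MatrixStar.

(* The Murray-von Neumann semigroup V(A).  Projections of all sizes n are
   compared through rectangular partial isometries; the size 0 is allowed and
   only contributes the zero class. *)
Section MurrayVonNeumann.
Context {R : realType} {A : starAlgType R}.

Definition is_mxproj n (p : 'M[A]_n) := (p *m p == p) && (adjmx p == p).

Definition mxproj := {p : {n : nat & 'M[A]_n} | is_mxproj (tagged p)}.

HB.instance Definition _ := Choice.on mxproj.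

Definition mkproj n (p : 'M[A]_n) (pP : is_mxproj p) : mxproj :=
  exist (fun p : {n : nat & 'M[A]_n} => is_mxproj (tagged p))
    (Tagged (fun n => 'M[A]_n) p) pP.

Definition projsize (p : mxproj) : nat := tag (sval p).
Definition projmx (p : mxproj) : 'M[A]_(projsize p) := tagged (sval p).

Definition mvn_equiv (p q : mxproj) : Prop :=
  exists v : 'M[A]_(projsize p, projsize q),
    v *m adjmx v = projmx p /\ adjmx v *m v = projmx q.

Lemma projmxM (p : mxproj) : projmx p *m projmx p = projmx p.
Proof. by case: p => p pP; case/andP: (pP) => /eqP. Qed.

Lemma projmxJ (p : mxproj) : adjmx (projmx p) = projmx p.
Proof. by case: p => p pP; case/andP: (pP) => _ /eqP. Qed.

Lemma mvn_refl p : mvn_equiv p p.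
Proof. by exists (projmx p); rewrite projmxJ projmxM. Qed.

Lemma mvn_sym p q : mvn_equiv p q -> mvn_equiv q p.
Proof. by case=> v [v1 v2]; exists (adjmx v); rewrite adjmxK. Qed.

Lemma mvn_trans q p r : mvn_equiv p q -> mvn_equiv q r -> mvn_equiv p r.
Proof.
case=> v [v1 v2] [w [w1 w2]]; exists (v *m w); rewrite adjmxM; split.
  by rewrite mulmxA -(mulmxA v w) w1 -v2 !mulmxA v1 -mulmxA v1 projmxM.
by rewrite mulmxA -(mulmxA (adjmx w)) v2 -w1 -!mulmxA w2 !mulmxA w2 projmxM.
Qed.

Fact is_mxproj_sum (p q : mxproj) :
  is_mxproj (block_mx (projmx p) 0 0 (projmx q)).
Proof.
rewrite /is_mxproj mulmx_block !(mulmx0, mul0mx) !(addr0, add0r) !projmxM eqxx.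
by rewrite adj_block_mx !adjmx0 !projmxJ eqxx.
Qed.

Definition addproj (p q : mxproj) : mxproj := mkproj (is_mxproj_sum p q).

Fact is_mxproj_scalar1 n : is_mxproj (1%:M : 'M[A]_n).
Proof. by rewrite /is_mxproj mul1mx adjmx1 !eqxx. Qed.

Definition oneproj : mxproj := mkproj (is_mxproj_scalar1 1).

Definition zeroproj : mxproj := mkproj (is_mxproj_scalar1 0).

Lemma addproj_mvn p p' q q' :
  mvn_equiv p p' -> mvn_equiv q q' -> mvn_equiv (addproj p q) (addproj p' q').
Proof.
case=> v [v1 v2] [w [w1 w2]]; exists (block_mx v 0 0 w).
rewrite adj_block_mx !adjmx0 !mulmx_block !(mulmx0, mul0mx) !(addr0, add0r).
by rewrite v1 v2 w1 w2.
Qed.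

Lemma addprojC p q : mvn_equiv (addproj p q) (addproj q p).
Proof.
exists (block_mx 0 (projmx p) (projmx q) 0).
rewrite adj_block_mx !adjmx0 !mulmx_block !(mulmx0, mul0mx) !(addr0, add0r).
by rewrite !projmxJ !projmxM.
Qed.

Lemma add0proj p : mvn_equiv (addproj zeroproj p) p.
Proof.
exists (col_mx 0 (projmx p)).
rewrite adj_col_mx !adjmx0 mul_col_row mul_row_col !(mulmx0, mul0mx) add0r.
rewrite !projmxJ !projmxM; split=> //; congr (block_mx _ 0 0 _).
by apply/matrixP => -[].
Qed.

Lemma mvn_cast m n (p : 'M[A]_m) (q : 'M[A]_n) pP qP (e : m = n) :
  castmx (e, e) p = q -> mvn_equiv (@mkproj m p pP) (@mkproj n q qP).
Proof.
case: n / e q qP => q qP; rewrite castmx_id => epq.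
by case: q / epq qP => qP; rewrite (bool_irrelevance qP pP); exact: mvn_refl.
Qed.

Lemma addprojA p q r :
  mvn_equiv (addproj p (addproj q r)) (addproj (addproj p q) r).
Proof.
apply: mvn_sym; apply: (@mvn_cast _ _ _ _ _ _ (esym (addnA _ _ _))).
have /= := @block_mxA _ _ _ _ _ _ _ (projmx p) 0 0 0 (projmx q) 0 0 0 (projmx r).
by rewrite !(row_mx0, col_mx0) => ->.
Qed.

Definition mvnb : rel mxproj := fun p q => `[< mvn_equiv p q >].

Fact mvnb_refl : reflexive mvnb.
Proof. by move=> p; apply/asboolP; exact: mvn_refl. Qed.

Fact mvnb_sym : symmetric mvnb.
Proof. by move=> p q; apply: asbool_equiv_eq; split; exact: mvn_sym. Qed.

Fact mvnb_trans : transitive mvnb.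
Proof.
by move=> q p r /asboolP pq /asboolP qr; apply/asboolP; exact: mvn_trans pq qr.
Qed.

Canonical mvnb_equiv := EquivRel mvnb mvnb_refl mvnb_sym mvnb_trans.

Definition Vsemigroup := {eq_quot mvnb}.

HB.instance Definition _ := Choice.on Vsemigroup.
HB.instance Definition _ := EqQuotient.on Vsemigroup.

Definition Vadd (x y : Vsemigroup) : Vsemigroup :=
  \pi_Vsemigroup (addproj (repr x) (repr y)).

Lemma mvn_pi p : mvn_equiv (repr (\pi_Vsemigroup p)) p.
Proof. by apply/asboolP; rewrite -[`[< _ >]]/(mvnb _ _) -eqmodE reprK. Qed.

Lemma mvn_eq p q : mvn_equiv p q -> \pi_Vsemigroup p = \pi_Vsemigroup q.
Proof. by move=> pq; apply/eqP; rewrite eqmodE; apply/asboolP. Qed.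

Lemma eq_mvn p q : \pi_Vsemigroup p = \pi_Vsemigroup q -> mvn_equiv p q.
Proof. by move=> /eqP; rewrite eqmodE => /asboolP. Qed.

Fact VaddA : associative Vadd.
Proof.
move=> x y z; apply: mvn_eq.
apply: (mvn_trans (addproj_mvn (mvn_refl _) (mvn_pi _))).
apply: (mvn_trans (addprojA _ _ _)).
exact: (addproj_mvn (mvn_sym (mvn_pi _)) (mvn_refl _)).
Qed.

Fact VaddC : commutative Vadd.
Proof. by move=> x y; apply: mvn_eq; exact: addprojC. Qed.

Fact Vadd0 : left_id (\pi_Vsemigroup zeroproj) Vadd.
Proof.
move=> x; rewrite -[RHS]reprK; apply: mvn_eq.
apply: mvn_trans (add0proj _).
exact: (addproj_mvn (mvn_pi _) (mvn_refl _)).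
Qed.

HB.instance Definition _ := GRing.isNmodule.Build Vsemigroup VaddA VaddC Vadd0.

End MurrayVonNeumann.

Arguments mxproj {R} A.
Arguments oneproj {R} A.
Arguments Vsemigroup {R} A.

(* The Grothendieck group of a commutative monoid, as classes of pairs (a, b)
   standing for a - b. *)
Section Grothendieck.
Context {V : nmodType}.

Definition groth_rel : rel (V * V) := fun x y =>
  `[< exists c, x.1 + y.2 + c = y.1 + x.2 + c >].

Fact groth_refl : reflexive groth_rel.
Proof. by move=> x; apply/asboolP; exists 0. Qed.

Fact groth_sym : symmetric groth_rel.
Proof. by move=> x y; apply: asbool_equiv_eq; split=> -[c e]; exists c. Qed.

Fact groth_trans : transitive groth_rel.
Proof.
move=> y x z /asboolP[c e] /asboolP[d f]; apply/asboolP.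
exists (y.1 + y.2 + c + d).
transitivity ((x.1 + y.2 + c) + (y.1 + z.2 + d)).
  by rewrite [LHS](AC (2*4) ((1*4*5)*(3*2*6)))/=.
rewrite e f [LHS](AC (3*3) ((4*2)*(1*5*3*6)))/=.
by [].
Qed.

Canonical groth_equiv := EquivRel groth_rel groth_refl groth_sym groth_trans.

Definition groth := {eq_quot groth_rel}.

HB.instance Definition _ := Choice.on groth.
HB.instance Definition _ := EqQuotient.on groth.

Definition gdiff (x : V * V) : groth := \pi_groth x.

Lemma gdiff_repr x : gdiff (repr x) = x.
Proof. exact: reprK. Qed.

Lemma gdiff_eq x y :
  (exists c, x.1 + y.2 + c = y.1 + x.2 + c) -> gdiff x = gdiff y.
Proof. by move=> xy; apply/eqP; rewrite eqmodE; apply/asboolP. Qed.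

Lemma repr_gdiff x : exists c,
  (repr (gdiff x)).1 + x.2 + c = x.1 + (repr (gdiff x)).2 + c.
Proof. by apply/asboolP; rewrite -[`[< _ >]]/(groth_rel _ _) -eqmodE reprK. Qed.

Definition gadd (x y : groth) : groth :=
  gdiff ((repr x).1 + (repr y).1, (repr x).2 + (repr y).2).
Definition gopp (x : groth) : groth := gdiff ((repr x).2, (repr x).1).

Lemma gadd_diff a b : gadd (gdiff a) (gdiff b) = gdiff (a.1 + b.1, a.2 + b.2).
Proof.
have [c e] := repr_gdiff a; have [d f] := repr_gdiff b.
apply: gdiff_eq => /=; exists (c + d).
rewrite [LHS](AC ((2*2)*2) ((1*3*5)*(2*4*6)))/= e f.
by rewrite [LHS](AC (3*3) ((1*4)*(2*5)*(3*6)))/=.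
Qed.

Fact gaddA : associative gadd.
Proof.
move=> x y z; rewrite -(gdiff_repr x) -(gdiff_repr y) -(gdiff_repr z).
rewrite (gadd_diff (repr y)) (gadd_diff (repr x)) !gadd_diff /=.
by rewrite !addrA.
Qed.

Fact gaddC : commutative gadd.
Proof.
move=> x y; rewrite -(gdiff_repr x) -(gdiff_repr y) !gadd_diff.
by rewrite [(repr x).1 + _]addrC [(repr x).2 + _]addrC.
Qed.

Fact gadd0 : left_id (gdiff (0, 0)) gadd.
Proof.
move=> x; rewrite -(gdiff_repr x) gadd_diff /= !add0r.
by rewrite -surjective_pairing.
Qed.

Fact gaddN : left_inverse (gdiff (0, 0)) gopp gadd.
Proof.
move=> x; rewrite -[X in gadd _ X](gdiff_repr x) gadd_diff.
by apply: gdiff_eq => /=; exists 0; rewrite !addr0 add0r addrC.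
Qed.

HB.instance Definition _ := GRing.isZmodule.Build groth gaddA gaddC gadd0 gaddN.

End Grothendieck.

Arguments groth V : clear implicits.

Section K0.
Context {R : realType} (A : starAlgType R).

Definition K0 := groth (Vsemigroup A).

HB.instance Definition _ := GRing.Zmodule.on K0.

Definition K0class (p : mxproj A) : K0 :=
  gdiff (\pi_(Vsemigroup A) p, 0).

Definition K0one : K0 := K0class (oneproj A).

Definition K0pos : set K0 := range K0class.

Definition cancellation_of_projections : Prop :=
  forall p q : mxproj A, K0class p = K0class q -> mvn_equiv p q.

End K0.

Arguments K0 {R} A.
Arguments K0one {R} A.
Arguments K0pos {R} A.
Arguments cancellation_of_projections {R} A.

Definition star_preserving (R : realType) (A B : starAlgType R) (f : A -> B) :=
  forall a, f (star a) = star (f a).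

Definition star_isomorphic (R : realType) (A B : starAlgType R) : Prop :=
  exists f : {lrmorphism A -> B}, bijective f /\ star_preserving f.

Definition unitary (R : realType) (A : starAlgType R) (u : A) : Prop :=
  star u * u = 1 /\ u * star u = 1.

Definition approx_unitarily_equiv (R : realType) (A B : cstarAlgType R)
    (f g : A -> B) : Prop :=
  exists u : nat -> B, (forall n, unitary (u n)) /\
    forall a, cnorm (u n * f a * star (u n) - g a) @[n --> \oo] --> (0 : R).

Definition cstar_separable (R : realType) (A : cstarAlgType R) : Prop :=
  exists u : nat -> A, forall (a : A) (e : R), 0 < e ->
    exists n, cnorm (a - u n) < e.

Section Representations.
Context {R : realType}.

Definition bounded_op (H : hilbertType R) (T : H -> H) : Prop :=
  linear T /\ exists M : R[i], forall x, `|T x| <= M * `|x|.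

Definition adjoint_ops (H : hilbertType R) (S T : H -> H) : Prop :=
  forall x y, inner (S x) y = inner x (T y).

Definition representation (A : starAlgType R) (H : hilbertType R)
    (pi : A -> H -> H) : Prop :=
  [/\ forall a, bounded_op (pi a),
      forall x, linear (pi^~ x),
      forall a b x, pi (a * b) x = pi a (pi b x) &
      forall a, adjoint_ops (pi (star a)) (pi a)].

Definition faithful_representation (A : starAlgType R) (H : hilbertType R)
    (pi : A -> H -> H) : Prop :=
  representation pi /\ injective pi.

Definition finite_rank_projection (H : hilbertType R) (p : H -> H) : Prop :=
  [/\ bounded_op p, forall x, p (p x) = p x, adjoint_ops p p &
      exists (n : nat) (v : 'I_n -> H), forall x,
        exists c : 'I_n -> R[i], p x = \sum_(i < n) c i *: v i].

Definition quasidiagonal (A : starAlgType R) : Prop :=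
  exists (H : hilbertType R) (pi : A -> H -> H) (p : nat -> H -> H),
    [/\ exists2 D : set H, countable D & dense D,
        faithful_representation pi,
        forall n, finite_rank_projection (p n) /\
          (forall x, p n.+1 (p n x) = p n x),
        forall x, p n x @[n --> \oo] --> x &
        forall (a : A) (e : R), 0 < e -> \forall n \near \oo, forall x,
          `|p n (pi a x) - pi a (p n x)| <= e%:C%C * `|x|].

(* (K, h) is the Hilbert space tensor product of H1 and H2, with
   h x y = x (x) y. *)
Definition hilbert_tensor (H1 H2 K : hilbertType R) (h : H1 -> H2 -> K) :=
  [/\ forall y, linear (h^~ y), forall x, linear (h x),
      forall x x' y y', inner (h x y) (h x' y') = inner x x' * inner y y' &
      dense [set z : K | exists (n : nat) (x : 'I_n -> H1) (y : 'I_n -> H2),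
                           z = \sum_(i < n) h (x i) (y i)]].

(* (T, t) is the spatial tensor product of A and B, with t a b = a (x) b:
   for some faithful representations of A and B on H1 and H2, T is identified
   with the norm closure of the span of the operators a (x) b on the Hilbert
   space tensor product of H1 and H2. *)
Definition spatial_tensor (A B T : cstarAlgType R) (t : A -> B -> T) : Prop :=
  (exists (H1 H2 K : hilbertType R) (h : H1 -> H2 -> K)
      (piA : A -> H1 -> H1) (piB : B -> H2 -> H2) (pi : T -> K -> K),
    [/\ hilbert_tensor h, faithful_representation piA,
        faithful_representation piB, faithful_representation pi &
        forall a b x y, pi (t a b) (h x y) = h (piA a x) (piB b y)])
  /\ forall (z : T) (e : R), 0 < e ->
       exists (n : nat) (a : 'I_n -> A) (b : 'I_n -> B),
         cnorm (z - \sum_(i < n) t (a i) (b i)) < e.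

End Representations.

Definition strongly_self_absorbing (R : realType) (D : cstarAlgType R) : Prop :=
  ~ star_isomorphic D (R[i])^o /\
  exists (T : cstarAlgType R) (t : D -> D -> T) (phi : {lrmorphism D -> T}),
    [/\ spatial_tensor t, bijective phi, star_preserving phi &
        approx_unitarily_equiv phi (fun d => t d 1)].

(* A is the closure of an increasing union of unital *-subalgebras isomorphic
   to the matrix algebras of sizes (k n).+1. *)
Definition uhf_with_sizes (R : realType) (A : cstarAlgType R) (k : nat -> nat) :=
  exists phi : forall n, {lrmorphism 'M[R[i]]_((k n).+1) -> A},
    [/\ forall n, star_preserving (phi n),
        forall n, range (phi n) `<=` range (phi n.+1) &
        forall (a : A) (e : R), 0 < e ->
          exists n x, cnorm (a - phi n x) < e].

(* Every prime has infinite multiplicity in the supernatural number, i.e. the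
   least common multiple, of the matrix sizes. *)
Definition universal_uhf (R : realType) (A : cstarAlgType R) : Prop :=
  exists k : nat -> nat, uhf_with_sizes A k /\
    forall p j : nat, prime p -> exists n, (p ^ j %| (k n).+1)%N.

(* Main.v *)
(** Divisibility of [1] in K0 and cancellation provide unital copies in D of all
    matrix algebras.  Let phi : D -> D (x) D be the given isomorphism and put
    beta a = phi^-1 (1 (x) a).  Approximate unitary equivalence of phi and
    a |-> a (x) 1 gives a unitary u with phi a ~ u^* (a (x) 1) u and
    u (1 (x) a) ~ (beta a (x) 1) u on a given finite set.  Quasidiagonality
    provides, by compression to a finite-dimensional subspace, a map g from D into
    the span of matrix units of D which is almost multiplicative on a given finite
    set and such that x (x) y |-> y (x) g x is contractive.  The latter sends an
    approximation of u to an almost unitary element, whose polar part U almost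
    intertwines a (x) 1 and 1 (x) g (beta a).  Hence phi a is close to
    (U u)^* (1 (x) g (beta a)) (U u), i.e. a is close to a matrix subalgebra of D,
    whose size may be any multiple of a given one.  Perturbing matrix units turns
    this into an increasing sequence of matrix subalgebras, so D is a universal UHF
    algebra.  Two such algebras are isomorphic by interlacing their matrix
    subalgebras.  Every projection over such an algebra Q is equivalent to one over
    a matrix subalgebra, so K0 Q is the union of the subgroups generated by the
    [1]/n, and [1] has infinite order because a nonzero projection over D, which
    has cancellation, is not equivalent to 0. *)

(* The only analytic tool is iteration in a complete norm, giving the root of 1 - x and, for small
   x, its inverse. Absolute values, polar parts and projections near almost projections all come
   from it, so no spectrum or functional calculus occurs. It also shows that a C*-norm is the
   operator norm of every faithful representation, even a degenerate one, so that bounds can be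
   moved between representations.

   This transfer overcomes the main obstacle: the tensor product is given on H1 (x) H2, while the
   compressions of quasidiagonality live on another space H. A vector test involves finitely many
   directions of H2 only, so the bound becomes one for a matrix over D. It holds on H as well,
   because matrices over D inherit a C*-norm from D (x) D through matrix units of D.

   The legs are exchanged because phi a is close to a conjugate of a (x) 1: slicing the first leg of
   u must produce an element intertwining a (x) 1 with a tensor whose second leg is a matrix.

   The compressing vectors are fixed before the matrix units in D that receive them, which leaves
   the final matrix size free up to divisibility. *)
Require Import Defs.
From HB Require Import structures.
From mathcomp Require Import all_boot all_order all_algebra.
From mathcomp Require Import complex ring lra.
From mathcomp Require Import all_classical all_reals all_analysis.
Import numFieldNormedType.Exports.
Set Implicit Arguments. Unset Strict Implicit. Unset Printing Implicit Defensive.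
Import Order.TTheory GRing.Theory Num.Theory.
Local Open Scope ring_scope.
Local Open Scope classical_set_scope.

(* Deciding identities in noncommutative rings: both sides are expanded into
   signed monomials, which are then cancelled in pairs. *)
Inductive nc_expr :=
  | NcVar of nat | NcZero | NcOne | NcAdd of nc_expr & nc_expr
  | NcOpp of nc_expr | NcMul of nc_expr & nc_expr | NcMuln of nc_expr & nat.

Section NcRing.
Variable W : pzRingType.
Implicit Types (env : seq W) (e : nc_expr) (l : seq (bool * seq nat)).

Fixpoint nc_eval env e : W :=
  match e with
  | NcVar i => nth 0 env i
  | NcZero => 0
  | NcOne => 1
  | NcAdd e1 e2 => nc_eval env e1 + nc_eval env e2
  | NcOpp e1 => - nc_eval env e1
  | NcMul e1 e2 => nc_eval env e1 * nc_eval env e2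
  | NcMuln e1 n => nc_eval env e1 *+ n
  end.

Fixpoint nc_norm e : seq (bool * seq nat) :=
  match e with
  | NcVar i => [:: (false, [:: i])]
  | NcZero => [::]
  | NcOne => [:: (false, [::])]
  | NcAdd e1 e2 => nc_norm e1 ++ nc_norm e2
  | NcOpp e1 => [seq (~~ m.1, m.2) | m <- nc_norm e1]
  | NcMul e1 e2 =>
      [seq (m1.1 (+) m2.1, m1.2 ++ m2.2) | m1 <- nc_norm e1, m2 <- nc_norm e2]
  | NcMuln e1 n => flatten (nseq n (nc_norm e1))
  end.

Definition nc_mono env (m : bool * seq nat) : W :=
  (-1) ^+ m.1 * \prod_(i <- m.2) nth 0 env i.

Definition nc_sum env l : W := \sum_(m <- l) nc_mono env m.

Lemma nc_normE env e : nc_eval env e = nc_sum env (nc_norm e).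
Proof.
rewrite /nc_sum; elim: e => /=.
- by move=> i; rewrite big_seq1 /nc_mono big_seq1 /= mul1r.
- by rewrite big_nil.
- by rewrite big_seq1 /nc_mono big_nil mulr1.
- by move=> e1 -> e2 ->; rewrite big_cat.
- move=> e ->; rewrite big_map -sumrN; apply: eq_bigr => -[s m] _.
  by rewrite /nc_mono /= signrN mulNr.
- move=> e1 -> e2 ->; rewrite big_allpairs_dep big_distrl; apply: eq_bigr => -[s m] _.
  rewrite big_distrr; apply: eq_bigr => -[s' m'] _.
  rewrite /nc_mono /= signr_addb big_cat /= -!mulrA; congr (_ * _).
  by case: s' => /=; rewrite ?mul1r// !mulN1r mulrN.
- move=> e -> n; elim: n => [|n IH] /=; first by rewrite big_nil.
  by rewrite mulrS IH big_cat.
Qed.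

(** The fuel [n] makes the recursion structural; the size of the list is enough, as each step
    removes two monomials. *)
Fixpoint nc_cancel n l : bool :=
  match n, l with
  | _, [::] => true
  | n.+1, (s, m) :: l' =>
      ((~~ s, m) \in l') && nc_cancel n (rem (~~ s, m) l')
  | _, _ => false
  end.

Lemma nc_cancelP env n l : nc_cancel n l -> nc_sum env l = 0.
Proof.
rewrite /nc_sum; elim: n l => [|n IH] [|[s m] l] //=; rewrite ?big_nil//.
move=> /andP[sml /IH l0]; rewrite big_cons (perm_big _ (perm_to_rem sml)) /=.
by rewrite big_cons l0 addr0 /nc_mono signrN mulNr subrr.
Qed.

Lemma nc_ring_correct env e1 e2 :
  (let l := nc_norm (NcAdd e1 (NcOpp e2)) in nc_cancel (size l) l) ->
  nc_eval env e1 = nc_eval env e2.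
Proof.
by move=> /nc_cancelP => /(_ env); rewrite -nc_normE /= => /eqP; rewrite subr_eq0 => /eqP.
Qed.

End NcRing.

(** The dummy matches on [Set] run the tactic [constr_eq] while a term is being computed; when it
    fails, the next branch is tried. *)
Ltac nc_insert x l :=
  lazymatch l with
  | nil => constr:(cons x nil)
  | cons ?y ?l' => match constr:(Set) with
      | _ => let _ := match constr:(Set) with _ => constr_eq x y end in constr:(l)
      | _ => let l2 := nc_insert x l' in constr:(cons y l2)
      end
  end.

Ltac nc_index x l :=
  lazymatch l with
  | cons ?y ?l' => match constr:(Set) with
      | _ => let _ := match constr:(Set) with _ => constr_eq x y end in constr:(O)
      | _ => let i := nc_index x l' in constr:(S i)
      end
  end.

Ltac nc_atoms t l :=
  lazymatch t with
  | (?a + ?b)%R => let l1 := nc_atoms a l in nc_atoms b l1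
  | (?a * ?b)%R => let l1 := nc_atoms a l in nc_atoms b l1
  | (- ?a)%R => nc_atoms a l
  | (?a *+ (S ?n))%R => nc_atoms a l
  | 0%R => constr:(l)
  | 1%R => constr:(l)
  | _ => nc_insert t l
  end.

Ltac nc_reify t l :=
  lazymatch t with
  | (?a + ?b)%R => let x := nc_reify a l in let y := nc_reify b l in constr:(NcAdd x y)
  | (?a * ?b)%R => let x := nc_reify a l in let y := nc_reify b l in constr:(NcMul x y)
  | (- ?a)%R => let x := nc_reify a l in constr:(NcOpp x)
  | (?a *+ (S ?n))%R => let x := nc_reify a l in constr:(NcMuln x (S n))
  | 0%R => constr:(NcZero)
  | 1%R => constr:(NcOne)
  | _ => let i := nc_index t l in constr:(NcVar i)
  end.

Ltac nc_ring :=
  lazymatch goal with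
  | |- @eq ?T ?a ?b =>
      let l0 := nc_atoms a (@nil T) in
      let l := nc_atoms b l0 in
      let x := nc_reify a l in
      let y := nc_reify b l in
      refine (@nc_ring_correct _ (l : seq T) x y _); vm_compute; exact: erefl
  end.

(** * Star algebras with a complete norm *)

Section StarTheory.
Context {R : realType} {W : starAlgType R}.
Implicit Types a b : W.

Lemma starN a : star (- a) = - star a.
Proof. by apply/eqP; rewrite -subr_eq0 opprK -starD addNr star0. Qed.

Lemma starB a b : star (a - b) = star a - star b.
Proof. by rewrite starD starN. Qed.

Lemma halfD a : 2^-1 *: a + 2^-1 *: a = a.
Proof. by rewrite -scalerDl -div1r -splitr scale1r. Qed.

Lemma scale_half2 a : 2^-1 *: (a + a) = a.
Proof. by rewrite scalerDr halfD. Qed.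

Lemma half_real : (2^-1 : R[i]) = (2^-1 : R)%:C%C.
Proof. by rewrite rmorphV ?unitfE// rmorph_nat. Qed.

Lemma conj_real (r : R) : (r%:C%C : R[i])^* = r%:C%C.
Proof. by apply/CrealP/complex_realP; exists r. Qed.

Lemma starZr (r : R) a : star (r%:C%C *: a) = r%:C%C *: star a.
Proof. by rewrite starZ conj_real. Qed.

Lemma star_half a : star (2^-1 *: a) = 2^-1 *: star a.
Proof. by rewrite half_real starZr. Qed.

Lemma normcr (r : R) : 0 <= r -> Normc.normc r%:C%C = r.
Proof. by move=> r0; rewrite /Normc.normc /= expr0n addr0 sqrtr_sqr ger0_norm. Qed.

Lemma normc_half : Normc.normc (2^-1 : R[i]) = 2^-1.
Proof. by rewrite half_real normcr// invr_ge0. Qed.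

End StarTheory.

(** Serves as a majorant: a sequence of algebra elements whose increments are bounded by those of
    [r] is Cauchy. *)
Lemma mono_bounded_cauchy (R : realType) (r : nat -> R) (B : R) :
  (forall n, r n <= r n.+1) -> (forall n, r n <= B) ->
  forall e, 0 < e -> exists N, forall m n, (N <= m)%N -> (m <= n)%N ->
    r n - r m < e.
Proof.
move=> r_mono rB e e0.
have mono m n : (m <= n)%N -> r m <= r n.
  elim: n => [|n IH]; first by rewrite leqn0 => /eqP ->.
  rewrite leq_eqVlt => /predU1P[->//|]; rewrite ltnS => /IH mn.
  exact: le_trans mn (r_mono n).
have rsup : has_sup (range r).
  by split; [exists (r 0%N), 0%N | exists B => _ [n _ <-]].
have [_ [N _ <-] rN] := sup_adherent e0 rsup.
exists N => m n Nm mn.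
have : r n <= sup (range r) by apply: sup_upper_bound => //; exists n.
have := mono _ _ Nm; have := mono _ _ mn; lra.
Qed.

Section NormPredicates.
Context {R : realType} {W : starAlgType R}.

(** A predicate on functions, so that one algebra can carry several norms, in particular norms
    pulled back along homomorphisms. The C*-identity is kept apart because the sum of the norms of
    the entries of a matrix, used for K0, violates it. *)
Record star_norm (nu : W -> R) : Prop := StarNorm {
  nu_eq0 : forall a, nu a = 0 -> a = 0;
  nuD : forall a b, nu (a + b) <= nu a + nu b;
  nuZ : forall (z : R[i]) a, nu (z *: a) = Normc.normc z * nu a;
  nuM : forall a b, nu (a * b) <= nu a * nu b;
  nuJ : forall a, nu (star a) = nu a;
  nu_complete : forall u : nat -> W,
    (forall e, 0 < e -> exists N, forall m n, (N <= m)%N -> (N <= n)%N ->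
       nu (u m - u n) < e) ->
    exists l, forall e, 0 < e -> exists N, forall n, (N <= n)%N ->
       nu (u n - l) < e
}.

Record cstar_norm (nu : W -> R) : Prop := CstarNorm {
  cstar_norm_star :> star_norm nu;
  nuC : forall a, nu (star a * a) = nu a ^+ 2
}.

End NormPredicates.

Section NormTheory.
Context {R : realType} {W : starAlgType R} {nu : W -> R}.
Hypothesis nuP : star_norm nu.
Implicit Types (a b c x y z : W) (u v : nat -> W).

Lemma nu0 : nu 0 = 0.
Proof. by rewrite -(scale0r (0 : W)) (nuZ nuP) /Normc.normc /= expr0n addr0 sqrtr0 mul0r. Qed.

Lemma nuN a : nu (- a) = nu a.
Proof.
rewrite -scaleN1r (nuZ nuP) /Normc.normc /= oppr0.
by rewrite [0 ^+ 2]expr0n addr0 sqrrN expr1n sqrtr1 mul1r.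
Qed.

Lemma nu_ge0 a : 0 <= nu a.
Proof. by have := nuD nuP a (- a); rewrite subrr nu0 nuN; lra. Qed.

Lemma nuBC a b : nu (a - b) = nu (b - a).
Proof. by rewrite -nuN opprB. Qed.

Lemma nuB a b : nu (a - b) <= nu a + nu b.
Proof. by rewrite -(nuN b); exact: nuD. Qed.

Lemma nu_tri b a c : nu (a - c) <= nu (a - b) + nu (b - c).
Proof. by apply: le_trans (nuD nuP _ _); rewrite subrKA. Qed.

Lemma nu_le_add a b : nu a <= nu b + nu (a - b).
Proof. by apply: le_trans (nuD nuP _ _); rewrite addrC subrK. Qed.

Lemma nu_half a : nu (2^-1 *: a) = nu a / 2.
Proof. by rewrite (nuZ nuP) normc_half mulrC. Qed.

Lemma nuZr (r : R) a : 0 <= r -> nu (r%:C%C *: a) = r * nu a.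
Proof. by move=> r0; rewrite (nuZ nuP) normcr. Qed.

Lemma nu_sum I (s : seq I) (P : pred I) (F : I -> W) :
  nu (\sum_(i <- s | P i) F i) <= \sum_(i <- s | P i) nu (F i).
Proof.
elim/big_rec2: _ => [|i r x _ xr]; first by rewrite nu0.
by apply: le_trans (nuD nuP _ _) _; rewrite lerD2l.
Qed.

Lemma nuM_le a b (r s : R) : nu a <= r -> nu b <= s -> nu (a * b) <= r * s.
Proof. by move=> ar bs; apply: le_trans (nuM nuP _ _) _; rewrite ler_pM ?nu_ge0. Qed.

Lemma nu_small0 a : (forall e, 0 < e -> nu a <= e) -> a = 0.
Proof.
move=> ae; apply: (nu_eq0 nuP); apply/eqP; rewrite eq_le nu_ge0 andbT.
by apply/ler_addgt0Pl => e e0; rewrite addr0 ae.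
Qed.

Definition cvgto u a :=
  forall e, 0 < e -> exists N, forall n, (N <= n)%N -> nu (u n - a) < e.

Lemma cvgto_uniq u a b : cvgto u a -> cvgto u b -> a = b.
Proof.
move=> ua ub; apply/eqP; rewrite -subr_eq0; apply/eqP/nu_small0 => e e0.
have [N aN] := ua _ (divr_gt0 e0 (ltr0Sn R 1)).
have [M bM] := ub _ (divr_gt0 e0 (ltr0Sn R 1)).
have := aN (maxn N M); rewrite leq_maxl => /(_ isT) uaN.
have := bM (maxn N M); rewrite leq_maxr => /(_ isT) ubN.
have := nu_tri (u (maxn N M)) a b; rewrite (nuBC a (u _)).
by move: uaN ubN; lra.
Qed.

Lemma cvgto_cst a : cvgto (fun=> a) a.
Proof. by move=> e e0; exists 0%N => n _; rewrite subrr nu0. Qed.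

Lemma cvgto_shift u a : cvgto u a -> cvgto (fun n => u n.+1) a.
Proof.
by move=> ua e /ua[N uN]; exists N => n Nn; apply: uN; rewrite leqW.
Qed.

Lemma cvgto_le u a (r : R) : (forall n, nu (u n) <= r) -> cvgto u a -> nu a <= r.
Proof.
move=> ur ua; apply/ler_addgt0Pl => e /ua[N /(_ N (leqnn N))].
by have := ur N; have := nu_le_add a (u N); rewrite nuBC; lra.
Qed.

Lemma cvgtoD u v a b : cvgto u a -> cvgto v b -> cvgto (fun n => u n + v n) (a + b).
Proof.
move=> ua vb e e0.
have [N aN] := ua _ (divr_gt0 e0 (ltr0Sn R 1)).
have [M bM] := vb _ (divr_gt0 e0 (ltr0Sn R 1)).
exists (maxn N M) => n; rewrite geq_max => /andP[/aN uan /bM vbn].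
rewrite opprD addrACA; have := nuD nuP (u n - a) (v n - b).
by move: uan vbn; lra.
Qed.

Lemma cvgtoM u v a b : cvgto u a -> cvgto v b -> cvgto (fun n => u n * v n) (a * b).
Proof.
move=> ua vb e e0; pose k := nu a + nu b + 1.
have k0 : 0 < k by rewrite /k; have := nu_ge0 a; have := nu_ge0 b; lra.
have ekE : e / k / 2 * k = e / 2 by field; rewrite gt_eqF.
have ek0 : 0 < Num.min 1 (e / k / 2) by rewrite lt_min ltr01 !divr_gt0.
have [N aN] := ua _ ek0; have [M bM] := vb _ ek0.
exists (maxn N M) => n; rewrite geq_max => /andP[/aN uan /bM vbn].
have -> : u n * v n - a * b = (u n - a) * v n + a * (v n - b) by nc_ring.
apply: le_lt_trans (nuD nuP _ _) _.
move: uan vbn; rewrite !lt_min => /andP[_ un] /andP[v1 vn].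
have vk : nu (v n) <= k.
  by have := nu_le_add (v n) b; rewrite /k; have := nu_ge0 a; lra.
have ak : nu a <= k by rewrite /k; have := nu_ge0 b; lra.
have le1 := nuM_le (ltW un) vk; have le2 := nuM_le ak (ltW vn).
have [un_eq vn_eq] : nu ((u n - a) * v n) < e / 2 /\ nu (a * (v n - b)) <= e / 2.
  split; last first.
    by apply: le_trans le2 _; rewrite mulrC ekE.
  have [v0|v0] := eqVneq (nu (v n)) 0.
    by apply: le_lt_trans (nuM nuP _ _) _; rewrite v0 mulr0 divr_gt0.
  apply: le_lt_trans (nuM nuP _ _) _.
  apply: (@lt_le_trans _ _ (e / k / 2 * nu (v n))).
    by rewrite ltr_pM2r// lt_neqAle eq_sym v0 nu_ge0.
  apply: (@le_trans _ _ (e / k / 2 * k)).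
    by rewrite ler_wpM2l// !divr_ge0// ltW.
  by rewrite ekE.
by move: un_eq vn_eq; lra.
Qed.

Lemma cvgtoJ u a : cvgto u a -> cvgto (fun n => star (u n)) (star a).
Proof.
by move=> ua e /ua[N uN]; exists N => n /uN; rewrite -starB (nuJ nuP).
Qed.

Lemma cvgto_half u a : cvgto u a -> cvgto (fun n => 2^-1 *: u n) (2^-1 *: a).
Proof.
move=> ua e /ua[N uN]; exists N => n /uN; rewrite -scalerBr nu_half.
by have := nu_ge0 (u n - a); lra.
Qed.

(** Stands in for a functional calculus: what limits of real polynomials in [x] inherit from [x]. *)
Definition star_comm_inv x y :=
  (star x = x -> star y = y) /\ (forall c, c * x = x * c -> c * y = y * c).

Lemma star_comm_inv_lim x u y :
  (forall n, star_comm_inv x (u n)) -> cvgto u y -> star_comm_inv x y.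
Proof.
move=> ux uy; split=> [sx|c cx].
  apply: (cvgto_uniq (cvgtoJ uy)) => e /uy[N uN]; exists N => n /uN.
  by rewrite (ux n).1.
apply: (cvgto_uniq (cvgtoM (cvgto_cst c) uy)) => e e0.
have [N uN] := cvgtoM uy (cvgto_cst c) e0.
by exists N => n /uN; rewrite (ux n).2.
Qed.

(* [1 - y] is a square root of [1 - x]: the limit of y' = (x + y^2)/2, whose
   increments are dominated by those of the scalar sequence r' = (q + r^2)/2. *)
Lemma sqrt1B x : nu x <= 1 -> exists y,
  [/\ y + y = x + y * y, nu y <= nu x & star_comm_inv x y].
Proof.
move=> x1; set q := nu x in x1 *.
pose u n := iter n (fun y => 2^-1 *: (x + y * y)) 0.
pose r n := iter n (fun s => (q + s * s) / 2) 0.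
have uS n : u n.+1 = 2^-1 *: (x + u n * u n) by [].
have rS n : r n.+1 = (q + r n * r n) / 2 by [].
have q0 : 0 <= q := nu_ge0 x.
have rb n : 0 <= r n <= q.
  elim: n => [|n /andP[r0 rq]]; first by rewrite /= lexx.
  rewrite [r n.+1]/=; nra.
have ur n : nu (u n) <= r n.
  elim: n => [|n IH]; first by rewrite nu0.
  rewrite [u _]/= [r _]/= nu_half ler_pM2r// (le_trans (nuD nuP _ _))//.
  by rewrite lerD2l nuM_le.
have uC n : star_comm_inv x (u n).
  elim: n => [|n [IHs IHc]].
    by split=> [_|c _]; rewrite /= ?star0 ?mulr0 ?mul0r.
  split=> [sx|c cx]; first by rewrite /= star_half starD starM sx IHs.
  rewrite /= -scalerAr -scalerAl mulrDr mulrDl cx.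
  by rewrite mulrA (IHc c cx) -!mulrA (IHc c cx).
have uu n : u n * u n.+1 = u n.+1 * u n.
  by have [_ uCn] := uC n; have [_] := uC n.+1; apply; rewrite uCn.
have dur n : nu (u n.+1 - u n) <= r n.+1 - r n.
  elim: n => [|n IH].
    have -> : u 1%N - u 0%N = 2^-1 *: x by rewrite /= mulr0 addr0 subr0.
    by rewrite nu_half /= mulr0 addr0 subr0.
  (* A difference of squares factors because successive iterates commute. *)
  have -> : u n.+2 - u n.+1 = 2^-1 *: ((u n.+1 - u n) * (u n.+1 + u n)).
    rewrite (uS n.+1) {3}(uS n) -scalerBr; congr (_ *: _).
    by rewrite -[RHS]addr0 -(subrr (u n * u n.+1)) {2}uu; nc_ring.
  have -> : r n.+2 - r n.+1 = (r n.+1 - r n) * (r n.+1 + r n) / 2.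
    rewrite (rS n.+1) {3}(rS n); lra.
  rewrite nu_half ler_pM2r// nuM_le// (le_trans (nuD nuP _ _))//.
  by rewrite lerD.
have durm m n : (m <= n)%N -> nu (u n - u m) <= r n - r m.
  elim: n => [|n IH]; first by rewrite leqn0 => /eqP ->; rewrite subrr nu0 subrr.
  rewrite leq_eqVlt => /predU1P[->|]; first by rewrite !subrr nu0.
  by rewrite ltnS => /IH; have := dur n; have := nu_tri (u n) (u n.+1) (u m); lra.
have [|y uy] := nu_complete nuP (u := u).
  move=> e e0.
  have [||N rN] := @mono_bounded_cauchy R r q _ _ _ e0.
  - by move=> n; have := dur n; have := nu_ge0 (u n.+1 - u n); lra.
  - by move=> n; case/andP: (rb n).
  exists N => m n Nm Nn; wlog mn : m n Nm Nn / (n <= m)%N.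
    by move=> W0; case: (leqP n m) => [|/ltnW] nm; [|rewrite nuBC]; exact: W0.
  exact: le_lt_trans (durm _ _ mn) (rN _ _ Nn mn).
exists y; split; last exact: star_comm_inv_lim uC uy.
  have yE : y = 2^-1 *: (x + y * y).
    apply: (cvgto_uniq (cvgto_shift uy)).
    by apply: cvgto_half; apply: cvgtoD; [exact: cvgto_cst|exact: cvgtoM].
  by rewrite {1 2}yE halfD.
apply: cvgto_le uy => n; apply: le_trans (ur n) _.
by case/andP: (rb n).
Qed.

(** Banach's fixed point theorem on a ball around 0. The closed property [P] travels along the
    iteration; it will be self-adjointness and commutation. *)
Lemma contraction (F : W -> W) (r : R) (P : W -> Prop) : 0 <= r ->
  (forall z, nu z <= r -> nu (F z) <= r) ->
  (forall z z', nu z <= r -> nu z' <= r -> nu (F z - F z') <= nu (z - z') / 2) ->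
  P 0 -> (forall z, P z -> P (F z)) ->
  (forall u z, (forall n, P (u n)) -> cvgto u z -> P z) ->
  exists z, [/\ F z = z, nu z <= r & P z].
Proof.
move=> r0 Fr FC P0 PF Plim; pose u n := iter n F 0.
have ur n : nu (u n) <= r by elim: n => [|n]; [rewrite nu0|exact: Fr].
have uP n : P (u n) by elim: n => [|n]; [|exact: PF].
(* The partial sums of the geometric bounds r / 2^n for the increments of [u]. *)
pose g n := (2 * r) * (1 - 2^-1 ^+ n).
have du n : nu (u n.+1 - u n) <= r * 2^-1 ^+ n.
  elim: n => [|n IH]; first by rewrite subr0 expr0 mulr1; exact: ur.
  have := FC _ _ (ur n.+1) (ur n); rewrite exprSr mulrA.
  by move: IH; rewrite -!iterS -/(u n) -/(u n.+1) -/(u n.+2); lra.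
have dug n : nu (u n.+1 - u n) <= g n.+1 - g n.
  have := du n; rewrite /g exprSr; lra.
have durm m n : (m <= n)%N -> nu (u n - u m) <= g n - g m.
  elim: n => [|n IH]; first by rewrite leqn0 => /eqP ->; rewrite subrr nu0 subrr.
  rewrite leq_eqVlt => /predU1P[->|]; first by rewrite !subrr nu0.
  by rewrite ltnS => /IH; have := dug n; have := nu_tri (u n) (u n.+1) (u m); lra.
have [|z uz] := nu_complete nuP (u := u).
  move=> e e0.
  have [||N rN] := @mono_bounded_cauchy R g (2 * r) _ _ _ e0.
  - by move=> n; have := dug n; have := nu_ge0 (u n.+1 - u n); lra.
  - move=> n; rewrite /g; have : 0 <= (2^-1 : R) ^+ n by rewrite exprn_ge0// invr_ge0.
    by move: (_ ^+ _) => s; nra.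
  exists N => m n Nm Nn; wlog mn : m n Nm Nn / (n <= m)%N.
    by move=> W0; case: (leqP n m) => [|/ltnW] nm; [|rewrite nuBC]; exact: W0.
  exact: le_lt_trans (durm _ _ mn) (rN _ _ Nn mn).
have zr : nu z <= r by exact: cvgto_le ur uz.
exists z; split=> //; last exact: Plim uP uz.
apply: (@cvgto_uniq (fun n => u n.+1)); last exact: cvgto_shift.
move=> e /uz[N uN]; exists N => n /uN.
by have := FC _ _ (ur n) zr; have := nu_ge0 (u n - z); rewrite [u n.+1]/= -/(u n); lra.
Qed.

(** [1 + z] is the inverse square root of [1 - x]. Expanding the equation and solving for the term
    2z gives [F z = z], and the bound 1/8 makes [F] contract the ball of radius [2 * nu x] by one
    half. *)
Lemma inv_sqrt1B x : nu x <= 8^-1 -> exists z,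
  [/\ (1 - x) * ((1 + z) * (1 + z)) = 1, nu z <= 2 * nu x & star_comm_inv x z].
Proof.
move=> x8; have q0 := nu_ge0 x.
pose F z := 2^-1 *: (x + x * z + x * z + x * (z * z) - z * z).
have [|z nz|z z' nz nz'|||u z uP uz|z [Fz nz zP]] :=
  @contraction F (2 * nu x) (star_comm_inv x).
- lra.
- rewrite nu_half.
  have e1 : (2 * nu x) * (2 * nu x) <= 2^-1 * nu x by nra.
  have h1 : nu (x * z) <= 8^-1 * (2 * nu x) by exact: nuM_le.
  have h3 : nu (z * z) <= 2^-1 * nu x by apply: le_trans e1; exact: nuM_le.
  have h2 : nu (x * (z * z)) <= 8^-1 * (2^-1 * nu x) by exact: nuM_le.
  have := nuB (x + x * z + x * z + x * (z * z)) (z * z).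
  have := nuD nuP (x + x * z + x * z) (x * (z * z)).
  have := nuD nuP (x + x * z) (x * z); have := nuD nuP x (x * z); lra.
- set d := z - z'.
  have -> : F z - F z' = 2^-1 *: (x * d + x * d + x * (z * d + d * z')
                                   - (z * d + d * z')).
    by rewrite -scalerBr; congr (_ *: _); rewrite /d; nc_ring.
  rewrite nu_half ler_pM2r//.
  have d0 := nu_ge0 d.
  have h2 : nu (z * d + d * z') <= 2^-1 * nu d.
    apply: le_trans (nuD nuP _ _) _.
    have h := ler_wpM2r d0 x8.
    have := nuM_le nz (lexx (nu d)); have := nuM_le (lexx (nu d)) nz'; lra.
  have h1 : nu (x * d) <= 8^-1 * nu d by exact: nuM_le.
  have h3 := nuM_le x8 h2.
  have := nuB (x * d + x * d + x * (z * d + d * z')) (z * d + d * z').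
  have := nuD nuP (x * d + x * d) (x * (z * d + d * z')).
  have := nuD nuP (x * d) (x * d); lra.
- by split=> [_|c _]; rewrite ?star0 ?mulr0 ?mul0r.
- move=> z [zs zc]; rewrite /F; split=> [sx|c cx].
    rewrite star_half; congr (_ *: _).
    have zx : x * z = z * x by exact: zc.
    rewrite !(starB, starD, starM) sx zs// (mulrA x z z) !zx.
    by rewrite -(mulrA z x z) zx mulrA.
  have cz : GRing.comm c z := zc _ cx.
  have {}cx : GRing.comm c x := cx.
  rewrite -scalerAr -scalerAl; congr (_ *: _).
  by do ![apply: commrB|apply: commrD|apply: commrM].
- exact: star_comm_inv_lim uP uz.
exists z; split=> //.
have e : z + z - (x + x * z + x * z + x * (z * z) - z * z) = 0.
  by rewrite -{1 2}Fz halfD subrr.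
apply/eqP; rewrite -subr_eq0 -e; apply/eqP; nc_ring.
Qed.

(** [u] is z times the inverse root of [star z * z]. The two relations between a, b and z make a
    commute with [star z * z], hence with that root, so exact intertwining passes from z to u. *)
Lemma polar z (d : R) : nu (1 - star z * z) <= d -> nu (1 - z * star z) <= d ->
  d <= 8^-1 -> exists u : W, [/\ unitary u, nu (u - z) <= nu z * (2 * d) &
    forall a b, z * a = b * z -> z * star a = star b * z -> u * a = b * u].
Proof.
move=> z1 z2 d8.
have [s [sE ns [ss sc]]] := inv_sqrt1B (le_trans z1 d8).
(* The root for [z * star z] shows that the left inverse [p * star z] of z is two-sided. *)
have [t [tE nt [ts tc]]] := inv_sqrt1B (le_trans z2 d8).
have Hs : star (1 - star z * z) = 1 - star z * z.
  by rewrite starB star1 starM starK.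
have Ht : star (1 - z * star z) = 1 - z * star z.
  by rewrite starB star1 starM starK.
have {}ss := ss Hs; have {}ts := ts Ht.
set p := (1 + s) * (1 + s) in sE; set p' := (1 + t) * (1 + t) in tE.
rewrite subKr in sE; rewrite subKr in tE.
have cs : GRing.comm (star z * z) (1 + s).
  by apply: commrD; [exact: commr1|apply: sc; nc_ring].
have pC : star z * z * p = p * (star z * z) by apply: commrM.
have pz : p * star z * z = 1 by rewrite -mulrA -pC.
have zp : z * (p * star z) = 1.
  suff -> : p * star z = star z * p' by rewrite mulrA.
  by rewrite -[LHS]mulr1 -tE !mulrA pz mul1r.
exists (z * (1 + s)); split.
- split; rewrite starM starD star1 ss.
    have -> : (1 + s) * star z * (z * (1 + s)) = (1 + s) * (star z * z * (1 + s)).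
      by rewrite !mulrA.
    by rewrite cs mulrA -/p mulrA.
  by rewrite -mulrA (mulrA (1 + s)) -/p.
- have -> : z * (1 + s) - z = z * s by nc_ring.
  apply: nuM_le => //; apply: le_trans ns _; rewrite ler_pM2l//.
- move=> a b za zb.
  suff sa : a * s = s * a.
    have -> : z * (1 + s) * a = (z * a) * (1 + s).
      by rewrite -!mulrA; congr (_ * _); rewrite mulrDr mulrDl sa mulr1 mul1r.
    by rewrite za mulrA.
  apply: sc; rewrite mulrBr mulrBl mulr1 mul1r; congr (_ - _).
  have az : a * star z = star z * b.
    by rewrite -[LHS]starK starM starK zb starM starK.
  by rewrite mulrA az -!mulrA za.
Qed.

End NormTheory.

(** * Operator representations *)

Section PreHilbert.
Context {R : realType} {V : lmodType R[i]}.

(** Completeness is left out, so that coordinate spaces and finite tuples of vectors are covered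
    together with Hilbert spaces. *)
Record prehilbert (ip : V -> V -> R[i]) : Prop := PreHilbert {
  ipDl : forall x y z, ip (x + y) z = ip x z + ip y z;
  ipZl : forall c x y, ip (c *: x) y = c * ip x y;
  ipC : forall x y, ip y x = (ip x y)^*;
  ip_ge0 : forall x, 0 <= ip x x;
  ip_eq0 : forall x, ip x x = 0 -> x = 0
}.

Definition nsq (ip : V -> V -> R[i]) (x : V) : R := complex.Re (ip x x).

End PreHilbert.

Section PreHilbertTheory.
Context {R : realType} {V : lmodType R[i]} {ip : V -> V -> R[i]}.
Hypothesis ipP : prehilbert ip.
Local Notation nsq := (nsq ip).
Implicit Types x y z : V.

Lemma ipDr x y z : ip x (y + z) = ip x y + ip x z.
Proof. by rewrite (ipC ipP) (ipDl ipP) rmorphD /= -!(ipC ipP). Qed.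

Lemma ipZr (c : R[i]) x y : ip x (c *: y) = c^* * ip x y.
Proof. by rewrite (ipC ipP) (ipZl ipP) rmorphM /= -(ipC ipP). Qed.

Lemma ip0l x : ip 0 x = 0.
Proof. by rewrite -(scale0r (0 : V)) (ipZl ipP) mul0r. Qed.

Lemma ip0r x : ip x 0 = 0.
Proof. by rewrite (ipC ipP) ip0l rmorph0. Qed.

Lemma ipNl x y : ip (- x) y = - ip x y.
Proof. by rewrite -scaleN1r (ipZl ipP) mulN1r. Qed.

Lemma ipNr x y : ip x (- y) = - ip x y.
Proof. by rewrite (ipC ipP) ipNl rmorphN /= -(ipC ipP). Qed.

Lemma ipBl x y z : ip (x - y) z = ip x z - ip y z.
Proof. by rewrite (ipDl ipP) ipNl. Qed.

Lemma ip_suml I (s : seq I) (P : pred I) (F : I -> V) y :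
  ip (\sum_(i <- s | P i) F i) y = \sum_(i <- s | P i) ip (F i) y.
Proof. exact: (big_morph (ip^~ y) (fun a b => ipDl ipP a b y) (ip0l y)). Qed.

Lemma ip_sumr I (s : seq I) (P : pred I) (F : I -> V) x :
  ip x (\sum_(i <- s | P i) F i) = \sum_(i <- s | P i) ip x (F i).
Proof. exact: (big_morph (ip x) (ipDr x) (ip0r x)). Qed.

Lemma ip_nsq x : ip x x = (nsq x)%:C%C.
Proof. by rewrite RRe_real// ger0_real// (ip_ge0 ipP). Qed.

Lemma nsq_ge0 x : 0 <= nsq x.
Proof. by have := ip_ge0 ipP x; rewrite ip_nsq lecR. Qed.

Lemma nsq_eq0 x : nsq x = 0 -> x = 0.
Proof. by move=> x0; apply: (ip_eq0 ipP); rewrite ip_nsq x0. Qed.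

Lemma nsq_le0 x : nsq x <= 0 -> x = 0.
Proof. by move=> x0; apply: nsq_eq0; apply/eqP; rewrite eq_le x0 nsq_ge0. Qed.

Lemma nsq0 : nsq 0 = 0.
Proof. by rewrite /nsq ip0l. Qed.

Lemma Re_conj (c : R[i]) : complex.Re c^* = complex.Re c.
Proof. by case: c. Qed.

Lemma ReD (c d : R[i]) : complex.Re (c + d) = complex.Re c + complex.Re d.
Proof. by case: c; case: d. Qed.

Lemma ReN (c : R[i]) : complex.Re (- c) = - complex.Re c.
Proof. by case: c. Qed.

Lemma ReZ (r : R) (c : R[i]) : complex.Re (r%:C%C * c) = r * complex.Re c.
Proof. by case: c => a b /=; rewrite mul0r subr0. Qed.

Lemma nsqD x y : nsq (x + y) = nsq x + nsq y + 2 * complex.Re (ip x y).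
Proof.
rewrite /nsq (ipDl ipP) !ipDr !ReD (ipC ipP x y) Re_conj.
rewrite -!/(nsq _); ring.
Qed.

Lemma nsqN x : nsq (- x) = nsq x.
Proof. by rewrite /nsq ipNl ipNr opprK. Qed.

Lemma nsqB x y : nsq (x - y) = nsq x + nsq y - 2 * complex.Re (ip x y).
Proof. by rewrite nsqD nsqN ipNr ReN mulrN. Qed.

Lemma nsqZ (c : R[i]) x : nsq (c *: x) = Normc.normc c ^+ 2 * nsq x.
Proof.
rewrite /nsq (ipZl ipP) ipZr mulrA -normCK ip_nsq.
rewrite normc_def -rmorphXn -rmorphM /=; congr (_ ^+ 2 * _).
by case: c.
Qed.

Lemma nsqZr (r : R) x : nsq (r%:C%C *: x) = r ^+ 2 * nsq x.
Proof.
by rewrite nsqZ /Normc.normc /= expr0n addr0 sqrtr_sqr real_normK// num_real.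
Qed.

(* The Cauchy-Schwarz inequality in the form used to bound [y] = [f x] by
   testing it against itself. *)
Lemma nsq_le_self x y (r : R) :
  nsq x <= r -> complex.Re (ip x y) = nsq y -> nsq y <= r.
Proof. by move=> xr xy; have := nsq_ge0 (x - y); rewrite nsqB xy; lra. Qed.

End PreHilbertTheory.

Section FaithfulRep.
Context {R : realType} {W : starAlgType R} {V : lmodType R[i]}.

(** The unit may act as a proper projection. Boundedness is a consequence, see [rho_bound]. *)
Record faithful_rep (ip : V -> V -> R[i]) (rho : W -> V -> V) : Prop :=
  FaithfulRep {
  rhoD : forall a x y, rho a (x + y) = rho a x + rho a y;
  rhoZ : forall a c x, rho a (c *: x) = c *: rho a x;
  rhoDl : forall a b x, rho (a + b) x = rho a x + rho b x;
  rhoZl : forall c a x, rho (c *: a) x = c *: rho a x;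
  rhoM : forall a b x, rho (a * b) x = rho a (rho b x);
  rhoJ : forall a x y, ip (rho (star a) x) y = ip x (rho a y);
  rho_inj : forall a, (forall x, rho a x = 0) -> a = 0
}.

End FaithfulRep.

Section CstarNormTheory.
Context {R : realType} {W : starAlgType R} {nu : W -> R}.
Hypothesis nuP : cstar_norm nu.
Implicit Types a b h k u : W.

Lemma nu1 : nu 1 = 1.
Proof.
have n1 : nu 1 != 0.
  by apply/eqP => /(nu_eq0 nuP) /eqP; rewrite oner_eq0.
by apply: (mulfI n1); rewrite mulr1 -expr2 -(nuC nuP) star1 mulr1.
Qed.

Lemma nu_isometry u : star u * u = 1 -> nu u = 1.
Proof.
move=> uu; have := nuC nuP u; rewrite uu nu1 => /esym/eqP.
by rewrite sqrf_eq1 => /orP[/eqP//|/eqP u1]; have := nu_ge0 nuP u; lra.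
Qed.

Lemma nu_conj u a : unitary u -> nu (u * a * star u) <= nu a.
Proof.
move=> [uu uu']; rewrite -[leRHS]mulr1 -[X in _ <= X * _]mul1r.
rewrite -{1}(nu_isometry uu) -(nu_isometry (u := star u)); last by rewrite starK.
by rewrite !(nuM_le nuP).
Qed.

(* [h + ik] is unitary. *)
Lemma nu_cos_le1 h k : star h = h -> star k = k -> h * k = k * h ->
  h * h + k * k = 1 -> nu h <= 1.
Proof.
move=> hs ks hk hhkk; pose u := h + 'i *: k.
have us : star u = h - 'i *: k.
  by rewrite /u starD starZ hs ks conjCi scaleNr.
have u1 : nu u = 1.
  apply: nu_isometry; rewrite us /u mulrBl !mulrDr -!scalerAl -!scalerAr hk.
  by rewrite opprD scalerA -(expr2 'i) sqrCi scaleN1r opprK addrA addrK.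
have -> : h = 2^-1 *: (u + star u) by rewrite us addrACA subrr addr0 scale_half2.
rewrite (nu_half nuP); have := nuD nuP u (star u); rewrite (nuJ nuP) u1; lra.
Qed.

(** With y from [sqrt1B] at h^2, 1 - h^2 is the square of k = 1 - y; since h^2 + k^2 = 1, k has norm
    at most 1 too. *)
Lemma nu_1Bsqr_le1 h : star h = h -> nu h <= 1 -> nu (1 - h * h) <= 1.
Proof.
move=> hs h1.
have [|y [yE ny [ys yc]]] := sqrt1B nuP (x := h * h).
  by rewrite -(mul1r 1) (nuM_le nuP).
have {}ys : star y = y by apply: ys; rewrite starM hs.
have hy : h * y = y * h by apply: yc; rewrite mulrA.
have hk : h * h + (1 - y) * (1 - y) = 1.
  have -> : h * h + (1 - y) * (1 - y) = 1 + (h * h + y * y - (y + y)) by nc_ring.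
  by rewrite yE subrr addr0.
have -> : 1 - h * h = (1 - y) * (1 - y) by rewrite -{1}hk addrC addKr.
have k1 : nu (1 - y) <= 1.
  apply: (@nu_cos_le1 _ h) => //; first by rewrite starB star1 ys.
    by rewrite mulrBl mulrBr mulr1 mul1r hy.
  by rewrite addrC.
by rewrite -[leRHS]mulr1 (nuM_le nuP).
Qed.

(* The absolute value of [c] as the square of some [g]. *)
Lemma abs_sqr (c : W) : star c = c -> nu c <= 1 -> exists g,
  [/\ star g = g, (forall d, d * c = c * d -> d * g = g * d) &
      (g * g) * (g * g) = c * c].
Proof.
move=> cs c1; have := nu_1Bsqr_le1 cs c1 => x1.
have [y [yE ny [ys yc]]] := sqrt1B nuP x1.
have {}ys : star y = y by apply: ys; rewrite starB star1 starM cs.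
(* [1 - y] is |c|, the root of c^2 = 1 - (1 - c^2), and [1 - w] is the root of |c|. *)
have [w [wE nw [ws wc]]] := sqrt1B nuP (le_trans ny x1).
have yy : (1 - y) * (1 - y) = c * c.
  have -> : (1 - y) * (1 - y) = 1 + (y * y - (y + y)) by nc_ring.
  rewrite yE; nc_ring.
have ww : (1 - w) * (1 - w) = 1 - y.
  have -> : (1 - w) * (1 - w) = 1 + (w * w - (w + w)) by nc_ring.
  rewrite wE; nc_ring.
exists (1 - w); split; last by rewrite ww yy.
  by rewrite starB star1 ws.
move=> d dc; rewrite mulrBr mulrBl mulr1 mul1r wc// yc//.
by rewrite mulrBr mulrBl mulr1 mul1r mulrA dc -mulrA dc mulrA.
Qed.

Context {V : lmodType R[i]} {ip : V -> V -> R[i]} {rho : W -> V -> V}.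
Hypotheses (ipP : prehilbert ip) (rhoP : faithful_rep ip rho).
Local Notation nsq := (nsq ip).
Implicit Types x y v : V.

Lemma rho0 a : rho a 0 = 0.
Proof. by rewrite -(scale0r (0 : V)) (rhoZ rhoP) !scale0r. Qed.

Lemma rho0l x : rho 0 x = 0.
Proof. by rewrite -(scale0r (0 : W)) (rhoZl rhoP) scale0r. Qed.

Lemma rhoNl a x : rho (- a) x = - rho a x.
Proof. by rewrite -[- a]scaleN1r (rhoZl rhoP) scaleN1r. Qed.

Lemma rhoBl a b x : rho (a - b) x = rho a x - rho b x.
Proof. by rewrite (rhoDl rhoP) rhoNl. Qed.

Lemma rhoB a x y : rho a (x - y) = rho a x - rho a y.
Proof. by rewrite (rhoD rhoP) -[- y]scaleN1r (rhoZ rhoP) scaleN1r. Qed.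

Lemma nsq_rho a x : nsq (rho a x) = complex.Re (ip (rho (star a * a) x) x).
Proof. by rewrite (rhoM rhoP) (rhoJ rhoP). Qed.

Lemma nsq_rho1 x : nsq (rho 1 x) <= nsq x.
Proof.
apply: (nsq_le_self ipP (lexx _)).
by rewrite nsq_rho star1 mulr1 (ipC ipP (rho 1 x) x) Re_conj.
Qed.

(** For b = a/q the element 1 - b^* b has the form c^* c by [sqrt1B], so it acts positively and b
    does not lengthen vectors. *)
Lemma rho_bound a (q : R) x : nu a <= q -> nsq (rho a x) <= q ^+ 2 * nsq x.
Proof.
move=> aq; have q0 := le_trans (nu_ge0 nuP a) aq.
have [q_eq0|qn0] := eqVneq q 0.
  have -> : a = 0.
    by apply: (nu_eq0 nuP); apply/eqP; rewrite eq_le (nu_ge0 nuP) -q_eq0 aq.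
  by rewrite rho0l (nsq0 ipP) mulr_ge0 ?sqr_ge0 ?(nsq_ge0 ipP).
have qp : 0 < q by rewrite lt_neqAle eq_sym qn0.
pose b := (q^-1)%:C%C *: a.
have ab : a = q%:C%C *: b.
  by rewrite scalerA -rmorphM /= divff// scale1r.
have b1 : nu b <= 1 by rewrite (nuZr nuP) ?invr_ge0// mulrC ler_pdivrMr ?mul1r.
have [|y [yE ny [ys _]]] := sqrt1B nuP (x := star b * b).
  by rewrite (nuC nuP) expr_le1// (nu_ge0 nuP).
have {}ys : star y = y by apply: ys; rewrite starM starK.
have e : star (1 - y) * (1 - y) = 1 - star b * b.
  rewrite starB star1 ys.
  have -> : (1 - y) * (1 - y) = 1 + (y * y - (y + y)) by nc_ring.
  rewrite yE; nc_ring.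
have : nsq (rho b x) <= nsq (rho 1 x).
  have := nsq_ge0 ipP (rho (1 - y) x).
  rewrite !nsq_rho e star1 mulr1 rhoBl (ipBl ipP) ReD ReN; lra.
have := nsq_rho1 x.
move=> l1 l2; rewrite ab (rhoZl rhoP _ b) (nsqZr ipP).
by apply: ler_wpM2l; [exact: sqr_ge0|exact: le_trans l2 l1].
Qed.

(** By assumption c = 1 - a^2 acts positively. Once c is known to be a square k^2 in the algebra,
    a^2 + k^2 = 1 gives the bound. The root k is obtained by showing that c coincides with its
    absolute value. *)
Let rho_bound_sa a : star a = a -> (forall x, nsq (rho a x) <= nsq x) -> nu a <= 1.
Proof.
move=> as_ a1; pose c := 1 - a * a; pose l := nu c + 1.
have l0 : 0 < l by rewrite /l; have := nu_ge0 nuP c; lra.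
pose c' := (l^-1)%:C%C *: c.
have cE : c = l%:C%C *: c' by rewrite scalerA -rmorphM /= divff ?gt_eqF// scale1r.
have cs : star c' = c' by rewrite starZr starB star1 starM as_.
have [||g [gs gc gE]] := @abs_sqr c' => //.
  by rewrite (nuZr nuP) ?invr_ge0 ?(ltW l0)// mulrC ler_pdivrMr// mul1r /l; lra.
have gc' : g * c' = c' * g by rewrite gc.
pose m := g * g.
have mc' : m * c' = c' * m by rewrite /m -mulrA gc' !mulrA gc'.
have ms : star m = m by rewrite starM gs.
have c'_ge0 v : 0 <= complex.Re (ip (rho c' v) v).
  rewrite (rhoZl rhoP) (ipZl ipP) ReZ mulr_ge0 ?invr_ge0 ?(ltW l0)//.
  rewrite rhoBl (ipBl ipP) ReD ReN -{1}as_ -nsq_rho.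
  have -> : complex.Re (ip (rho 1 v) v) = nsq (rho 1 v).
    by rewrite nsq_rho star1 mulr1.
  by have := a1 (rho 1 v); rewrite -(rhoM rhoP) mulr1; lra.
(* m and c' act positively and (m + c')(m - c') = 0. On a vector v in the range of m - c' this gives
   m v = - c' v, which forces both to vanish. *)
have mc : m = c'.
  apply/eqP; rewrite -subr_eq0; apply/eqP/(rho_inj rhoP) => x.
  set v := rho (m - c') x.
  have mcv : rho m v = - rho c' v.
    apply/eqP; rewrite -addr_eq0 -(rhoDl rhoP) -(rhoM rhoP).
    have -> : (m + c') * (m - c') = 0.
      have -> : (m + c') * (m - c') = m * m - c' * c' - (m * c' - c' * m).
        nc_ring.
      by rewrite mc' gE !subrr.
    by rewrite rho0l.
  have gv : rho g v = 0.
    apply: (nsq_le0 ipP); rewrite nsq_rho gs -/m mcv (ipNl ipP) ReN.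
    by rewrite oppr_le0.
  have mv0 : rho m v = 0 by rewrite (rhoM rhoP) gv rho0.
  have cv0 : rho c' v = 0 by apply: oppr_inj; rewrite -mcv mv0 oppr0.
  apply: (nsq_eq0 ipP); rewrite /nsq {1}/v.
  have -> : m - c' = star (m - c') by rewrite starB ms cs.
  by rewrite (rhoJ rhoP) rhoBl mv0 cv0 subr0 (ip0r ipP).
pose k := (Num.sqrt l)%:C%C *: g.
have kk : k * k = c.
  rewrite -scalerAl -scalerAr scalerA -rmorphM /= -expr2 sqr_sqrtr ?ltW//.
  by rewrite -/m mc -cE.
apply: (@nu_cos_le1 a k) => //.
- by rewrite starZr gs.
- rewrite -scalerAl -scalerAr gc// -scalerAl -scalerAr; congr (_ *: _).
  by rewrite mulrBr mulrBl mulr1 mul1r mulrA.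
- by rewrite kk addrC subrK.
Qed.

(** The C*-identity reduces this to the self-adjoint case, applied to a^* a divided by q^2. *)
Lemma rho_boundV a (q : R) : 0 <= q ->
  (forall x, nsq (rho a x) <= q ^+ 2 * nsq x) -> nu a <= q.
Proof.
move=> q0 aq; have [q_eq0|qn0] := eqVneq q 0.
  rewrite (rho_inj rhoP (a := a)) ?(nu0 nuP)// => x.
  by apply: (nsq_le0 ipP); rewrite (le_trans (aq x))// q_eq0 expr0n mul0r.
have qp : 0 < q by rewrite lt_neqAle eq_sym qn0.
have q2 : 0 < q ^+ 2 by rewrite exprn_gt0.
(* The bound passes to the adjoint by expanding the squared norm of a a^* x - q^2 x, which is
   nonnegative. *)
have asq x : nsq (rho (star a) x) <= q ^+ 2 * nsq x.
  have := nsq_ge0 ipP (rho a (rho (star a) x) - (q ^+ 2)%:C%C *: x).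
  rewrite (nsqB ipP) (nsqZr ipP) (ipZr ipP) conj_real ReZ.
  have -> : complex.Re (ip (rho a (rho (star a) x)) x) = nsq (rho (star a) x).
    by rewrite nsq_rho starK (rhoM rhoP).
  have := aq (rho (star a) x); set r := nsq _; set s := nsq _; set t := nsq _.
  move=> l1 l2; have : q ^+ 2 * s <= q ^+ 2 * (q ^+ 2 * t) by lra.
  by rewrite ler_pM2l.
have h1 : nu ((q ^- 2)%:C%C *: (star a * a)) <= 1.
  apply: rho_bound_sa => [|x]; first by rewrite starZr starM starK.
  rewrite (rhoZl rhoP) (nsqZr ipP) (rhoM rhoP) exprVn ler_pdivrMl ?exprn_gt0//.
  rewrite expr2 -mulrA (le_trans (asq _))// ler_pM2l//.
rewrite -(ler_pXn2r (ltn0Sn 1)) ?nnegrE ?(nu_ge0 nuP)//.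
by move: h1; rewrite (nuZr nuP) ?invr_ge0 ?(ltW q2)// mulrC ler_pdivrMr// mul1r (nuC nuP).
Qed.

End CstarNormTheory.

(* Injective *-homomorphisms into represented algebras are isometric, since both
   norms are the operator norm of the same representation. *)
Lemma faithful_rep_nu_eq (R : realType) (W W' : starAlgType R)
    (V : lmodType R[i]) (ip : V -> V -> R[i]) (nu : W -> R) (nu' : W' -> R)
    (rho : W -> V -> V) (rho' : W' -> V -> V) (f : W -> W') :
  cstar_norm nu -> cstar_norm nu' -> prehilbert ip ->
  faithful_rep ip rho -> faithful_rep ip rho' ->
  (forall a x, rho' (f a) x = rho a x) -> forall a, nu' (f a) = nu a.
Proof.
move=> nuP nuP' ipP rhoP rhoP' fE a; apply/eqP; rewrite eq_le; apply/andP; split.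
  apply: (rho_boundV nuP' ipP rhoP'); first exact: (nu_ge0 nuP).
  by move=> x; rewrite fE (rho_bound nuP ipP rhoP).
apply: (rho_boundV nuP ipP rhoP); first exact: (nu_ge0 nuP').
by move=> x; rewrite -fE (rho_bound nuP' ipP rhoP').
Qed.

(** * Matrix units and matrices over a star algebra *)

Lemma eventually_forall (I : finType) (P : I -> nat -> Prop) :
  (forall i, exists N, forall n, (N <= n)%N -> P i n) ->
  exists N, forall n, (N <= n)%N -> forall i, P i n.
Proof.
move=> /choice[N NP]; exists (\max_i N i)%N => n Nn i; apply: NP.
exact: leq_trans (leq_bigmax i) Nn.
Qed.

Lemma sum_delta (V : nmodType) (I : finType) (j : I) (F : I -> V) :
  \sum_k F k *+ (j == k) = F j.
Proof.
rewrite (bigD1 j)//= eqxx big1 ?addr0// => k kj.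
by rewrite eq_sym (negPf kj).
Qed.

Lemma sum_delta_sym (V : nmodType) (I : finType) (j : I) (F : I -> V) :
  \sum_k F k *+ (k == j) = F j.
Proof. by under eq_bigr do rewrite eq_sym; exact: sum_delta. Qed.

Section GramSchmidt.
Context {R : realType} {V : lmodType R[i]} {ip : V -> V -> R[i]}.
Hypothesis ipP : prehilbert ip.

Definition orthonormal m (f : 'I_m -> V) := forall i j, ip (f i) (f j) = (i == j)%:R.

Definition expands m (f : 'I_m -> V) v := v = \sum_i ip v (f i) *: f i.

(** [P] stands for a subspace containing [s], such as the range of a projection; the basis stays
    inside it. Vectors already in the span add nothing, so m may be 0. *)
Lemma gram_schmidt (P : V -> Prop) (s : seq V) :
  (forall x y, P x -> P y -> P (x + y)) -> (forall c x, P x -> P (c *: x)) ->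
  (forall v, v \in s -> P v) ->
  exists m (f : 'I_m -> V), [/\ orthonormal f, forall i, P (f i) &
    forall v, v \in s -> expands f v].
Proof.
move=> PD PZ; elim: s => [|v s IH] sP.
  exists 0%N, (fun=> 0); split=> //; first by case.
  by case.
have [|m [f [fo fP fe]]] := IH.
  by move=> w ws; apply: sP; rewrite in_cons ws orbT.
have Pv : P v by apply: sP; rewrite mem_head.
have Psum (c : 'I_m -> R[i]) : P (v - \sum_i c i *: f i).
  rewrite -sumrN; elim/big_rec: _ => [|i x _ Px]; first by rewrite addr0.
  rewrite addrCA -scaleNr; apply: PD => //; exact: PZ.
set w := v - \sum_i ip v (f i) *: f i.
have wf i : ip w (f i) = 0.
  rewrite (ipBl ipP) (ip_suml ipP); under eq_bigr do rewrite (ipZl ipP) fo mulr_natr.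
  by rewrite sum_delta_sym subrr.
have fw i : ip (f i) w = 0 by rewrite (ipC ipP w) wf rmorph0.
have [w0|w0] := eqVneq w 0.
  exists m, f; split=> // x; rewrite in_cons => /predU1P[->|/fe//].
  by apply/eqP; rewrite -subr_eq0 -/w w0.
have nw : 0 < nsq ip w.
  rewrite lt_neqAle (nsq_ge0 ipP) andbT eq_sym; apply: contraNneq w0.
  by move/(nsq_eq0 ipP) ->.
pose r := Num.sqrt (nsq ip w); have r0 : 0 < r by rewrite sqrtr_gt0.
pose g := (r^-1)%:C%C *: w.
have gf i : ip g (f i) = 0 by rewrite (ipZl ipP) wf mulr0.
have fg i : ip (f i) g = 0 by rewrite (ipZr ipP) fw mulr0.
have gg : ip g g = 1.
  rewrite (ip_nsq ipP) (nsqZr ipP) exprVn sqr_sqrtr ?ltW//.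
  by rewrite mulVf ?gt_eqF.
have wg : w = ip w g *: g.
  rewrite /g (ipZr ipP) conj_real (ip_nsq ipP) scalerA -!rmorphM /=.
  rewrite -mulrA mulrCA -invfM -expr2 sqr_sqrtr ?ltW// divff ?gt_eqF//.
  by rewrite scale1r.
pose f' (i : 'I_m.+1) := oapp f g (unlift ord0 i).
have f'0 : f' ord0 = g by rewrite /f' unlift_none.
have f'S i : f' (lift ord0 i) = f i by rewrite /f' liftK.
exists m.+1, f'; split.
- move=> i j; case: (unliftP ord0 i) => [i'|] ->; case: (unliftP ord0 j) => [j'|] ->;
    rewrite ?f'0 ?f'S ?f'S ?gf ?fg ?gg ?eqxx//.
- move=> i; case: (unliftP ord0 i) => [i'|] ->; rewrite ?f'0 ?f'S//.
  exact/PZ/Psum.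
move=> x; rewrite in_cons /expands big_ord_recl f'0.
under eq_bigr do rewrite f'S.
move=> /predU1P[->|/fe xE].
  have -> : ip v g = ip w g.
    rewrite (ipBl ipP) (ip_suml ipP) big1 ?subr0// => i _.
    by rewrite (ipZl ipP) fg mulr0.
  by rewrite -wg /w subrK.
suff -> : ip x g = 0 by rewrite scale0r add0r.
by rewrite xE (ip_suml ipP) big1// => i _; rewrite (ipZl ipP) fg mulr0.
Qed.

Lemma nsq_orthonormal m (f : 'I_m -> V) (c : 'I_m -> R[i]) : orthonormal f ->
  nsq ip (\sum_i c i *: f i) = \sum_i Normc.normc (c i) ^+ 2.
Proof.
move=> fo; rewrite /nsq (ip_suml ipP).
under eq_bigr => i _.
  rewrite (ipZl ipP) (ip_sumr ipP).
  under eq_bigr do rewrite (ipZr ipP) fo mulr_natr.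
  rewrite sum_delta -normCK normc_def -rmorphXn; over.
rewrite -rmorph_sum /=; apply: eq_bigr => i _.
by case: (c i).
Qed.

End GramSchmidt.

Section StarHom.
Context {R : realType}.

Record star_hom (A B : starAlgType R) (f : A -> B) : Prop := StarHom {
  shD : forall x y, f (x + y) = f x + f y;
  shZ : forall (c : R[i]) x, f (c *: x) = c *: f x;
  shM : forall x y, f (x * y) = f x * f y;
  shJ : forall x, f (star x) = star (f x);
  sh1 : f 1 = 1
}.

Lemma star_hom_lrmorphism (A B : starAlgType R) (f : {lrmorphism A -> B}) :
  star_preserving f -> star_hom f.
Proof.
by split; [exact: rmorphD|move=> c x; exact: linearZ|exact: rmorphM| |exact: rmorph1].
Qed.

Lemma star_hom_comp (A B D : starAlgType R) (f : A -> B) (g : B -> D) :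
  star_hom f -> star_hom g -> star_hom (g \o f).
Proof.
move=> fP gP; split=> [x y|c x|x y|x|] /=.
- by rewrite (shD fP) (shD gP).
- by rewrite (shZ fP) (shZ gP).
- by rewrite (shM fP) (shM gP).
- by rewrite (shJ fP) (shJ gP).
- by rewrite (sh1 fP) (sh1 gP).
Qed.

Context {A B : starAlgType R} {f : A -> B}.
Hypothesis fP : star_hom f.

Lemma sh0 : f 0 = 0.
Proof. by rewrite -(scale0r (0 : A)) (shZ fP) scale0r. Qed.

Lemma shN x : f (- x) = - f x.
Proof. by rewrite -[- x]scaleN1r (shZ fP) scaleN1r. Qed.

Lemma shB x y : f (x - y) = f x - f y.
Proof. by rewrite (shD fP) shN. Qed.

Lemma sh_sum I (s : seq I) (P : pred I) (F : I -> A) :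
  f (\sum_(i <- s | P i) F i) = \sum_(i <- s | P i) f (F i).
Proof. exact: (big_morph f (shD fP) sh0). Qed.

End StarHom.

Section MatrixUnits.
Context {R : realType} {W : starAlgType R} {n : nat}.

Record munits (E : 'I_n -> 'I_n -> W) : Prop := MUnits {
  muM : forall i j k l, E i j * E k l = E i l *+ (j == k);
  muJ : forall i j, star (E i j) = E j i;
  mu1 : \sum_i E i i = 1
}.

Context {E : 'I_n -> 'I_n -> W}.
Hypothesis EP : munits E.

Lemma munits_nu_le1 (nu : W -> R) i j : cstar_norm nu -> nu (E i j) <= 1.
Proof.
move=> nuP; have p1 k : nu (E k k) <= 1.
  have := nuC nuP (E k k); rewrite (muJ EP) (muM EP) eqxx mulr1n.
  by have := nu_ge0 nuP (E k k); set r := nu _; nra.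
have := nuC nuP (E i j); rewrite (muJ EP) (muM EP) eqxx mulr1n => e.
have := p1 j; have := nu_ge0 nuP (E i j); rewrite e; set r := nu _; nra.
Qed.

End MatrixUnits.

(** An alias, because matrices over [B] are scaled by [B], while here they form an algebra over the
    complex numbers. *)
Definition cmat (R : realType) (B : starAlgType R) (n : nat) := 'M[B]_n.+1.

Section MatrixAlgebra.
Context {R : realType} (B : starAlgType R) (n : nat).
Local Notation M := (cmat B n).

HB.instance Definition _ := GRing.NzRing.copy M 'M[B]_n.+1.

Definition cmat_scale (c : R[i]) (X : M) : M := map_mx (fun b => c *: b) X.

Fact cmat_scaleA a b (X : M) : cmat_scale a (cmat_scale b X) = cmat_scale (a * b) X.
Proof. by apply/matrixP => i j; rewrite !mxE scalerA. Qed.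

Fact cmat_scale1 : left_id 1 cmat_scale.
Proof. by move=> X; apply/matrixP => i j; rewrite !mxE scale1r. Qed.

Fact cmat_scaleDr : right_distributive cmat_scale +%R.
Proof. by move=> a X Y; apply/matrixP => i j; rewrite !mxE scalerDr. Qed.

Fact cmat_scaleDl (X : M) : {morph cmat_scale^~ X : a b / a + b}.
Proof. by move=> a b; apply/matrixP => i j; rewrite !mxE scalerDl. Qed.

HB.instance Definition _ := GRing.Zmodule_isLmodule.Build R[i] M
  cmat_scaleA cmat_scale1 cmat_scaleDr cmat_scaleDl.

Fact cmat_scaleAl (a : R[i]) (X Y : M) : a *: (X * Y) = a *: X * Y.
Proof.
apply/matrixP => i j; rewrite !mxE scaler_sumr; apply: eq_bigr => k _.
by rewrite !mxE scalerAl.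
Qed.

HB.instance Definition _ := GRing.Lmodule_isLalgebra.Build R[i] M cmat_scaleAl.

Fact cmat_scaleAr (a : R[i]) (X Y : M) : a *: (X * Y) = X * (a *: Y).
Proof.
apply/matrixP => i j; rewrite !mxE scaler_sumr; apply: eq_bigr => k _.
by rewrite !mxE scalerAr.
Qed.

HB.instance Definition _ := GRing.Lalgebra_isAlgebra.Build R[i] M cmat_scaleAr.

Fact cmat_starD : {morph (@adjmx R B n.+1 n.+1 : M -> M) : X Y / X + Y}.
Proof. by move=> X Y; apply/matrixP => i j; rewrite !mxE starD. Qed.

Fact cmat_starZ (c : R[i]) (X : M) : adjmx (c *: X) = c^* *: (adjmx X : M).
Proof. by apply/matrixP => i j; rewrite !mxE starZ. Qed.

HB.instance Definition _ := isStarAlgebra.Build R M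
  (@adjmxK R B n.+1 n.+1) cmat_starD cmat_starZ (@adjmxM R B n.+1 n.+1 n.+1).

Lemma cmat_starE (X : M) i j : (star X) i j = star (X j i).
Proof. by rewrite !mxE. Qed.

Lemma cmat_mulE (X Y : M) i j : (X * Y) i j = \sum_k X i k * Y k j.
Proof. by rewrite mxE. Qed.

Lemma cmat_scaleE c (X : M) i j : (c *: X) i j = c *: X i j.
Proof. by rewrite mxE. Qed.

Lemma cmat_1E i j : (1 : M) i j = 1 *+ (i == j).
Proof. by rewrite mxE. Qed.

End MatrixAlgebra.

Section MatrixRep.
Context {R : realType} {B : starAlgType R} {V : lmodType R[i]} {n : nat}.
Context {ip : V -> V -> R[i]} {rho : B -> V -> V}.
Hypothesis ipP : prehilbert ip.
Local Notation Vn := {ffun 'I_n.+1 -> V}.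

Definition ipn (x y : Vn) : R[i] := \sum_i ip (x i) (y i).

Definition rhon (X : cmat B n) (x : Vn) : Vn := [ffun a => \sum_b rho (X a b) (x b)].

Lemma nsq_ipn (x : Vn) : nsq ipn x = \sum_i nsq ip (x i).
Proof.
rewrite /nsq /ipn; under eq_bigr do rewrite (ip_nsq ipP).
by rewrite -rmorph_sum.
Qed.

Lemma ipn_prehilbert : prehilbert ipn.
Proof.
split=> [x y z|c x y|x y|x|x x0].
- by rewrite -big_split; apply: eq_bigr => i _; rewrite ffunE (ipDl ipP).
- by rewrite /ipn mulr_sumr; apply: eq_bigr => i _; rewrite ffunE (ipZl ipP).
- by rewrite rmorph_sum; apply: eq_bigr => i _ /=; rewrite -(ipC ipP).
- by apply: sumr_ge0 => i _; exact: (ip_ge0 ipP).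
apply/ffunP => i; rewrite ffunE; apply: (ip_eq0 ipP).
have /eqP := x0; rewrite psumr_eq0 => [/allP/(_ i)|j _]; last exact: (ip_ge0 ipP).
by rewrite mem_index_enum => /(_ isT)/eqP.
Qed.

Hypothesis rhoP : faithful_rep ip rho.

Lemma rhon_faithful : faithful_rep ipn rhon.
Proof.
split=> [X x y|X c x|X Y x|c X x|X Y x|X x y|X X0].
- apply/ffunP => a; rewrite !ffunE -big_split; apply: eq_bigr => b _.
  by rewrite ffunE (rhoD rhoP).
- apply/ffunP => a; rewrite !ffunE scaler_sumr; apply: eq_bigr => b _.
  by rewrite ffunE (rhoZ rhoP).
- apply/ffunP => a; rewrite !ffunE -big_split; apply: eq_bigr => b _.
  by rewrite mxE (rhoDl rhoP).
- apply/ffunP => a; rewrite !ffunE scaler_sumr; apply: eq_bigr => b _.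
  by rewrite cmat_scaleE (rhoZl rhoP).
- apply/ffunP => a; rewrite !ffunE.
  under eq_bigr => b _.
    rewrite cmat_mulE.
    rewrite (big_morph (rho^~ (x b)) (fun u v => rhoDl rhoP u v (x b)) (rho0l rhoP (x b))).
    under eq_bigr do rewrite (rhoM rhoP); over.
  rewrite exchange_big; apply: eq_bigr => k _ /=; rewrite ffunE.
  by rewrite (big_morph (rho (X a k)) (rhoD rhoP _) (rho0 rhoP _)).
- rewrite /ipn; under eq_bigr => a _.
    rewrite ffunE (ip_suml ipP).
    under eq_bigr do rewrite cmat_starE (rhoJ rhoP); over.
  rewrite exchange_big; apply: eq_bigr => b _ /=.
  by rewrite ffunE (ip_sumr ipP).
apply/matrixP => a b; rewrite mxE; apply: (rho_inj rhoP) => v.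
have /ffunP/(_ a) := X0 [ffun i => v *+ (i == b)]; rewrite !ffunE.
rewrite -[RHS]/0 => <-; rewrite (bigD1 b)//= ffunE eqxx mulr1n big1 ?addr0// => i ib.
by rewrite ffunE (negPf ib) (rho0 rhoP).
Qed.

End MatrixRep.

Arguments ipn {R V n} ip.
Arguments rhon {R B V n} rho.

Section MatrixNorm.
Context {R : realType} {B A : starAlgType R} {n : nat}.
Context {nuB : B -> R} {nuA : A -> R} {th : B -> A} {E : 'I_n.+1 -> 'I_n.+1 -> A}.

(** When [th] commutes with the matrix units [E], this embeds the matrices over B into A; their
    C*-norm is defined by pulling back that of A. *)
Definition mx_embed (th : B -> A) (E : 'I_n.+1 -> 'I_n.+1 -> A) (X : cmat B n) : A :=
  \sum_a \sum_b th (X a b) * E a b.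

Implicit Types X Y : cmat B n.

Hypotheses (thP : star_hom th) (EP : munits E).
Hypothesis thE : forall b i j, th b * E i j = E i j * th b.

(** Recovering the entries from the image makes the pulled back norm equivalent to the sum of the
    entry norms, hence definite and complete. *)
Lemma mx_embed_entry X a b :
  \sum_c E c a * mx_embed th E X * E b c = th (X a b).
Proof.
have entry c : E c a * mx_embed th E X * E b c = th (X a b) * E c c.
  rewrite mulr_sumr mulr_suml (bigD1 a)//= [X in _ + X]big1 => [|i ia].
    rewrite addr0 mulr_sumr mulr_suml (bigD1 b)//= [X in _ + X]big1 => [|j jb].
      by rewrite addr0 mulrA -thE -!mulrA !(muM EP, eqxx, mulr1n).
    by rewrite -!mulrA (muM EP) (negPf jb) mulr0n !mulr0.
  rewrite mulr_sumr mulr_suml big1// => j _.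
  by rewrite mulrA -thE -(mulrA (th _)) (muM EP) eq_sym (negPf ia) mulr0n mulr0 mul0r.
by under eq_bigr do rewrite entry; rewrite -mulr_sumr (mu1 EP) mulr1.
Qed.

Lemma mx_embed_hom : star_hom (mx_embed th E).
Proof.
split=> [X Y|c X|X Y|X|].
- rewrite -big_split; apply: eq_bigr => a _; rewrite -big_split; apply: eq_bigr => b _.
  by rewrite mxE (shD thP) mulrDl.
- rewrite scaler_sumr; apply: eq_bigr => a _; rewrite scaler_sumr; apply: eq_bigr => b _.
  by rewrite cmat_scaleE (shZ thP) scalerAl.
- rewrite /mx_embed mulr_suml; apply: eq_bigr => a _.
  rewrite mulr_suml.
  under eq_bigr do rewrite cmat_mulE (sh_sum thP) mulr_suml.
  rewrite exchange_big; apply: eq_bigr => k _ /=.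
  rewrite mulr_sumr [RHS](bigD1 k)//= [X in _ = _ + X]big1 ?addr0 => [|i ik].
    rewrite mulr_sumr; apply: eq_bigr => b _.
    by rewrite (shM thP) -!mulrA (mulrA (E a k)) -thE -mulrA (muM EP) eqxx mulr1n.
  rewrite mulr_sumr big1// => j _.
  by rewrite -!mulrA (mulrA (E a k)) -thE -mulrA (muM EP) eq_sym (negPf ik) mulr0n !mulr0.
- rewrite /mx_embed star_sum exchange_big; apply: eq_bigr => a _ /=.
  rewrite star_sum; apply: eq_bigr => b _.
  by rewrite cmat_starE starM (muJ EP) -(shJ thP) thE.
- rewrite /mx_embed -(mu1 EP); apply: eq_bigr => a _.
  rewrite (bigD1 a)//= big1 ?addr0 => [|b ba].
    by rewrite cmat_1E eqxx mulr1n (sh1 thP) mul1r.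
  by rewrite cmat_1E eq_sym (negPf ba) (sh0 thP) mul0r.
Qed.

Hypotheses (nuBP : star_norm nuB) (nuAP : cstar_norm nuA).
Hypothesis th_iso : forall b, nuA (th b) = nuB b.

Lemma mx_embed_ge X a b : nuB (X a b) <= n.+1%:R * nuA (mx_embed th E X).
Proof.
rewrite -th_iso -mx_embed_entry; apply: le_trans (nu_sum nuAP _ _ _) _.
apply: le_trans (_ : \sum_(i < n.+1) nuA (mx_embed th E X) <= _).
  apply: ler_sum => c _; rewrite -[leRHS]mulr1 (nuM_le nuAP)//; last exact: (munits_nu_le1 EP _ _ nuAP).
  by rewrite -[leRHS]mul1r (nuM_le nuAP)//; exact: (munits_nu_le1 EP _ _ nuAP).
by rewrite sumr_const card_ord mulr_natl.
Qed.

Lemma mx_embed_le X : nuA (mx_embed th E X) <= \sum_a \sum_b nuB (X a b).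
Proof.
apply: le_trans (nu_sum nuAP _ _ _) _; apply: ler_sum => a _.
apply: le_trans (nu_sum nuAP _ _ _) _; apply: ler_sum => b _.
rewrite -[leRHS]mulr1 (nuM_le nuAP)//; first by rewrite th_iso.
exact: (munits_nu_le1 EP _ _ nuAP).
Qed.

Lemma mx_entrywise_complete (N : cmat B n -> R) (K : R) : 0 < K ->
  (forall X Y a b, nuB (X a b - Y a b) <= K * N (X - Y)) ->
  (forall X, N X <= K * \sum_a \sum_b nuB (X a b)) ->
  forall u : nat -> cmat B n,
    (forall e, 0 < e -> exists N0, forall p q, (N0 <= p)%N -> (N0 <= q)%N ->
       N (u p - u q) < e) ->
    exists l, forall e, 0 < e -> exists N0, forall p, (N0 <= p)%N -> N (u p - l) < e.
Proof.
move=> K0 ge le u uC.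
have /choice[l lE] (ab : 'I_n.+1 * 'I_n.+1) : exists l, cvgto (nu := nuB) (fun p => u p ab.1 ab.2) l.
  apply: (nu_complete nuBP) => e e0.
  have [N0 uN] := uC _ (divr_gt0 e0 K0); exists N0 => p q Np Nq.
  apply: le_lt_trans (ge _ _ _ _) _.
  by rewrite mulrC -ltr_pdivlMr// uN.
exists (\matrix_(a, b) l (a, b)) => e e0.
pose c : R := K * (n.+1%:R * n.+1%:R); have c0 : 0 < c by rewrite !mulr_gt0.
have [N0 uN] := eventually_forall (fun ab => lE ab _ (divr_gt0 e0 c0)).
exists N0 => p /uN h; apply: le_lt_trans (le _) _.
rewrite -ltr_pdivlMl//.
apply: (@lt_le_trans _ _ (\sum_(a < n.+1) \sum_(b < n.+1) (e / c))); last first.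
  rewrite !sumr_const !card_ord -mulrnA -[_ *+ (_ * _)]mulr_natr natrM /c.
  by rewrite le_eqVlt; apply/orP; left; apply/eqP; field; rewrite !gt_eqF//= ltr0Sn.
have lt0 a b : nuB ((u p - \matrix_(a, b) l (a, b)) a b) < e / c.
  by rewrite !mxE; exact: (h (a, b)).
have has0 : has predT (index_enum 'I_n.+1).
  by apply/hasP; exists ord0 => //; rewrite mem_index_enum.
by apply: ltr_sum => // a _; apply: ltr_sum => // b _; exact: lt0.
Qed.

Lemma mx_embed_cstar_norm : cstar_norm (fun X => nuA (mx_embed th E X)).
Proof.
have hP := mx_embed_hom; split; first split.
- move=> X /(nu_eq0 nuAP) X0; apply/matrixP => a b; rewrite mxE.
  apply: (nu_eq0 nuBP); apply/eqP; rewrite eq_le (nu_ge0 nuBP) andbT.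
  by rewrite (le_trans (mx_embed_ge _ _ _))// X0 (nu0 nuAP) mulr0.
- by move=> X Y; rewrite (shD hP) (nuD nuAP).
- by move=> c X; rewrite (shZ hP) (nuZ nuAP).
- by move=> X Y; rewrite (shM hP) (nuM nuAP).
- by move=> X; rewrite (shJ hP) (nuJ nuAP).
- apply: (mx_entrywise_complete (N := fun X => nuA (mx_embed th E X)) (ltr0Sn R n)) => [X Y a b|X].
    by have := mx_embed_ge (X - Y) a b; rewrite !mxE.
  apply: le_trans (mx_embed_le X) _; rewrite ler_peMl//.
    by apply: sumr_ge0 => a _; apply: sumr_ge0 => b _; exact: nu_ge0.
  by rewrite ler1n.
- by move=> X; rewrite (shM hP) (shJ hP) (nuC nuAP).
Qed.

End MatrixNorm.

(** Available over any normed algebra without matrix units, at the price of the C*-identity;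
    projections over a UHF algebra are perturbed in this norm. *)
Definition nu_entries (R : realType) (B : starAlgType R) n (nuB : B -> R)
    (X : cmat B n) : R := \sum_a \sum_b nuB (X a b).

Lemma nu_entries_star_norm (R : realType) (B : starAlgType R) n (nuB : B -> R) :
  star_norm nuB -> star_norm (@nu_entries R B n nuB).
Proof.
move=> nuP; have s0 (X : cmat B n) a b : nuB (X a b) <= nu_entries nuB X.
  rewrite /nu_entries (bigD1 a)//= (bigD1 b)//= -addrA lerDl addr_ge0//.
    by apply: sumr_ge0 => j _; exact: nu_ge0.
  by apply: sumr_ge0 => i _; apply: sumr_ge0 => j _; exact: nu_ge0.
split.
- move=> X X0; apply/matrixP => a b; rewrite mxE; apply: (nu_eq0 nuP).
  by apply/eqP; rewrite eq_le (nu_ge0 nuP) andbT -X0.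
- move=> X Y; rewrite -big_split; apply: ler_sum => a _.
  rewrite -big_split; apply: ler_sum => b _; rewrite mxE; exact: (nuD nuP).
- move=> c X; rewrite mulr_sumr; apply: eq_bigr => a _.
  by rewrite mulr_sumr; apply: eq_bigr => b _; rewrite cmat_scaleE (nuZ nuP).
- move=> X Y; rewrite {2}/nu_entries mulr_suml; apply: ler_sum => a _.
  apply: (@le_trans _ _ (\sum_b \sum_k nuB (X a k) * nuB (Y k b))).
    apply: ler_sum => b _; rewrite cmat_mulE; apply: le_trans (nu_sum nuP _ _ _) _.
    by apply: ler_sum => k _; exact: (nuM nuP).
  rewrite exchange_big mulr_suml; apply: ler_sum => k _ /=.
  rewrite -mulr_sumr ler_wpM2l ?(nu_ge0 nuP)//.
  rewrite /nu_entries [leRHS](bigD1 k)//= lerDl.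
  by apply: sumr_ge0 => i _; apply: sumr_ge0 => j _; exact: nu_ge0.
- move=> X; rewrite /nu_entries exchange_big; apply: eq_bigr => a _ /=.
  by apply: eq_bigr => b _; rewrite cmat_starE (nuJ nuP).
- apply: (mx_entrywise_complete nuP (N := nu_entries nuB) ltr01) => [X Y a b|X].
    by have := s0 (X - Y) a b; rewrite !mxE mul1r.
  by rewrite mul1r.
Qed.

(** * Spatial tensor products *)

Section Limits.
Context {R : realType}.

Lemma cvg0_eps (x : nat -> R) : x n @[n --> \oo] --> (0 : R) ->
  forall e, 0 < e -> exists N, forall n, (N <= n)%N -> x n < e.
Proof.
move=> /cvgrPdist_lt x0 e /x0[N _ xN]; exists N => n /xN /=.
by rewrite sub0r normrN; apply: le_lt_trans; exact: ler_norm.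
Qed.

Lemma eps_cauchy_cvg (x : nat -> R) :
  (forall e, 0 < e -> exists N, forall m n, (N <= m)%N -> (N <= n)%N ->
     `|x m - x n| < e) ->
  exists l, forall e, 0 < e -> exists N, forall n, (N <= n)%N -> `|x n - l| < e.
Proof.
move=> xC; have cx : cvg (x n @[n --> \oo]).
  apply/cauchy_cvgP/cauchy_exP => e /= /xC[N xN]; exists (x N).
  by exists N => // n Nn; exact: xN.
exists (limn x) => e e0; have /cvgrPdist_lt/(_ e e0)[N _ xN] := cx.
by exists N => n /xN /=; rewrite distrC.
Qed.

Lemma normc_ge_Re (z : R[i]) : `|complex.Re z| <= Normc.normc z.
Proof.
by case: z => a b /=; rewrite -sqrtr_sqr ler_wsqrtr// lerDl sqr_ge0.
Qed.

Lemma normc_ge_Im (z : R[i]) : `|complex.Im z| <= Normc.normc z.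
Proof.
by case: z => a b /=; rewrite -sqrtr_sqr ler_wsqrtr// lerDr sqr_ge0.
Qed.

Lemma normc_le_ReIm (z : R[i]) : Normc.normc z <= `|complex.Re z| + `|complex.Im z|.
Proof.
case: z => a b /=; rewrite -[leRHS]ger0_norm ?addr_ge0// -sqrtr_sqr ler_wsqrtr//.
rewrite sqrrD !real_normK ?num_real// -addrA lerD2l lerDr.
by rewrite mulrn_wge0// mulr_ge0.
Qed.

Lemma normcJ (z : R[i]) : Normc.normc z^* = Normc.normc z.
Proof. by case: z => a b; rewrite /= sqrrN. Qed.

Lemma normc_star_norm : star_norm (@Normc.normc R : (R[i])^o -> R).
Proof.
split=> [z /Normc.eq0_normc//|||||].
- exact: le_normcD.
- exact: Normc.normcM.
- by move=> a b; rewrite Normc.normcM.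
- exact: normcJ.
move=> u uC.
have [|a aP] := @eps_cauchy_cvg (fun n => complex.Re (u n)).
  move=> e /uC[N uN]; exists N => m n Nm Nn; apply: le_lt_trans (uN _ _ Nm Nn).
  by rewrite -ReN -ReD; exact: normc_ge_Re.
have [|b bP] := @eps_cauchy_cvg (fun n => complex.Im (u n)).
  move=> e /uC[N uN]; exists N => m n Nm Nn; apply: le_lt_trans (uN _ _ Nm Nn).
  have -> : complex.Im (u m) - complex.Im (u n) = complex.Im (u m - u n).
    by case: (u m) => ? ?; case: (u n).
  exact: normc_ge_Im.
exists (Complex a b) => e e0; have e2 : 0 < e / 2 by rewrite divr_gt0.
have [N aN] := aP _ e2; have [M bM] := bP _ e2.
exists (maxn N M) => n; rewrite geq_max => /andP[/aN lea /bM leb].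
apply: le_lt_trans (normc_le_ReIm _) _; move: lea leb.
by case: (u n) => c d /=; lra.
Qed.

End Limits.

Lemma cnorm_cstar_norm (R : realType) (A : cstarAlgType R) :
  cstar_norm (@cnorm R A).
Proof.
have n0 : cnorm (0 : A) = 0.
  by rewrite -(scale0r (0 : A)) cnormZ /Normc.normc /= expr0n addr0 sqrtr0 mul0r.
have nN (a : A) : cnorm (- a) = cnorm a.
  rewrite -scaleN1r cnormZ /Normc.normc /= oppr0.
  by rewrite [0 ^+ 2]expr0n addr0 sqrrN expr1n sqrtr1 mul1r.
have ge0 (a : A) : 0 <= cnorm a.
  by have := cnormD_le a (- a); rewrite subrr n0 nN; lra.
have leJ (a : A) : cnorm a <= cnorm (star a).
  have := cnormM_le (star a) a; rewrite cnorm_starM expr2.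
  have [-> _|a0] := eqVneq (cnorm a) 0; first exact: ge0.
  by rewrite ler_pM2r// lt_neqAle eq_sym a0 ge0.
split; last exact: cnorm_starM.
split; [exact: cnorm0_eq0|exact: cnormD_le|exact: cnormZ|exact: cnormM_le| |].
  by move=> a; apply/eqP; rewrite eq_le leJ -{2}(starK a) leJ.
move=> u /cnorm_complete[l ul]; exists l => e e0.
by have [N uN] := cvg0_eps ul e0; exists N.
Qed.

Section HilbertSpace.
Context {R : realType} {H : hilbertType R}.
Implicit Types x y : H.
Local Notation ip := (@inner R H).

Lemma inner_prehilbert : prehilbert ip.
Proof.
split; [exact: innerDl|exact: innerZl|exact: innerC| |].
  by move=> x; rewrite inner_norm exprn_ge0.
by move=> x /eqP; rewrite inner_norm sqrf_eq0 normr_eq0 => /eqP.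
Qed.

Lemma norm_nsq x : `|x| ^+ 2 = (nsq ip x)%:C%C.
Proof. by rewrite -inner_norm (ip_nsq inner_prehilbert). Qed.

Lemma nsq_le_norm x y (e : R) : 0 <= e ->
  `|x| <= e%:C%C * `|y| -> nsq ip x <= e ^+ 2 * nsq ip y.
Proof.
move=> e0 xy; rewrite -lecR rmorphM rmorphXn /= -!norm_nsq -exprMn.
by rewrite ler_pXn2r// nnegrE ?mulr_ge0// lecR.
Qed.

Lemma nsq_lt_norm x (e : R) : 0 < e -> (`|x| < e%:C%C) = (nsq ip x < e ^+ 2).
Proof.
move=> e0; rewrite -ltcR -norm_nsq rmorphXn /= ltr_pXn2r// nnegrE//.
by rewrite lecR ltW.
Qed.

Lemma dense_nsq (S : set H) : dense S ->
  forall x (e : R), 0 < e -> exists2 s, S s & nsq ip (x - s) < e.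
Proof.
move=> Sd x e e0; have r0 : 0 < Num.sqrt e by rewrite sqrtr_gt0.
have [|s [Bs Ss]] := Sd (ball x (Num.sqrt e)%:C%C) _ (ball_open x _).
  exists x; apply: ballxx; by rewrite ltcR.
exists s => //; move: Bs; rewrite -ball_normE /ball_ /=.
by rewrite nsq_lt_norm// sqr_sqrtr ?ltW.
Qed.

Lemma cvg_nsq (u : nat -> H) x : u n @[n --> \oo] --> x ->
  forall e : R, 0 < e -> exists N, forall n, (N <= n)%N -> nsq ip (u n - x) < e.
Proof.
move=> /cvgrPdist_lt ux e e0; have r0 : 0 < Num.sqrt e by rewrite sqrtr_gt0.
have [|N _ uN] := ux (Num.sqrt e)%:C%C; first by rewrite ltcR.
exists N => n /uN /=; rewrite distrC nsq_lt_norm// sqr_sqrtr ?ltW//.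
Qed.

Lemma representation_faithful_rep (A : starAlgType R) (pi : A -> H -> H) :
  faithful_representation pi -> faithful_rep ip pi.
Proof.
move=> [[bnd lin pM pJ] inj].
have linr a : linear (pi a) by have [] := bnd a.
have pD a b x : pi (a + b) x = pi a x + pi b x.
  by have := lin x 1 a b; rewrite !scale1r.
have p0 x : pi 0 x = 0.
  by have := pD 0 0 x; rewrite addr0 => /eqP; rewrite -subr_eq subrr eq_sym => /eqP.
split=> //.
- by move=> a x y; have := linr a 1 x y; rewrite !scale1r.
- move=> a c x; have := linr a c x 0; rewrite !addr0.
  have -> : pi a 0 = 0.
    by have := linr a (- 1) 0 0; rewrite scaler0 addr0 scaleN1r addNr.
  by rewrite addr0.
- by move=> c a x; have := lin x c a 0; rewrite !addr0 p0 addr0.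
- by move=> a a0; apply: inj; apply: funext => x; rewrite p0.
Qed.

End HilbertSpace.

Section TensorProduct.
Context {R : realType}.

(** The part of a spatial tensor product that mentions no Hilbert space; density of the span is
    carried as a separate hypothesis. *)
Record tensor_product (A B T : cstarAlgType R) (t : A -> B -> T) : Prop :=
  TensorProduct {
  tDl : forall a a' b, t (a + a') b = t a b + t a' b;
  tDr : forall a b b', t a (b + b') = t a b + t a b';
  tZl : forall c a b, t (c *: a) b = c *: t a b;
  tZr : forall c a b, t a (c *: b) = c *: t a b;
  tM : forall a b a' b', t a b * t a' b' = t (a * a') (b * b');
  tJ : forall a b, star (t a b) = t (star a) (star b);
  t11 : t 1 1 = 1;
  tl_iso : forall a, cnorm (t a 1) = cnorm a;
  tr_iso : forall b, cnorm (t 1 b) = cnorm b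
}.

Section TensorProperties.
Context {A B T : cstarAlgType R} {t : A -> B -> T}.
Context {H1 H2 K : hilbertType R} {h : H1 -> H2 -> K}.
Context {piA : A -> H1 -> H1} {piB : B -> H2 -> H2} {piT : T -> K -> K}.
Hypotheses (hP : hilbert_tensor h) (piAP : faithful_representation piA).
Hypotheses (piBP : faithful_representation piB) (piP : faithful_representation piT).
Hypothesis tE : forall a b x y, piT (t a b) (h x y) = h (piA a x) (piB b y).
Hypothesis t_dense : forall (z : T) (e : R), 0 < e ->
  exists (n : nat) (a : 'I_n -> A) (b : 'I_n -> B),
    cnorm (z - \sum_(i < n) t (a i) (b i)) < e.
Let rA := representation_faithful_rep piAP.
Let rB := representation_faithful_rep piBP.
Let rT := representation_faithful_rep piP.
Let ipK := @inner_prehilbert R K.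
Let nuT := @cnorm_cstar_norm R T.

(** Operators of T are bounded and the simple tensors span a dense subspace. *)
Lemma pi_ext (z : T) : (forall x y, piT z (h x y) = 0) -> z = 0.
Proof.
move=> z0; apply: (rho_inj rT) => k; have [_ _ _ hd] := hP.
apply: (nsq_le0 ipK); apply/ler_addgt0Pl => e e0; rewrite addr0.
have q0 : 0 < cnorm z ^+ 2 + 1 by have := sqr_ge0 (cnorm z); lra.
have [s [n [x [y sE]]] ks] := dense_nsq hd k (divr_gt0 e0 q0).
have zs0 : piT z s = 0.
  by rewrite sE (big_morph (piT z) (rhoD rT z) (rho0 rT z)) big1.
have -> : piT z k = piT z (k - s) by rewrite (rhoB rT) zs0 subr0.
apply: le_trans (rho_bound nuT ipK rT _ (lexx _)) _.
move: ks; rewrite ltr_pdivlMr//.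
have := nsq_ge0 ipK (k - s); have := sqr_ge0 (cnorm z).
by set r := nsq _ _; set q := _ ^+ 2; nra.
Qed.

Lemma pi_ext_eq (z z' : T) : (forall x y, piT z (h x y) = piT z' (h x y)) -> z = z'.
Proof.
move=> zz; apply/eqP; rewrite -subr_eq0; apply/eqP/pi_ext => x y.
by rewrite (rhoBl rT) zz subrr.
Qed.

Lemma hDl x x' y : h (x + x') y = h x y + h x' y.
Proof. by have [hl _ _ _] := hP; have := hl y 1 x x'; rewrite !scale1r. Qed.

Lemma hDr x y y' : h x (y + y') = h x y + h x y'.
Proof. by have [_ hr _ _] := hP; have := hr x 1 y y'; rewrite !scale1r. Qed.

Lemma h0l y : h 0 y = 0.
Proof.
by have [hl _ _ _] := hP; have := hl y (- 1) 0 0; rewrite scaler0 addr0 scaleN1r addNr.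
Qed.

Lemma h0r x : h x 0 = 0.
Proof.
by have [_ hr _ _] := hP; have := hr x (- 1) 0 0; rewrite scaler0 addr0 scaleN1r addNr.
Qed.

Lemma hZl c x y : h (c *: x) y = c *: h x y.
Proof. by have [hl _ _ _] := hP; have := hl y c x 0; rewrite !addr0 h0l addr0. Qed.

Lemma hZr c x y : h x (c *: y) = c *: h x y.
Proof. by have [_ hr _ _] := hP; have := hr x c y 0; rewrite !addr0 h0r addr0. Qed.

Lemma h_inner x y x' y' : inner (h x y) (h x' y') = inner x x' * inner y y'.
Proof. by have [_ _ hi _] := hP; exact: hi. Qed.

Lemma h_eq0 x y : h x y = 0 -> x = 0 \/ y = 0.
Proof.
move=> xy; have /eqP := h_inner x y x y; rewrite xy (ip0l ipK) eq_sym mulf_eq0.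
by move=> /orP[/eqP/(ip_eq0 inner_prehilbert) ->|/eqP/(ip_eq0 inner_prehilbert) ->];
  [left|right].
Qed.

Lemma piB1_neq0 : exists y, piB 1 y <> 0.
Proof.
apply: contrapT => /forallNP n; have /eqP := oner_neq0 B; apply.
by apply: (rho_inj rB) => y; apply: contrapT; exact: n.
Qed.

Lemma piA1_neq0 : exists x, piA 1 x <> 0.
Proof.
apply: contrapT => /forallNP n; have /eqP := oner_neq0 A; apply.
by apply: (rho_inj rA) => y; apply: contrapT; exact: n.
Qed.

Let tM' a b a' b' : t a b * t a' b' = t (a * a') (b * b').
Proof.
apply: pi_ext_eq => x y.
by rewrite (rhoM rT) !tE (rhoM rA) (rhoM rB).
Qed.

Let tJ' a b : star (t a b) = t (star a) (star b).
Proof.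
apply: pi_ext_eq => x y; apply/eqP; rewrite -subr_eq0; apply/eqP.
(* The adjoint is only known through inner products, so the difference v is shown to be orthogonal
   to the dense span. *)
set v := _ - _; have [_ _ _ hd] := hP.
have vS s : [set z | exists (n : nat) (x : 'I_n -> H1) (y : 'I_n -> H2),
    z = \sum_(i < n) h (x i) (y i)] s -> inner v s = 0.
  move=> [n [x' [y' ->]]]; rewrite (ip_sumr ipK) big1// => i _.
  rewrite (ipBl ipK) (rhoJ rT) !tE !h_inner.
  by rewrite (rhoJ rA) (rhoJ rB) subrr.
apply: (nsq_le0 ipK); apply/ler_addgt0Pl => e e0; rewrite addr0.
have [s Ss vs] := dense_nsq hd v e0; apply: le_trans (ltW vs).
by rewrite (nsqB ipK v s) vS//= mulr0 subr0 lerDl (nsq_ge0 ipK).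
Qed.

(** As the representations may be degenerate, this is not read off from them: [t 1 1] is a unit for
    the simple tensors, hence for all of T by density. *)
Let t11' : t 1 1 = 1.
Proof.
rewrite -[LHS]mulr1; apply/eqP; rewrite -subr_eq0; apply/eqP.
set z : T := 1; rewrite -[X in _ - X]mul1r -mulrBl.
apply: (nu_small0 nuT) => e e0.
pose q := cnorm (t 1 1 - 1) + 1.
have q0 : 0 < q by rewrite /q; have := nu_ge0 nuT (t 1 1 - 1); lra.
have [n [a [b ab]]] := t_dense z (divr_gt0 e0 q0).
have -> : (t 1 1 - 1) * z = (t 1 1 - 1) * (z - \sum_(i < n) t (a i) (b i)).
  rewrite [RHS]mulrBr [X in _ = _ - X](_ : _ = 0) ?subr0//.
  by rewrite mulr_sumr big1// => i _; rewrite mulrBl mul1r tM' !mul1r subrr.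
apply: le_trans (nuM_le nuT (lexx _) (ltW ab)) _.
rewrite mulrCA ler_piMr ?(ltW e0)// ler_pdivrMr// mul1r /q; lra.
Qed.

Lemma tensor_productP : tensor_product t.
Proof.
have tl_hom : star_hom (fun a => t a 1).
  split=> [a a'|c a|a a'|a|//].
  - by apply: pi_ext_eq => x y; rewrite (rhoDl rT) !tE (rhoDl rA) hDl.
  - by apply: pi_ext_eq => x y; rewrite (rhoZl rT) !tE (rhoZl rA) hZl.
  - by rewrite tM' mulr1.
  - by rewrite tJ' star1.
have tr_hom : star_hom (t 1).
  split=> [a a'|c a|a a'|a|//].
  - by apply: pi_ext_eq => x y; rewrite (rhoDl rT) !tE (rhoDl rB) hDr.
  - by apply: pi_ext_eq => x y; rewrite (rhoZl rT) !tE (rhoZl rB) hZr.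
  - by rewrite tM' mulr1.
  - by rewrite tJ' star1.
(* An injective homomorphism into T makes C act faithfully on K, and both norms are the operator
   norm there. *)
have comp_rep (C : cstarAlgType R) (f : C -> T) : star_hom f ->
    (forall c, f c = 0 -> c = 0) -> forall c, cnorm (f c) = cnorm c.
  move=> fP f0; apply: (faithful_rep_nu_eq (cnorm_cstar_norm C) nuT ipK
    (rho := fun c => piT (f c)) _ rT) => //.
  split.
  - by move=> a x y; rewrite (rhoD rT).
  - by move=> a c x; rewrite (rhoZ rT).
  - by move=> a b x; rewrite (shD fP) (rhoDl rT).
  - by move=> c a x; rewrite (shZ fP) (rhoZl rT).
  - by move=> a b x; rewrite (shM fP) (rhoM rT).
  - by move=> a x y; rewrite (shJ fP) (rhoJ rT).
  - by move=> a a0; apply: f0; exact: (rho_inj rT).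
have tlr a b : t a b = t a 1 * t 1 b by rewrite tM' mulr1 mul1r.
split=> //.
- by move=> a a' b; rewrite tlr (shD tl_hom) mulrDl -!tlr.
- by move=> a b b'; rewrite tlr (shD tr_hom) mulrDr -!tlr.
- by move=> c a b; rewrite tlr (shZ tl_hom) -scalerAl -tlr.
- by move=> c a b; rewrite tlr (shZ tr_hom) -scalerAr -tlr.
- apply: (comp_rep _ _ tl_hom) => a a0; apply: (rho_inj rA) => x.
  have [y y0] := piB1_neq0.
  have : h (piA a x) (piB 1 y) = 0 by rewrite -tE a0 (rho0l rT).
  by move/h_eq0 => [].
- apply: (comp_rep _ _ tr_hom) => b b0; apply: (rho_inj rB) => y.
  have [x x0] := piA1_neq0.
  have : h (piA 1 x) (piB b y) = 0 by rewrite -tE b0 (rho0l rT).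
  by move/h_eq0 => [].
Qed.

End TensorProperties.

End TensorProduct.

(** * Matrix algebras and slices of tensors *)

Section Pullback.
Context {R : realType} {A B : starAlgType R} {f : A -> B}.
Hypothesis fP : star_hom f.

Lemma cstar_norm_pullback (nu : B -> R) :
  bijective f -> cstar_norm nu -> cstar_norm (fun a => nu (f a)).
Proof.
move=> [g fK gK] nuP; split; first split.
- move=> a /(nu_eq0 nuP) fa0; by rewrite -(fK a) fa0 -(sh0 fP) fK.
- by move=> a b; rewrite (shD fP) (nuD nuP).
- by move=> c a; rewrite (shZ fP) (nuZ nuP).
- by move=> a b; rewrite (shM fP) (nuM nuP).
- by move=> a; rewrite (shJ fP) (nuJ nuP).
- move=> u uC; have [|l lP] := nu_complete nuP (u := fun n => f (u n)).
    by move=> e /uC[N uN]; exists N => m n Nm Nn; rewrite -(shB fP) uN.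
  exists (g l) => e /lP[N uN]; exists N => n /uN.
  by rewrite (shB fP) gK.
- by move=> a; rewrite (shM fP) (shJ fP) (nuC nuP).
Qed.

Lemma faithful_rep_pullback (V : lmodType R[i]) (ip : V -> V -> R[i])
    (rho : B -> V -> V) :
  (forall a, f a = 0 -> a = 0) -> faithful_rep ip rho ->
  faithful_rep ip (fun a => rho (f a)).
Proof.
move=> f0 rhoP; split.
- by move=> a x y; rewrite (rhoD rhoP).
- by move=> a c x; rewrite (rhoZ rhoP).
- by move=> a b x; rewrite (shD fP) (rhoDl rhoP).
- by move=> c a x; rewrite (shZ fP) (rhoZl rhoP).
- by move=> a b x; rewrite (shM fP) (rhoM rhoP).
- by move=> a x y; rewrite (shJ fP) (rhoJ rhoP).
- by move=> a a0; apply: f0; exact: (rho_inj rhoP).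
Qed.

End Pullback.

Section ComplexMatrices.
Context {R : realType}.
Local Notation C := (R[i])^o.

Definition ip_complex (z w : C) : R[i] := (z : R[i]) * w^*.

Lemma ip_complex_prehilbert : prehilbert ip_complex.
Proof.
split=> [x y z|c x y|x y|x|x /eqP].
- by rewrite /ip_complex mulrDl.
- by rewrite /ip_complex -mulrA.
- by rewrite /ip_complex rmorphM /= conjCK mulrC.
- by rewrite /ip_complex -normCK exprn_ge0.
- by rewrite /ip_complex -normCK sqrf_eq0 normr_eq0 => /eqP.
Qed.

Lemma mul_complex_faithful : faithful_rep ip_complex (fun z w : C => z * w).
Proof.
split=> [a x y|a c x|a b x|c a x|a b x|a x y|a /(_ 1)].
- exact: mulrDr.
- exact: mulrCA.
- exact: mulrDl.
- by rewrite [RHS]mulrA.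
- by rewrite mulrA.
- by rewrite /ip_complex rmorphM /= mulrCA mulrA.
- by rewrite mulr1.
Qed.

Lemma cmat_complex_hom n : star_hom (id : 'M[R[i]]_n.+1 -> cmat C n).
Proof.
by split=> // c x; apply/matrixP => a b; rewrite cmat_scaleE mxE.
Qed.

Definition mx_rep n (x : 'M[R[i]]_n.+1) (v : {ffun 'I_n.+1 -> C}) : {ffun 'I_n.+1 -> C} :=
  rhon (fun z w : C => z * w) (x : cmat C n) v.

Lemma mx_rep_faithful n : faithful_rep (ipn ip_complex) (@mx_rep n).
Proof.
refine (faithful_rep_pullback (cmat_complex_hom n) _
  (rhon_faithful ip_complex_prehilbert mul_complex_faithful)).
by [].
Qed.

Context {A : starAlgType R} {n : nat}.
Implicit Types (x y : 'M[R[i]]_n.+1) (E : 'I_n.+1 -> 'I_n.+1 -> A).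

(** For matrix units [E] this is the unital embedding of the complex matrix algebra that sends the
    standard units to [E]. *)
Definition lin E x : A := \sum_a \sum_b x a b *: E a b.

Let th (z : C) : A := (z : R[i]) *: 1.

Let th_hom : star_hom th.
Proof.
split=> [x y|c x|x y|x|]; rewrite /th.
- exact: scalerDl.
- by rewrite scalerA.
- by rewrite -scalerAl mul1r scalerA.
- by rewrite starZ star1.
- exact: scale1r.
Qed.

Let thE E z i j : th z * E i j = E i j * th z.
Proof. by rewrite /th -scalerAl -scalerAr mul1r mulr1. Qed.

Lemma linE E x : lin E x = mx_embed th E (x : cmat C n).
Proof.
apply: eq_bigr => a _; apply: eq_bigr => b _.
by rewrite /th -scalerAl mul1r.
Qed.

Context {E : 'I_n.+1 -> 'I_n.+1 -> A}.
Hypothesis EP : munits E.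

Lemma lin_hom : star_hom (lin E).
Proof.
have hP := star_hom_comp (cmat_complex_hom n) (mx_embed_hom th_hom EP (thE E)).
have -> : lin E = mx_embed th E \o (id : 'M[R[i]]_n.+1 -> cmat C n).
  by apply: funext => x; rewrite linE.
exact: hP.
Qed.

Lemma lin_delta i j : lin E (delta_mx i j) = E i j.
Proof.
rewrite /lin (bigD1 i)//= [X in _ + X]big1 ?addr0 => [|k ki].
  rewrite (bigD1 j)//= [X in _ + X]big1 ?addr0 => [|k kj]; first by rewrite mxE !eqxx scale1r.
  by rewrite mxE eqxx (negPf kj) scale0r.
by rewrite big1// => l _; rewrite mxE (negPf ki) scale0r.
Qed.

Lemma lin_scalar (c : R[i]) : lin E c%:M = c *: 1.
Proof. by rewrite -scalemx1 (shZ lin_hom) (sh1 lin_hom). Qed.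

Context {nu : A -> R}.
Hypothesis nuP : cstar_norm nu.

Let th_iso z : nu (th z) = Normc.normc z.
Proof. by rewrite /th (nuZ nuP) (nu1 nuP) mulr1. Qed.

Lemma lin_cstar_norm : cstar_norm (fun x => nu (lin E x)).
Proof.
have := cstar_norm_pullback (cmat_complex_hom n) _
  (mx_embed_cstar_norm th_hom EP (thE E) normc_star_norm nuP th_iso).
have -> : (fun x => nu (lin E x)) = (fun x => nu (mx_embed th E (id x : cmat C n))).
  by apply: funext => x; rewrite linE.
by apply; exists id.
Qed.

Lemma lin_eq0 x : lin E x = 0 -> x = 0.
Proof. by move=> x0; apply: (nu_eq0 lin_cstar_norm); rewrite x0 (nu0 nuP). Qed.

Lemma lin_inj : injective (lin E).
Proof.
move=> x y xy; apply/eqP; rewrite -subr_eq0; apply/eqP/lin_eq0.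
by rewrite (shB lin_hom) xy subrr.
Qed.

Lemma lin_bound x q v : nu (lin E x) <= q ->
  nsq (ipn ip_complex) (mx_rep x v) <= q ^+ 2 * nsq (ipn ip_complex) v.
Proof.
exact: (rho_bound lin_cstar_norm (ipn_prehilbert ip_complex_prehilbert) (mx_rep_faithful n)).
Qed.

Lemma lin_boundV x q : 0 <= q ->
  (forall v, nsq (ipn ip_complex) (mx_rep x v) <= q ^+ 2 * nsq (ipn ip_complex) v) ->
  nu (lin E x) <= q.
Proof.
exact: (rho_boundV lin_cstar_norm (ipn_prehilbert ip_complex_prehilbert) (mx_rep_faithful n)).
Qed.

End ComplexMatrices.

(** Both sides are the operator norm of the matrix x on a coordinate space. *)
Lemma lin_nu_eq (R : realType) (A B : starAlgType R) n
    (E : 'I_n.+1 -> 'I_n.+1 -> A) (F : 'I_n.+1 -> 'I_n.+1 -> B)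
    (nuA : A -> R) (nuB : B -> R) x :
  munits E -> munits F -> cstar_norm nuA -> cstar_norm nuB ->
  nuA (lin E x) = nuB (lin F x).
Proof.
move=> EP FP nuAP nuBP.
apply: (faithful_rep_nu_eq (lin_cstar_norm FP nuBP) (lin_cstar_norm EP nuAP)
  (ipn_prehilbert ip_complex_prehilbert) (mx_rep_faithful n) (mx_rep_faithful n)
  (f := id)) => //.
Qed.

Lemma sum_rot3 (V : nmodType) (I1 I2 I3 : finType) (F : I1 -> I2 -> I3 -> V) :
  \sum_a \sum_b \sum_c F a b c = \sum_c \sum_a \sum_b F a b c.
Proof.
rewrite [RHS]exchange_big; apply: eq_bigr => a _ /=.
exact: exchange_big.
Qed.

Lemma sum_rev4 (V : nmodType) (I1 I2 I3 I4 : finType)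
    (F : I1 -> I2 -> I3 -> I4 -> V) :
  \sum_a \sum_b \sum_c \sum_d F a b c d = \sum_d \sum_c \sum_b \sum_a F a b c d.
Proof.
under eq_bigr do rewrite sum_rot3.
rewrite exchange_big; apply: eq_bigr => d _ /=.
by rewrite sum_rot3; apply: eq_bigr => c _; exact: exchange_big.
Qed.

Section TensorMatrices.
Context {R : realType} {A B T : cstarAlgType R} {t : A -> B -> T} {n : nat}.
Hypothesis tP : tensor_product t.
Context {E : 'I_n.+1 -> 'I_n.+1 -> B}.
Hypothesis EP : munits E.

Lemma tl_hom : star_hom (fun a => t a 1).
Proof.
split=> [a a'|c a|a a'|a|]; first exact: (tDl tP).
- exact: (tZl tP).
- by rewrite (tM tP) mulr1.
- by rewrite (tJ tP) star1.
- exact: (t11 tP).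
Qed.

Lemma tr_hom : star_hom (t 1).
Proof.
split=> [a a'|c a|a a'|a|]; first exact: (tDr tP).
- exact: (tZr tP).
- by rewrite (tM tP) mulr1.
- by rewrite (tJ tP) star1.
- exact: (t11 tP).
Qed.

Lemma munits_hom (A' B' : starAlgType R) m (f : A' -> B') (F : 'I_m -> 'I_m -> A') :
  star_hom f -> munits F -> munits (fun i j => f (F i j)).
Proof.
move=> fP FP; split=> [i j k l|i j|].
- rewrite -(shM fP) (muM FP); case: (j == k) => //=.
  by rewrite !mulr0n (sh0 fP).
- by rewrite -(shJ fP) (muJ FP).
- by rewrite -(sh_sum fP) (mu1 FP) (sh1 fP).
Qed.

Definition mx_tensor (E : 'I_n.+1 -> 'I_n.+1 -> B) : cmat A n -> T :=
  mx_embed (fun a => t a 1) (fun i j => t 1 (E i j)).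

Lemma mx_tensorE X : mx_tensor E X = \sum_a \sum_b t (X a b) (E a b).
Proof.
apply: eq_bigr => a _; apply: eq_bigr => b _.
by rewrite (tM tP) mul1r mulr1.
Qed.

Lemma mx_tensor_cstar_norm : cstar_norm (fun X => cnorm (mx_tensor E X)).
Proof.
apply: (mx_embed_cstar_norm tl_hom (munits_hom tr_hom EP) _
  (cnorm_cstar_norm A) (cnorm_cstar_norm T) (tl_iso tP)).
by move=> b i j; rewrite !(tM tP) !mul1r !mulr1.
Qed.

End TensorMatrices.

Section Slice.
Context {R : realType} {A B T : cstarAlgType R} {t : A -> B -> T}.
Context {H1 H2 K : hilbertType R} {h : H1 -> H2 -> K}.
Context {piA : A -> H1 -> H1} {piB : B -> H2 -> H2} {piT : T -> K -> K}.
Hypotheses (hP : hilbert_tensor h) (piAP : faithful_representation piA).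
Hypotheses (piBP : faithful_representation piB) (piP : faithful_representation piT).
Hypothesis tE : forall a b x y, piT (t a b) (h x y) = h (piA a x) (piB b y).
Hypothesis tP : tensor_product t.
Context {H : hilbertType R} {piQ : A -> H -> H}.
Hypothesis piQP : faithful_representation piQ.
Let rA := representation_faithful_rep piAP.
Let rB := representation_faithful_rep piBP.
Let rT := representation_faithful_rep piP.
Let rQ := representation_faithful_rep piQP.
Let ipP (H' : hilbertType R) := @inner_prehilbert R H'.

Variables (J : finType) (x : J -> A) (y : J -> B) (q : R).
Hypothesis xy_le : cnorm (\sum_i t (x i) (y i)) <= q.

Let rho_sumZ (D : starAlgType R) (V : lmodType R[i]) (ip : V -> V -> R[i])
    (rho : D -> V -> V) (rhoP : faithful_rep ip rho) (c : J -> R[i]) (d : J -> D) v :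
  rho (\sum_i c i *: d i) v = \sum_i c i *: rho (d i) v.
Proof.
rewrite (big_morph (rho^~ v) (fun a b => rhoDl rhoP a b v) (rho0l rhoP v)).
by apply: eq_bigr => i _; rewrite (rhoZl rhoP).
Qed.

Section CompressB.
Variables (m : nat) (f : 'I_m.+1 -> H2).
Hypothesis fo : orthonormal (ip := inner) f.

Let Y : cmat A m := \matrix_(a, b) \sum_i inner (piB (y i) (f b)) (f a) *: x i.

Let emb (v : {ffun 'I_m.+1 -> H1}) : K := \sum_b h (v b) (f b).

Let nsq_emb v : nsq inner (emb v) = nsq (ipn inner) v.
Proof.
rewrite /nsq /emb (ip_suml (ipP K)); congr complex.Re; apply: eq_bigr => b _.
rewrite (ip_sumr (ipP K)); under eq_bigr do rewrite (h_inner hP) fo mulr_natr.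
by rewrite sum_delta.
Qed.

Let ip_emb v w : inner (piT (\sum_i t (x i) (y i)) (emb v)) (emb w)
  = ipn inner (rhon piA Y v) w.
Proof.
rewrite /emb (big_morph _ (rhoD rT _) (rho0 rT _)) (ip_suml (ipP K)).
rewrite /ipn; under [RHS]eq_bigr => a _.
  rewrite ffunE (ip_suml (ipP H1)).
  under eq_bigr => b _.
    rewrite mxE (rho_sumZ rA) (ip_suml (ipP H1)); over.
  over.
rewrite [RHS]exchange_big; apply: eq_bigr => b _ /=.
rewrite (ip_sumr (ipP K)); apply: eq_bigr => a _.
rewrite (big_morph (piT^~ (h (v b) (f b))) (fun u w => rhoDl rT u w _) (rho0l rT _)).
rewrite (ip_suml (ipP K)); apply: eq_bigr => i _.
by rewrite tE (h_inner hP) (ipZl (ipP H1)) mulrC.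
Qed.

(** [emb] is an isometry of the tuples over H1 into K, and the matrix Y is the compression of the
    sum of the x_i (x) y_i along it. *)
Lemma compress_bound v :
  nsq (ipn inner) (rhon piA Y v) <= q ^+ 2 * nsq (ipn inner) v.
Proof.
rewrite -!nsq_emb; apply: (nsq_le_self (ipP K)
  (rho_bound (cnorm_cstar_norm T) (ipP K) rT (emb v) xy_le)).
by rewrite ip_emb nsq_emb.
Qed.

(** The change of representation: the bound on H1 bounds the C*-norm of Y, and this norm bounds Y in
    the representation on H. *)
Lemma compress_boundQ (F : 'I_m.+1 -> 'I_m.+1 -> B) v : munits F ->
  nsq (ipn inner) (rhon piQ Y v) <= q ^+ 2 * nsq (ipn inner) v.
Proof.
move=> FP; have q0 : 0 <= q := le_trans (nu_ge0 (cnorm_cstar_norm T) _) xy_le.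
apply: (rho_bound (mx_tensor_cstar_norm tP FP) (ipn_prehilbert (ipP H)) (rhon_faithful (ipP H) rQ)).
apply: (rho_boundV (mx_tensor_cstar_norm tP FP) (ipn_prehilbert (ipP H1)) (rhon_faithful (ipP H1) rA)) => //.
exact: compress_bound.
Qed.

End CompressB.

Hypothesis allB : forall n, exists F : 'I_n.+1 -> 'I_n.+1 -> B, munits F.

Variables (k : nat) (e : 'I_k.+1 -> H).
Hypothesis eo : orthonormal (ip := inner) e.

Let Z : cmat B k := \matrix_(r, s) \sum_i inner (piQ (x i) (e s)) (e r) *: y i.

(** Z is the compression of the sum of the x_i (x) y_i, with the x_i acting on H, to the span of [e]
    in the first leg. No tensor product of H and H2 is formed: for one v, only the span of the
    entries of v and of Z v in H2 matters, and a basis [f] of it leads back to [compress_boundQ]. *)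
Lemma slice_bound v :
  nsq (ipn inner) (rhon piB Z v) <= q ^+ 2 * nsq (ipn inner) v.
Proof.
set w := rhon piB Z v.
have [//|//|//|m [f [fo _ fe]]] := gram_schmidt (ipP H2) (P := fun=> True)
  (s := codom v ++ codom w).
have fv s : expands (ip := inner) f (v s) by apply: fe; rewrite mem_cat codom_f.
have fw s : expands (ip := inner) f (w s) by apply: fe; rewrite mem_cat codom_f orbT.
have nsq_ge0' : 0 <= q ^+ 2 * nsq (ipn inner) v.
  by rewrite mulr_ge0 ?sqr_ge0 ?(nsq_ge0 (ipn_prehilbert (ipP H2))).
case: m f fo fv fw {fe} => [|m] f fo fv fw.
  rewrite [leLHS](_ : _ = 0)//.
  rewrite (nsq_ipn (ipP H2)) big1// => s _.
  by rewrite fw big_ord0 (nsq0 (ipP H2)).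
have [F FP] := allB m.
(* Transposes coordinates: a tuple over H2 indexed by [e] becomes a tuple over H indexed by [f],
   with the same coefficients. *)
pose c (u : {ffun 'I_k.+1 -> H2}) : {ffun 'I_m.+1 -> H} :=
  [ffun b => \sum_s inner (u s) (f b) *: e s].
have nsq_c (u : {ffun 'I_k.+1 -> H2}) : (forall s, expands (ip := inner) f (u s)) ->
    nsq (ipn inner) (c u) = nsq (ipn inner) u.
  move=> fu; rewrite (nsq_ipn (ipP H)) (nsq_ipn (ipP H2)).
  under eq_bigr do rewrite ffunE (nsq_orthonormal (ipP H) _ eo).
  rewrite exchange_big; apply: eq_bigr => s _ /=.
  by rewrite [in RHS](fu s) (nsq_orthonormal (ipP H2) _ fo).
rewrite -(nsq_c v)// -(nsq_c w)//.
apply: (nsq_le_self (ipn_prehilbert (ipP H)) (compress_boundQ fo (c v) FP)).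
rewrite (nsq_c w)// /nsq; congr complex.Re; rewrite {2}/w /ipn.
transitivity (\sum_i \sum_a \sum_b (inner (piB (y i) (f b)) (f a) *
    \sum_s \sum_r inner (v s) (f b) * (inner (w r) (f a))^* *
      inner (piQ (x i) (e s)) (e r))).
  rewrite -sum_rot3; apply: eq_bigr => a _.
  rewrite ffunE (ip_suml (ipP H)); apply: eq_bigr => b _.
  rewrite mxE (rho_sumZ rQ) (ip_suml (ipP H)); apply: eq_bigr => i _.
  rewrite (ipZl (ipP H)) !ffunE; congr (_ * _).
  rewrite (big_morph _ (rhoD rQ _) (rho0 rQ _)) (ip_suml (ipP H)).
  apply: eq_bigr => s _; rewrite (ip_sumr (ipP H)); apply: eq_bigr => r _.
  by rewrite (rhoZ rQ) (ipZl (ipP H)) (ipZr (ipP H)) mulrA.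
symmetry; transitivity (\sum_i \sum_r \sum_s
    (inner (piQ (x i) (e s)) (e r) * inner (piB (y i) (v s)) (w r))).
  rewrite -sum_rot3; apply: eq_bigr => r _.
  rewrite ffunE (ip_suml (ipP H2)); apply: eq_bigr => s _.
  rewrite mxE (rho_sumZ rB) (ip_suml (ipP H2)); apply: eq_bigr => i _.
  by rewrite (ipZl (ipP H2)).
apply: eq_bigr => i _.
under [RHS]eq_bigr do under eq_bigr do
  (rewrite mulr_sumr; under eq_bigr do rewrite mulr_sumr).
rewrite sum_rev4; apply: eq_bigr => r _; apply: eq_bigr => s _.
rewrite {1}(fv s) {1}(fw r) (big_morph _ (rhoD rB _) (rho0 rB _)) (ip_suml (ipP H2)).
rewrite mulr_sumr; apply: eq_bigr => b _.
rewrite (ip_sumr (ipP H2)) mulr_sumr; apply: eq_bigr => a _.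
rewrite (rhoZ rB) (ipZl (ipP H2)) (ipZr (ipP H2)).
ring.
Qed.

End Slice.

(** * Quasidiagonality and compressions *)

(** p = (1 + s)/2, where s is the sign of x = 2b - 1, that is x times the inverse root of x^2 = 1 +
    4(b^2 - b). The bound 1/32 keeps x^2 within 1/8 of 1. *)
Lemma near_projection (R : realType) (W : starAlgType R) (nu : W -> R) (b : W) (d : R) :
  star_norm nu -> star b = b -> nu (b * b - b) <= d -> d <= 32^-1 ->
  exists p, [/\ p * p = p, star p = p & nu (p - b) <= 4 * d * nu (b + b - 1)].
Proof.
move=> nuP bs bd d32; set x := b + b - 1; set y := b * b - b.
pose w := - (y + y + (y + y)).
have xx : x * x = 1 - w by rewrite /w /x /y; nc_ring.
have nw : nu w <= 4 * d.
  rewrite (nuN nuP); have := nuD nuP (y + y) (y + y); have := nuD nuP y y; lra.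
have [|z [zE nz [zs zc]]] := inv_sqrt1B nuP (x := w); first by lra.
have ws : star w = w by rewrite /w /y !(starN, starD, starM) bs.
have xs : star x = x by rewrite /x starB starD star1 bs.
have xz : x * z = z * x by apply: zc; rewrite /w /x /y; nc_ring.
have {}zs := zs ws; pose s := x * (1 + z).
have xc : (1 + z) * x = x * (1 + z).
  by apply/esym; apply: (commrD (commr1 x)); exact: xz.
have ss : s * s = 1.
  by rewrite -[RHS]zE -xx /s -!mulrA (mulrA (1 + z) x) xc -!mulrA.
have sst : star s = s.
  by rewrite /s starM starD star1 zs xs xc.
exists (2^-1 *: (1 + s)); split.
- rewrite -scalerAl -scalerAr; congr (_ *: _).
  have -> : (1 + s) * (1 + s) = (1 + s) + (s + s * s) by nc_ring.
  by rewrite ss (addrC s) scale_half2.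
- by rewrite star_half starD star1 sst.
have -> : 2^-1 *: (1 + s) - b = 2^-1 *: (x * z).
  rewrite -{1}(scale_half2 b) -scalerBr; congr (_ *: _); rewrite /s /x; nc_ring.
rewrite (nu_half nuP) ler_pdivrMr//.
have := nuM_le nuP (lexx (nu x)) nz; have := nu_ge0 nuP x.
move: nw; set q := nu w; set r := nu x => h1 h2 h3; apply: le_trans h3 _.
have := ler_wpM2l h2 h1; lra.
Qed.

Section Compression.
Context {R : realType} {V : lmodType R[i]} {ip : V -> V -> R[i]}.
Hypothesis ipP : prehilbert ip.

Definition span_proj m (e : 'I_m -> V) (x : V) : V := \sum_r ip x (e r) *: e r.

Lemma span_projD m (e : 'I_m -> V) x y : span_proj e (x + y) = span_proj e x + span_proj e y.
Proof.
by rewrite -big_split; apply: eq_bigr => r _; rewrite (ipDl ipP) scalerDl.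
Qed.

Lemma span_projZ m (e : 'I_m -> V) c x : span_proj e (c *: x) = c *: span_proj e x.
Proof.
by rewrite scaler_sumr; apply: eq_bigr => r _; rewrite (ipZl ipP) scalerA.
Qed.

Lemma span_proj0 m (e : 'I_m -> V) : span_proj e 0 = 0.
Proof. by rewrite /span_proj big1// => r _; rewrite (ip0l ipP) scale0r. Qed.

Lemma span_proj_ip m (e : 'I_m -> V) x r : orthonormal (ip := ip) e ->
  ip (span_proj e x) (e r) = ip x (e r).
Proof.
move=> eo; rewrite (ip_suml ipP); under eq_bigr do rewrite (ipZl ipP) eo mulr_natr.
exact: sum_delta_sym.
Qed.

Lemma span_proj_id m (e : 'I_m -> V) r : orthonormal (ip := ip) e ->
  span_proj e (e r) = e r.
Proof.
move=> eo; rewrite /span_proj (bigD1 r)//= eo eqxx scale1r big1 ?addr0// => s sr.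
by rewrite eo eq_sym (negPf sr) scale0r.
Qed.

Lemma nsq_span_proj m (e : 'I_m -> V) x : orthonormal (ip := ip) e ->
  nsq ip (span_proj e x) <= nsq ip x.
Proof.
move=> eo; apply: (nsq_le_self ipP (lexx _)).
rewrite /nsq {2}/span_proj (ip_sumr ipP) {1}/span_proj (ip_sumr ipP).
congr complex.Re; apply: eq_bigr => r _.
by rewrite !(ipZr ipP) span_proj_ip.
Qed.

Lemma proj_orthonormal (p : V -> V) (I : finType) (v : I -> V) :
  (forall x y, p (x + y) = p x + p y) -> (forall c x, p (c *: x) = c *: p x) ->
  (forall x, p (p x) = p x) -> (forall x y, ip (p x) y = ip x (p y)) ->
  (forall x, exists c : I -> R[i], p x = \sum_i c i *: v i) ->
  exists m (e : 'I_m -> V), orthonormal (ip := ip) e /\ forall x, p x = span_proj e x.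
Proof.
move=> pD pZ pp pJ pv.
have p0 : p 0 = 0 by rewrite -(scale0r (0 : V)) pZ !scale0r.
have [|||m [e [eo pe ee]]] := gram_schmidt ipP (P := fun x => p x = x)
  (s := [seq p (v i) | i <- enum I]).
- by move=> x y px py; rewrite pD px py.
- by move=> c x px; rewrite pZ px.
- by move=> _ /mapP[i _ ->].
exists m, e; split=> // x; have [c pxE] := pv x.
have -> : span_proj e x = span_proj e (p x).
  by apply: eq_bigr => r _; rewrite pJ pe.
rewrite -pp pxE (big_morph p pD p0).
rewrite (big_morph (span_proj e) (span_projD e) (span_proj0 e)).
apply: eq_bigr => i _; rewrite pZ span_projZ; congr (_ *: _).
by apply: ee; apply/mapP; exists i => //; rewrite mem_enum.
Qed.

Definition compress m (e : 'I_m -> V) (S : V -> V) : 'M[R[i]]_m :=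
  \matrix_(r, s) ip (S (e s)) (e r).

Definition expand m (e : 'I_m -> V) (v : {ffun 'I_m -> (R[i])^o}) : V :=
  \sum_s (v s : R[i]) *: e s.

Context {k : nat} {e : 'I_k.+1 -> V}.
Hypothesis eo : orthonormal (ip := ip) e.

Lemma ip_expand v w : ip (expand e v) (expand e w) = ipn ip_complex v w.
Proof.
rewrite (ip_suml ipP); apply: eq_bigr => s _.
rewrite (ip_sumr ipP); under eq_bigr do rewrite (ipZl ipP) (ipZr ipP) eo mulr_natr mulrnAr.
by rewrite sum_delta.
Qed.

Lemma nsq_expand v : nsq ip (expand e v) = nsq (ipn ip_complex) v.
Proof. by rewrite /nsq ip_expand. Qed.

Lemma span_proj_expand v : span_proj e (expand e v) = expand e v.
Proof.
rewrite {2}/expand; apply: eq_bigr => r _; congr (_ *: _).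
rewrite (ip_suml ipP); under eq_bigr do rewrite (ipZl ipP) eo mulr_natr.
exact: sum_delta_sym.
Qed.

Lemma expand_compress (S : V -> V) v :
  (forall x y, S (x + y) = S x + S y) -> (forall c x, S (c *: x) = c *: S x) ->
  expand e (mx_rep (compress e S) v) = span_proj e (S (expand e v)).
Proof.
move=> SD SZ; have S0 : S 0 = 0 by rewrite -(scale0r (0 : V)) SZ !scale0r.
apply: eq_bigr => r _; congr (_ *: _).
rewrite ffunE /expand (big_morph S SD S0) (ip_suml ipP); apply: eq_bigr => s _.
by rewrite mxE SZ (ipZl ipP) mulrC.
Qed.

Lemma compress_mul (S S' : V -> V) :
  (forall x y, S (x + y) = S x + S y) -> (forall c x, S (c *: x) = c *: S x) ->
  compress e S * compress e S' = compress e (fun x => S (span_proj e (S' x))).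
Proof.
move=> SD SZ; have S0 : S 0 = 0 by rewrite -(scale0r (0 : V)) SZ !scale0r.
apply/matrixP => r s; rewrite !mxE (big_morph S SD S0) (ip_suml ipP).
by apply: eq_bigr => l _; rewrite !mxE SZ (ipZl ipP) mulrC.
Qed.

Lemma compressB (S S' : V -> V) :
  compress e S - compress e S' = compress e (fun x => S x - S' x).
Proof. by apply/matrixP => r s; rewrite !mxE (ipBl ipP). Qed.

Lemma compress_adj (S S' : V -> V) : (forall x y, ip (S x) y = ip x (S' y)) ->
  star (compress e S) = compress e S'.
Proof.
by move=> SS; apply/matrixP => r s; rewrite !mxE SS -(ipC ipP).
Qed.

Lemma compress_norm (A : starAlgType R) (nu : A -> R) (E : 'I_k.+1 -> 'I_k.+1 -> A)
    (S : V -> V) (q : R) :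
  cstar_norm nu -> munits E -> 0 <= q ->
  (forall x y, S (x + y) = S x + S y) -> (forall c x, S (c *: x) = c *: S x) ->
  (forall x, span_proj e x = x -> nsq ip (S x) <= q ^+ 2 * nsq ip x) ->
  nu (lin E (compress e S)) <= q.
Proof.
move=> nuP EP q0 SD SZ Sq; apply: lin_boundV => // v.
rewrite -!nsq_expand expand_compress//.
by apply: le_trans (nsq_span_proj _ eo) _; apply: Sq; exact: span_proj_expand.
Qed.

End Compression.

Arguments compress {R V} ip {m} e S.
Arguments span_proj {R V} ip {m} e x.

Lemma ffun_basis (R : realType) (I : finType) (x : {ffun I -> (R[i])^o}) :
  x = \sum_i (x i : R[i]) *: [ffun j => 1 *+ (i == j)].
Proof.
apply/ffunP => j; rewrite sum_ffunE.
under eq_bigr => i _ do rewrite !ffunE -scalerMnr.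
by rewrite sum_delta_sym /GRing.scale /= mulr1.
Qed.

Lemma mx_projection_orthonormal (R : realType) N (P : 'M[R[i]]_N.+1) :
  P * P = P -> star P = P ->
  exists m (g : 'I_m -> {ffun 'I_N.+1 -> (R[i])^o}),
    orthonormal (ip := ipn ip_complex) g /\
    forall x, mx_rep P x = span_proj (ipn ip_complex) g x.
Proof.
move=> PP Ps; have rV := mx_rep_faithful (R := R) N.
apply: (proj_orthonormal (ipn_prehilbert ip_complex_prehilbert)
  (v := fun i : 'I_N.+1 => [ffun j => 1 *+ (i == j)])).
- exact: (rhoD rV).
- exact: (rhoZ rV).
- by move=> x; rewrite -(rhoM rV) PP.
- by move=> x y; rewrite -(rhoJ rV) Ps.
- by move=> x; exists (mx_rep P x); exact: ffun_basis.
Qed.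

Section QuasidiagonalCompression.
Context {R : realType} {D : cstarAlgType R}.
Hypothesis allD : forall n, exists E : 'I_n.+1 -> 'I_n.+1 -> D, munits E.
Let nuDP := cnorm_cstar_norm D.

Section NearlyInvariant.
Context {H : hilbertType R} {rho : D -> H -> H}.
Hypothesis piP : faithful_representation rho.
Let rP := representation_faithful_rep piP.
Let ipP := @inner_prehilbert R H.
Local Notation nsqH := (nsq (@inner R H)).

Variables (N : nat) (f : 'I_N.+1 -> H) (d : R) (x0 : H).
Hypothesis fo : orthonormal (ip := inner) f.
Hypotheses (d0 : 0 < d) (d128 : 128 * d <= 1).
Local Notation p := (span_proj inner f).
Definition nearly_commutes a :=
  forall x, nsqH (p (rho a x) - rho a (p x)) <= d ^+ 2 * nsqH x.
Hypothesis p1 : nearly_commutes 1.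
Hypotheses (x0_neq0 : x0 <> 0) (px0 : nsqH (p x0 - x0) <= 8^-1 * nsqH x0).
Hypothesis pi1x0 : rho 1 x0 = x0.
Variables (F : 'I_N.+1 -> 'I_N.+1 -> D).
Hypothesis FP : munits F.
Local Notation nuF := (fun x : 'M[R[i]]_N.+1 => cnorm (lin F x)).
Let nuNP : cstar_norm nuF := lin_cstar_norm FP nuDP.
Local Notation g0 a := (compress inner f (rho a)).

(** The difference is the compression of a(1 - p)b, and (1 - p) b x = b p x - p b x for x in the
    range of p. *)
Let g0_mul a b : nearly_commutes b -> nuF (g0 (a * b) - g0 a * g0 b) <= cnorm a * d.
Proof.
move=> bc; have a0 := nu_ge0 nuDP a.
rewrite (compress_mul ipP _ (rhoD rP a) (rhoZ rP a)) (compressB ipP).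
apply: (compress_norm ipP fo nuDP FP); first by rewrite mulr_ge0// ltW.
- by move=> x y; rewrite !(rhoD rP) (span_projD ipP) (rhoD rP) opprD addrACA.
- by move=> c x; rewrite !(rhoZ rP) (span_projZ ipP) (rhoZ rP) scalerBr.
move=> x px; rewrite (rhoM rP) -(rhoB rP).
apply: le_trans (rho_bound nuDP ipP rP _ (lexx _)) _.
rewrite exprMn -[leRHS]mulrA; apply: ler_wpM2l; first exact: sqr_ge0.
by have := bc x; rewrite px -opprB (nsqN ipP).
Qed.

Let g0_le a : nuF (g0 a) <= cnorm a.
Proof.
apply: (compress_norm ipP fo nuDP FP); first exact: (nu_ge0 nuDP).
- exact: (rhoD rP).
- exact: (rhoZ rP).
by move=> x _; exact: (rho_bound nuDP ipP rP).
Qed.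

(** In a degenerate representation the compression G of the unit to the range of p may be far from
    1, but it is almost a projection. Passing to the range of a true projection P near G repairs
    this. The 12 is 4 times the bound 3 for the norm of 2G - 1. *)
Lemma cut_down : exists k (e : 'I_k.+1 -> H), orthonormal (ip := inner) e /\
  forall E : 'I_k.+1 -> 'I_k.+1 -> D, munits E ->
    cnorm (lin E (compress inner e (rho 1) - 1)) <= 12 * d /\
    forall a b, nearly_commutes b ->
      cnorm (lin E (compress inner e (rho (a * b))
                    - compress inner e (rho a) * compress inner e (rho b)))
      <= cnorm a * (2 + 12 * cnorm b) * d.
Proof.
set G := g0 1.
have Gs : star G = G.
  by apply: (compress_adj ipP) => x y; rewrite -(rhoJ rP) star1.
have GG : nuF (G * G - G) <= d.
  by rewrite (nuBC nuNP); have := g0_mul 1 p1; rewrite mulr1 (nu1 nuDP) mul1r.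
have G1 : nuF G <= 1 by rewrite -(nu1 nuDP); exact: g0_le.
have d32 : d <= 32^-1.
  by have := d128; lra.
have [|P [PP Ps PG]] := near_projection nuNP Gs GG; first by [].
have {}PG : nuF (P - G) <= 12 * d.
  apply: le_trans PG _; rewrite -mulrA mulrCA mulrC ler_pM2r//.
  have := nuB nuNP (G + G) 1; have := nuD nuNP G G; rewrite (nu1 nuNP).
  move: G1; cbv beta; lra.
pose V := {ffun 'I_N.+1 -> (R[i])^o}.
have ipV : prehilbert (ipn ip_complex : V -> V -> R[i]) := ipn_prehilbert ip_complex_prehilbert.
have rV := mx_rep_faithful (R := R) N.
have [m [g [go gP]]] := mx_projection_orthonormal PP Ps.
case: m g go gP => [|k] g go gP.
  (* If P were 0, G would be small. But x0 is fixed by the unit and almost by p, so G almost fixes p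
     x0, which is not small. *)
  exfalso.
  have P0 : P = 0.
    apply: (rho_inj rV) => x; by rewrite gP /span_proj big_ord0.
  have G4 : nuF G <= 4^-1 by have := d128; move: PG; rewrite P0 sub0r (nuN nuNP); lra.
  have n0 : 0 < nsqH x0.
    rewrite lt_neqAle eq_sym (nsq_ge0 ipP) andbT; apply/eqP => /(nsq_eq0 ipP).
    exact: x0_neq0.
  set X := p x0.
  have pX : p X = X by rewrite /X /span_proj; apply: eq_bigr => r _; rewrite (span_proj_ip ipP).
  pose v : V := [ffun s => inner x0 (f s)].
  have XE : X = expand f v by apply: eq_bigr => s _; rewrite ffunE.
  have le1 : nsqH (p (rho 1 X)) <= 4^-1 ^+ 2 * nsqH X.
    rewrite XE -(expand_compress ipP _ (rhoD rP 1) (rhoZ rP 1)) !(nsq_expand ipP fo).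
    exact: (lin_bound FP nuDP).
  have le2 : nsqH (X - p (rho 1 X)) <= 8^-1 * nsqH x0.
    have -> : X - p (rho 1 X) = p (rho 1 (x0 - X)).
      rewrite (rhoB rP) pi1x0 -[- rho 1 X]scaleN1r (span_projD ipP) (span_projZ ipP).
      by rewrite scaleN1r.
    apply: le_trans (nsq_span_proj ipP _ fo) _.
    apply: le_trans (nsq_rho1 ipP rP _) _.
    by rewrite -(nsqN ipP) opprB.
  have par x y : nsqH (x + y) <= 2 * nsqH x + 2 * nsqH y.
    by have := nsq_ge0 ipP (x - y); rewrite (nsqB ipP) (nsqD ipP); lra.
  have := par (X - p (rho 1 X)) (p (rho 1 X)); rewrite subrK.
  have := par (x0 - X) X; rewrite subrK.
  move: px0; rewrite -(nsqN ipP) opprB -/X.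
  have := nsq_ge0 ipP X; move: le1 le2 n0; lra.
pose e j := expand f (g j).
have eo : orthonormal (ip := inner) e.
  by move=> i j; rewrite (ip_expand ipP fo) go.
(* Compression in two stages: to the span of [f], then to the range of P in coordinates. *)
have eE a : compress inner e (rho a) = compress (ipn ip_complex) g (mx_rep (g0 a)).
  apply/matrixP => r s; rewrite !mxE -(ip_expand ipP fo).
  rewrite (expand_compress ipP _ (rhoD rP a) (rhoZ rP a)).
  rewrite {2}/e /expand !(ip_sumr ipP); apply: eq_bigr => l _.
  by rewrite !(ipZr ipP) (span_proj_ip ipP).
exists k, e; split=> // E EP.
have cut M q : 0 <= q -> nuF M <= q ->
    cnorm (lin E (compress (ipn ip_complex) g (mx_rep M))) <= q.
  move=> q0 Mq; apply: (compress_norm ipV go nuDP EP) => //.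
  - exact: (rhoD rV).
  - exact: (rhoZ rV).
  - by move=> v _; apply: (lin_bound FP nuDP).
have mulP M M' : compress (ipn ip_complex) g (mx_rep M) * compress (ipn ip_complex) g (mx_rep M')
    = compress (ipn ip_complex) g (mx_rep (M * P * M')).
  rewrite (compress_mul ipV _ (rhoD rV M) (rhoZ rV M)).
  by congr compress; apply: funext => v; rewrite -gP -!(rhoM rV) ?mulrA.
have subP M M' : compress (ipn ip_complex) g (mx_rep M) - compress (ipn ip_complex) g (mx_rep M')
    = compress (ipn ip_complex) g (mx_rep (M - M')).
  by rewrite (compressB ipV); congr compress; apply: funext => v; rewrite (rhoBl rV).
split=> [|a b bc].
  have -> : 1 = compress (ipn ip_complex) g (mx_rep P).
    apply/matrixP => r s; rewrite [RHS]mxE gP (span_proj_id _ go) go mxE eq_sym.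
    by [].
  rewrite eE subP; apply: cut; first by rewrite mulr_ge0// ltW.
  by rewrite (nuBC nuNP).
rewrite !eE mulP subP; have a0 := nu_ge0 nuDP a; have b0 := nu_ge0 nuDP b.
apply: cut; first by apply: mulr_ge0; [apply: mulr_ge0 => //; lra|exact: ltW].
(* Writing P = G + (P - G) with G = g0 1, the middle term is controlled by the almost
   multiplicativity of g0 on 1 and b. *)
have -> : g0 (a * b) - g0 a * P * g0 b = (g0 (a * b) - g0 a * g0 b)
  + g0 a * ((g0 (1 * b) - G * g0 b) - (P - G) * g0 b).
  by rewrite mul1r; nc_ring.
apply: le_trans (nuD nuNP _ _) _.
have h1 := g0_mul a bc; have := g0_mul 1 bc; rewrite (nu1 nuDP) (mul1r d) => h2.
have h3 := nuM_le nuNP PG (g0_le b).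
have h4 : nuF (g0 (1 * b) - G * g0 b - (P - G) * g0 b) <= d + 12 * d * cnorm b.
  by apply: le_trans (nuB nuNP _ _) _; exact: lerD h2 h3.
have h5 := nuM_le nuNP (g0_le a) h4.
apply: le_trans (lerD h1 h5) _.
by rewrite le_eqVlt; apply/orP; left; apply/eqP; ring.
Qed.

End NearlyInvariant.

(** The vectors [e] precede the units [E], so the same compression can be realised in any unital
    copy of its matrix algebra in D. *)
Lemma quasidiagonal_compression : quasidiagonal D ->
  exists (H : hilbertType R) (rho : D -> H -> H), faithful_representation rho /\
  forall (P : seq (D * D)) (d : R), 0 < d ->
  exists k (e : 'I_k.+1 -> H), orthonormal (ip := inner) e /\
  forall E : 'I_k.+1 -> 'I_k.+1 -> D, munits E ->
    cnorm (lin E (compress inner e (rho 1) - 1)) <= d /\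
    forall a b, (a, b) \in P ->
      cnorm (lin E (compress inner e (rho (a * b))
                    - compress inner e (rho a) * compress inner e (rho b))) <= d.
Proof.
move=> [H [rho [p [_ piP pP pcvg pcomm]]]]; exists H, rho; split=> // P d d0.
have ipP := @inner_prehilbert R H; have rP := representation_faithful_rep piP.
have F0 (ab : D * D) : 0 <= cnorm ab.1 * (2 + 12 * cnorm ab.2).
  have := nu_ge0 nuDP ab.1; have := nu_ge0 nuDP ab.2; nra.
(* Dominates both constants of [cut_down], for all pairs of P at once. *)
pose B := \sum_(ab <- P) (cnorm ab.1 * (2 + 12 * cnorm ab.2)) + 12.
have B12 : 12 <= B by rewrite lerDr sumr_ge0.
have BP a b : (a, b) \in P -> cnorm a * (2 + 12 * cnorm b) <= B.
  move=> abP; rewrite /B (perm_big _ (perm_to_rem abP)) big_cons /=.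
  by rewrite -[leRHS]addrA lerDl addr_ge0// sumr_ge0.
pose d' := Num.min 128^-1 (d / B).
have d'0 : 0 < d' by rewrite lt_min invr_gt0 divr_gt0 //=; lra.
have d'128 : 128 * d' <= 1.
  by rewrite -ler_pdivlMl// mulr1 ge_min lexx.
have d'B : B * d' <= d.
  apply: (@le_trans _ _ (B * (d / B))).
    by rewrite ler_pM2l ?ge_min ?lexx ?orbT//; lra.
  by rewrite mulrCA divff ?mulr1//; apply/eqP; lra.
have [x1 x1P] : exists x, rho 1 x <> 0.
  apply: contrapT => /forallNP n; have /eqP := oner_neq0 D; apply.
  by apply: (rho_inj rP) => x; apply: contrapT; exact: n.
pose x0 := rho 1 x1.
have pix0 : rho 1 x0 = x0 by rewrite /x0 -(rhoM rP) mulr1.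
have n0 : 0 < nsq inner x0.
  rewrite lt_neqAle eq_sym (nsq_ge0 ipP) andbT; apply/eqP => /(nsq_eq0 ipP).
  exact: x1P.
have n8 : 0 < 8^-1 * nsq inner x0 by rewrite mulr_gt0.
have [N0 N0P] := cvg_nsq (pcvg x0) n8.
have comm a : exists N, forall n, (N <= n)%N -> forall x,
    nsq inner (p n (rho a x) - rho a (p n x)) <= d' ^+ 2 * nsq inner x.
  have [N _ NP] := pcomm a d' d'0; exists N => n Nn x.
  by apply: nsq_le_norm; [exact: ltW|exact: NP].
have [N1 N1P] := comm 1.
have commL (L : seq (D * D)) : exists N, forall n, (N <= n)%N ->
    forall ab, ab \in L -> forall x,
    nsq inner (p n (rho ab.2 x) - rho ab.2 (p n x)) <= d' ^+ 2 * nsq inner x.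
  elim: L => [|ab L [N NP]]; first by exists 0%N.
  have [M MP] := comm ab.2.
  exists (maxn N M) => n; rewrite geq_max => /andP[Nn Mn] ab'.
  by rewrite in_cons => /predU1P[->|/(NP n Nn)//]; exact: MP.
have [N2 N2P] := commL P.
pose n := maxn N0 (maxn N1 N2).
have [[[plin _] pp padj [r [v pv]]] _] := pP n.
have pD x y : p n (x + y) = p n x + p n y by have := plin 1 x y; rewrite !scale1r.
have p0 : p n 0 = 0.
  by have := plin (- 1) 0 0; rewrite scaler0 addr0 scaleN1r addNr.
have pZ c x : p n (c *: x) = c *: p n x by have := plin c x 0; rewrite p0 !addr0.
have [m [f [fo fp]]] := proj_orthonormal ipP pD pZ pp padj pv.
have px0 : nsq inner (p n x0 - x0) <= 8^-1 * nsq inner x0.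
  by apply/ltW/N0P; rewrite leq_maxl.
case: m f fo fp => [|m] f fo fp.
  exfalso; move: px0; rewrite fp /span_proj big_ord0 sub0r (nsqN ipP); lra.
have [F FP] := allD m.
have pfE : p n = span_proj inner f by apply: funext => x; rewrite fp.
have [||k [e [eo eE]]] := cut_down piP fo d'0 d'128 _ x1P _ pix0 FP.
- by move=> x; rewrite -pfE; apply: N1P; rewrite /n !leq_max leqnn !orbT.
- by rewrite -pfE.
exists k, e; split=> // E EP; have [e1 e2] := eE E EP; split.
  by apply: le_trans e1 (le_trans _ d'B); rewrite ler_pM2r.
move=> a b abP; apply: le_trans (e2 a b _) (le_trans _ d'B).
  move=> x; rewrite -pfE; apply: (N2P n _ (a, b)) => //.
  by rewrite /n !leq_max leqnn !orbT.
by rewrite ler_pM2r// BP.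
Qed.

End QuasidiagonalCompression.

(** * Matrix units from K0 *)

Section K0Sums.
Context {R : realType} {D : starAlgType R}.
Implicit Types p q : mxproj D.

Lemma pi_addproj p q :
  \pi_(Vsemigroup D)%qT (addproj p q) = \pi_(Vsemigroup D)%qT p + \pi_(Vsemigroup D)%qT q.
Proof.
by apply: mvn_eq; apply: addproj_mvn; apply: mvn_sym; exact: mvn_pi.
Qed.

Lemma K0class_addproj p q : K0class (addproj p q) = K0class p + K0class q.
Proof.
rewrite [RHS](gadd_diff (_, _) (_, _)) /=; apply: gdiff_eq; exists 0 => /=.
by rewrite pi_addproj !addr0.
Qed.

End K0Sums.

Section MatrixUnitsFromK0.
Context {R : realType} {D : cstarAlgType R}.
Implicit Types p q : mxproj D.

Fixpoint nfold p n := if n is n'.+1 then addproj p (nfold p n') else p.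

Lemma K0class_nfold p n : K0class (nfold p n) = K0class p *+ n.+1.
Proof.
elim: n => [|n IH]; first by rewrite mulr1n.
by rewrite mulrS -IH -K0class_addproj.
Qed.

(** Cuts v into its column blocks. That each block is v times a matrix is what lets the induction
    inherit orthogonality to the first block. *)
Lemma nfold_columns p n m (v : 'M[D]_(m, projsize (nfold p n))) :
  adjmx v *m v = projmx (nfold p n) ->
  exists w : 'I_n.+1 -> 'M[D]_(m, projsize p),
    [/\ forall i, exists s, w i = v *m s,
        forall i j, adjmx (w i) *m w j = projmx p *+ (i == j) &
        v *m adjmx v = \sum_i w i *m adjmx (w i)].
Proof.
elim: n v => [|n IH] v /= vv.
  exists (fun=> v); split.
  - by move=> i; exists 1%:M; rewrite mulmx1.
  - by move=> i j; rewrite !ord1 eqxx vv.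
  - by rewrite big_ord1.
change 'M[D]_(m, projsize p + projsize (nfold p n)) in v.
have vE : v = row_mx (lsubmx v) (rsubmx v) by rewrite hsubmxK.
have adjE : adjmx v = col_mx (adjmx (lsubmx v)) (adjmx (rsubmx v)).
  by rewrite {1}vE /adjmx map_row_mx tr_row_mx.
have vv' : adjmx v *m v = block_mx (projmx p) 0 0 (projmx (nfold p n)) := vv.
have : col_mx (adjmx (lsubmx v)) (adjmx (rsubmx v)) *m row_mx (lsubmx v) (rsubmx v)
    = block_mx (projmx p) 0 0 (projmx (nfold p n)) by rewrite -adjE -vE.
rewrite mul_col_row => /eq_block_mx[ll lr rl rr].
have [w [ws ww wE]] := IH _ rr.
have lw i : adjmx (lsubmx v) *m w i = 0.
  by have [s ->] := ws i; rewrite mulmxA lr mul0mx.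
have wl i : adjmx (w i) *m lsubmx v = 0.
  by rewrite -[LHS]adjmxK adjmxM adjmxK lw adjmx0.
exists (fun i => oapp w (lsubmx v) (unlift ord0 i)); split.
- move=> i; case: (unliftP ord0 i) => [j|] _ /=.
    have [s sE] := ws j; exists (col_mx 0 s).
    by rewrite [X in X *m _]vE mul_row_col mulmx0 add0r.
  by exists (col_mx 1%:M 0); rewrite [X in X *m _]vE mul_row_col mulmx1 mulmx0 addr0.
- move=> i j; case: (unliftP ord0 i) => [i'|] ->; case: (unliftP ord0 j) => [j'|] -> //=.
- rewrite big_ord_recl unlift_none /=.
  under eq_bigr do rewrite liftK /=.
  by rewrite -wE adjE [X in X *m _]vE mul_row_col.
Qed.

(** If [1] = (n+1)[p], cancellation gives v with v v^* = 1 and v^* v the sum of n+1 copies of p. The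
    column blocks w_i of v yield the units w_i w_j^*, which are 1 by 1 matrices. *)
Lemma munits_of_K0 : cancellation_of_projections D ->
  (forall n : nat, (1 <= n)%N -> [set x *+ n | x in K0pos D] (K0one D)) ->
  forall n, exists E : 'I_n.+1 -> 'I_n.+1 -> D, munits E.
Proof.
move=> Dcancel Dunit n; have [_ [p _ <-]] := Dunit n.+1 isT.
rewrite -K0class_nfold => /esym/Dcancel[v [v1 v2]].
have [w [_ ww]] := nfold_columns v2; rewrite v1 => w1'.
have w1 : 1%:M = \sum_i w i *m adjmx (w i) :> 'M[D]_1 := w1'.
pose E i j : D := (w i *m adjmx (w j)) ord0 ord0.
have EE i j : w i *m adjmx (w j) = (E i j)%:M.
  by apply/matrixP => a b; rewrite !ord1 [RHS]mxE eqxx mulr1n.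
have wp i : w i *m projmx p = w i.
  rewrite -[RHS]mul1mx [X in _ = X *m _]w1 mulmx_suml [RHS](bigD1 i)//= [X in _ + X]big1 ?addr0.
    by rewrite -mulmxA ww eqxx mulr1n.
  by move=> j ji; rewrite -mulmxA ww (negPf ji) mulr0n mulmx0.
exists E; split=> [i j k l|i j|].
- have : (E i j)%:M *m (E k l)%:M = (E i l *+ (j == k))%:M :> 'M[D]_1.
    rewrite -!EE -mulmxA (mulmxA (adjmx (w j))) ww.
    case: eqP => _; rewrite ?mulr1n ?mulr0n.
      by rewrite mulmxA wp EE.
    by rewrite mul0mx mulmx0; apply/matrixP => a b; rewrite !mxE mul0rn.
  by move=> /matrixP/(_ ord0 ord0); rewrite -scalar_mxM !mxE eqxx !mulr1n.
- have : adjmx (w i *m adjmx (w j)) = w j *m adjmx (w i) by rewrite adjmxM adjmxK.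
  by rewrite !EE => /matrixP/(_ ord0 ord0); rewrite !mxE eqxx !mulr1n.
- have := congr1 (fun M : 'M[D]_1 => M ord0 ord0) w1; rewrite /= mxE eqxx mulr1n => ->.
  by rewrite summxE.
Qed.

End MatrixUnitsFromK0.

Section MatrixUnitsConstructions.
Context {R : realType}.

Lemma conj_hom (W : starAlgType R) (u : W) : unitary u -> star_hom (fun a => star u * a * u).
Proof.
move=> [u1 u2]; split=> [a b|c a|a b|a|].
- by rewrite mulrDr mulrDl.
- by rewrite -scalerAr -scalerAl.
- rewrite -!mulrA; congr (_ * (_ * _)); rewrite !mulrA u2 mul1r; by [].
- by rewrite !starM starK mulrA.
- by rewrite mulr1.
Qed.

Lemma unitary_star (W : starAlgType R) (u : W) : unitary u -> unitary (star u).
Proof. by move=> [u1 u2]; split; rewrite starK. Qed.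

Lemma unitaryM (W : starAlgType R) (u v : W) : unitary u -> unitary v -> unitary (u * v).
Proof.
move=> [u1 u2] [v1 v2]; split; rewrite starM.
  by rewrite mulrA -(mulrA (star v)) u1 mulr1.
by rewrite mulrA -(mulrA u) v2 mulr1.
Qed.

Lemma lin_comp (A B : starAlgType R) (f : A -> B) n (E : 'I_n.+1 -> 'I_n.+1 -> A) x :
  star_hom f -> f (lin E x) = lin (fun i j => f (E i j)) x.
Proof.
move=> fP; rewrite /lin (sh_sum fP); apply: eq_bigr => a _.
by rewrite (sh_sum fP); apply: eq_bigr => b _; rewrite (shZ fP).
Qed.

(** The block copy of the smaller matrix algebra with multiplicity q; [mxvec_index] enumerates the
    pairs (i, c). *)
Lemma munits_div n N : (n.+1 %| N.+1)%N ->
  exists K : 'I_n.+1 -> 'I_n.+1 -> 'M[R[i]]_N.+1, munits K.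
Proof.
move=> /dvdnP[q Nq]; have {}Nq : (n.+1 * q)%N = N.+1 by rewrite mulnC.
pose idx i (c : 'I_q) : 'I_N.+1 := cast_ord Nq (mxvec_index i c).
have idx_inj i c j d : (idx i c == idx j d) = (i == j) && (c == d).
  rewrite (inj_eq (@cast_ord_inj _ _ _)).
  apply/eqP/andP => [|[/eqP-> /eqP->]//].
  have [g gK _] := curry_mxvec_bij n.+1 q.
  have gE i' c' : g (mxvec_index i' c') = (i', c') := gK (i', c') isT.
  by move=> /(congr1 g); rewrite !gE => -[-> ->].
exists (fun i j => \sum_c delta_mx (idx i c) (idx j c)); split.
- move=> i j k l; rewrite mulr_suml.
  transitivity (\sum_c (delta_mx (idx i c) (idx l c) : 'M[R[i]]_N.+1) *+ (j == k)).
    apply: eq_bigr => c _; rewrite mulr_sumr.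
    under eq_bigr => d _ do rewrite [_ * _]mul_delta_mx_cond idx_inj andbC -mulnb mulrnA.
    by rewrite sumrMnl sum_delta.
  by rewrite sumrMnl.
- move=> i j; rewrite star_sum; apply: eq_bigr => c _.
  apply/matrixP => a b; rewrite !mxE rmorph_nat andbC.
  by [].
- rewrite [RHS](_ : 1 = \sum_r delta_mx r r); last first.
    exact: mx1_sum_delta.
  rewrite pair_big /= [RHS](reindex (fun ic : 'I_n.+1 * 'I_q => idx ic.1 ic.2))//=.
  have [g gK Kg] := curry_mxvec_bij n.+1 q.
  exists (fun r => g (cast_ord (esym Nq) r)) => [[i c]|r] _.
    by rewrite /idx cast_ordK; exact: (gK (i, c) isT).
  rewrite /idx; move: (Kg (cast_ord (esym Nq) r) isT).
  by case: (g _) => i c /= ->; rewrite cast_ordKV.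
Qed.

Lemma munits_lin (A : starAlgType R) n N (E : 'I_N.+1 -> 'I_N.+1 -> A)
    (K : 'I_n.+1 -> 'I_n.+1 -> 'M[R[i]]_N.+1) :
  munits E -> munits K -> munits (fun i j => lin E (K i j)).
Proof. by move=> EP; apply: munits_hom; exact: lin_hom. Qed.

End MatrixUnitsConstructions.

(** * Approximation by matrix subalgebras *)

Section TensorSums.
Context {R : realType} {A B T : cstarAlgType R} {t : A -> B -> T}.
Hypothesis tP : tensor_product t.

Lemma t0l b : t 0 b = 0.
Proof. by rewrite -(scale0r (0 : A)) (tZl tP) scale0r. Qed.

Lemma t0r a : t a 0 = 0.
Proof. by rewrite -(scale0r (0 : B)) (tZr tP) scale0r. Qed.

Lemma tNl a b : t (- a) b = - t a b.
Proof. by rewrite -scaleN1r (tZl tP) scaleN1r. Qed.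

Lemma tNr a b : t a (- b) = - t a b.
Proof. by rewrite -scaleN1r (tZr tP) scaleN1r. Qed.

Lemma tBr a b b' : t a (b - b') = t a b - t a b'.
Proof. by rewrite (tDr tP) tNr. Qed.

Lemma t_suml I (s : seq I) (P : pred I) (F : I -> A) b :
  t (\sum_(i <- s | P i) F i) b = \sum_(i <- s | P i) t (F i) b.
Proof. exact: (big_morph (t^~ b) (fun x y => tDl tP x y b) (t0l b)). Qed.

Lemma t_sumr I (s : seq I) (P : pred I) (F : I -> B) a :
  t a (\sum_(i <- s | P i) F i) = \sum_(i <- s | P i) t a (F i).
Proof. exact: (big_morph (t a) (tDr tP a) (t0r a)). Qed.

Lemma t_norm a b : cnorm (t a b) <= cnorm a * cnorm b.
Proof.
rewrite -(tl_iso tP a) -(tr_iso tP b); apply: le_trans (cnormM_le _ _).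
by rewrite (tM tP) mulr1 mul1r.
Qed.

Lemma t_sum_star (I : finType) (x : I -> A) (y : I -> B) :
  star (\sum_i t (x i) (y i)) = \sum_i t (star (x i)) (star (y i)).
Proof. by rewrite star_sum; apply: eq_bigr => i _; rewrite (tJ tP). Qed.

Lemma t_sum_mul (I J : finType) (x : I -> A) (y : I -> B) (x' : J -> A) (y' : J -> B) :
  (\sum_i t (x i) (y i)) * (\sum_j t (x' j) (y' j))
  = \sum_i \sum_j t (x i * x' j) (y i * y' j).
Proof.
rewrite mulr_suml; apply: eq_bigr => i _; rewrite mulr_sumr.
by apply: eq_bigr => j _; rewrite (tM tP).
Qed.

End TensorSums.

Section LocalApproximation.
Context {R : realType} {D T : cstarAlgType R} {t : D -> D -> T}.
Hypothesis tP : tensor_product t.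
Hypothesis allD : forall n, exists E : 'I_n.+1 -> 'I_n.+1 -> D, munits E.

(* The map [x (x) y |-> y (x) g x] is contractive for the tensor norm. *)
Definition flip_contractive (g : D -> D) :=
  forall (J : finType) (x y : J -> D) (q : R),
    cnorm (\sum_i t (x i) (y i)) <= q -> cnorm (\sum_i t (y i) (g (x i))) <= q.

(** The flipped sum is the image under [mx_tensor] of the matrix Z of [slice_bound], whose norm can
    be computed on H2. *)
Lemma compression_flip_contractive {H1 H2 K H : hilbertType R} {h : H1 -> H2 -> K}
    {piA : D -> H1 -> H1} {piB : D -> H2 -> H2} {piT : T -> K -> K} {rho : D -> H -> H}
    k (e : 'I_k.+1 -> H) (E : 'I_k.+1 -> 'I_k.+1 -> D) :
  hilbert_tensor h -> faithful_representation piA ->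
  faithful_representation piB -> faithful_representation piT ->
  (forall a b x y, piT (t a b) (h x y) = h (piA a x) (piB b y)) ->
  faithful_representation rho -> orthonormal (ip := inner) e -> munits E ->
  flip_contractive (fun a => lin E (compress inner e (rho a))).
Proof.
move=> hP piAP piBP piTP tE rhoP eo EP J x y q xy.
have q0 : 0 <= q := le_trans (nu_ge0 (cnorm_cstar_norm T) _) xy.
pose Z : cmat D k := \matrix_(r, s) \sum_i inner (rho (x i) (e s)) (e r) *: y i.
have -> : \sum_i t (y i) (lin E (compress inner e (rho (x i)))) = mx_tensor (t := t) E Z.
  rewrite (mx_tensorE tP); symmetry.
  under eq_bigr => r _ do under eq_bigr => s _ do rewrite mxE (t_suml tP).
  rewrite sum_rot3; apply: eq_bigr => i _.
  rewrite /lin (t_sumr tP); apply: eq_bigr => r _.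
  rewrite (t_sumr tP); apply: eq_bigr => s _.
  by rewrite (tZl tP) (tZr tP) mxE.
apply: (rho_boundV (mx_tensor_cstar_norm tP EP) (ipn_prehilbert inner_prehilbert)
  (rhon_faithful inner_prehilbert (representation_faithful_rep piBP)) q0).
by move=> v; apply: (slice_bound hP piAP piBP piTP tE tP rhoP xy allD eo).
Qed.

Lemma qd_flip_maps {H1 H2 K : hilbertType R} {h : H1 -> H2 -> K}
    {piA : D -> H1 -> H1} {piB : D -> H2 -> H2} {piT : T -> K -> K} :
  hilbert_tensor h -> faithful_representation piA ->
  faithful_representation piB -> faithful_representation piT ->
  (forall a b x y, piT (t a b) (h x y) = h (piA a x) (piB b y)) ->
  quasidiagonal D ->
  forall (P : seq (D * D)) (d : R), 0 < d ->
  exists k, forall E : 'I_k.+1 -> 'I_k.+1 -> D, munits E ->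
  exists g : D -> D, [/\ forall a, exists x, g a = lin E x,
    forall a, g (star a) = star (g a), cnorm (g 1 - 1) <= d,
    forall a b, (a, b) \in P -> cnorm (g (a * b) - g a * g b) <= d &
    flip_contractive g].
Proof.
move=> hP piAP piBP piTP tE qd P d d0.
have [H [rho [rhoP Hqd]]] := quasidiagonal_compression allD qd.
have [k [e [eo eE]]] := Hqd P d d0; exists k => E EP; have [e1 e2] := eE E EP.
have EH := lin_hom EP; have rP := representation_faithful_rep rhoP.
exists (fun a => lin E (compress inner e (rho a))); split.
- by move=> a; exists (compress inner e (rho a)).
- move=> a; rewrite -(shJ EH); congr (lin E _).
  symmetry; apply: (compress_adj inner_prehilbert) => x y.
  by rewrite -(rhoJ rP) starK.
- by rewrite -[X in _ - X](sh1 EH) -(shB EH).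
- by move=> a b abP; rewrite -(shM EH) -(shB EH) e2.
- exact: (compression_flip_contractive hP piAP piBP piTP tE rhoP eo EP).
Qed.

Section FromFlipMaps.
Hypothesis t_dense : forall (z : T) (e : R), 0 < e ->
  exists (n : nat) (a : 'I_n -> D) (b : 'I_n -> D),
    cnorm (z - \sum_(i < n) t (a i) (b i)) < e.
Hypothesis flip_maps : forall (P : seq (D * D)) (d : R), 0 < d ->
  exists k, forall E : 'I_k.+1 -> 'I_k.+1 -> D, munits E ->
  exists g : D -> D, [/\ forall a, exists x, g a = lin E x,
    forall a, g (star a) = star (g a), cnorm (g 1 - 1) <= d,
    forall a b, (a, b) \in P -> cnorm (g (a * b) - g a * g b) <= d &
    flip_contractive g].
Let nT := cnorm_cstar_norm T.
Let nD := cnorm_cstar_norm D.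

(** * Slicing an approximation of the intertwining unitary *)

Section Estimates.
Variables (n : nat) (x y : 'I_n -> D) (u : T) (e : R).
Hypotheses (uP : unitary u) (e0 : 0 < e) (e32 : 32 * e <= 1).
Local Notation X := (\sum_i t (x i) (y i)).
Hypothesis uX : cnorm (u - X) <= e.
Let Y : R := \sum_i cnorm (y i).
Variables (g : D -> D) (d : R).
Hypotheses (gJ : forall a, g (star a) = star (g a)) (g1 : cnorm (g 1 - 1) <= d).
Hypotheses (gxx : forall i j, cnorm (g (star (x i) * x j) - g (star (x i)) * g (x j)) <= d)
  (gxx' : forall i j, cnorm (g (x i * star (x j)) - g (x i) * g (star (x j))) <= d).
Hypotheses (d0 : 0 < d) (dY : d * (1 + Y) ^+ 2 <= e).
Hypothesis gc : flip_contractive g.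
Local Notation XX := (\sum_i t (y i) (g (x i))).

Let Y0 : 0 <= Y.
Proof. by apply: sumr_ge0 => i _; exact: (nu_ge0 nD). Qed.

Let X2 : cnorm X <= 2.
Proof.
have := nu_le_add nT X u; rewrite (nuBC nT) (nu_isometry nT uP.1).
by have := uX; have := e32; lra.
Qed.

Lemma XX_le2 : cnorm XX <= 2.
Proof. exact: gc. Qed.

Let sum2_le (F : 'I_n -> 'I_n -> D) (z : 'I_n -> 'I_n -> D) :
  (forall i j, cnorm (z i j) <= cnorm (y i) * cnorm (y j)) ->
  (forall i j, cnorm (F i j) <= d) ->
  cnorm (\sum_i \sum_j t (z i j) (F i j)) <= Y ^+ 2 * d.
Proof.
move=> zy Fd; apply: le_trans (nu_sum nT _ _ _) _.
rewrite expr2 -mulrA {1}/Y mulr_suml; apply: ler_sum => i _.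
apply: le_trans (nu_sum nT _ _ _) _.
rewrite {1}/Y mulr_suml mulr_sumr; apply: ler_sum => j _.
apply: le_trans (t_norm tP _ _) _; rewrite mulrA.
by apply: ler_pM => //; exact: (nu_ge0 nD).
Qed.

(* [z i j] and [w i j] play the roles of x_i^* x_j and y_i^* y_j, then of
   x_i x_j^* and y_i y_j^*. *)
Let square_estimate (z w : 'I_n -> 'I_n -> D) (G : 'I_n -> 'I_n -> D) :
  cnorm (1 - \sum_i \sum_j t (z i j) (w i j)) <= 3 * e ->
  (forall i j, cnorm (w i j) <= cnorm (y i) * cnorm (y j)) ->
  (forall i j, cnorm (g (z i j) - G i j) <= d) ->
  cnorm (1 - \sum_i \sum_j t (w i j) (G i j)) <= 4 * e.
Proof.
move=> zw3 wy gG.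
(* The additional summand turns the difference from 1 into one sum of simple tensors, as
   [flip_contractive] requires. *)
pose x1 (s : 'I_n * 'I_n + 'I_1) := match s with inl p => z p.1 p.2 | inr _ => 1 end.
pose y1 (s : 'I_n * 'I_n + 'I_1) := match s with inl p => w p.1 p.2 | inr _ => - 1 end.
have h1 : cnorm (\sum_s t (x1 s) (y1 s)) <= 3 * e.
  rewrite big_sumType big_ord1 /= -(pair_bigA _ (fun i j => t (z i j) (w i j))) /=.
  by rewrite (tNr tP) (t11 tP) (nuBC nT).
have := gc h1.
rewrite big_sumType big_ord1 /= -(pair_bigA _ (fun i j => t (w i j) (g (z i j)))) /=.
rewrite (tNl tP) => h2.
have h3 : cnorm (\sum_i \sum_j t (w i j) (g (z i j) - G i j)) <= Y ^+ 2 * d.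
  exact: sum2_le.
have h4 : cnorm (t 1 (g 1 - 1)) <= d by rewrite (tr_iso tP).
have -> : 1 - \sum_i \sum_j t (w i j) (G i j)
   = \sum_i \sum_j t (w i j) (g (z i j) - G i j)
     - (\sum_i \sum_j t (w i j) (g (z i j)) - t 1 (g 1)) - t 1 (g 1 - 1).
  have -> : \sum_i \sum_j t (w i j) (g (z i j) - G i j)
      = \sum_i \sum_j t (w i j) (g (z i j)) - \sum_i \sum_j t (w i j) (G i j).
    rewrite -sumrB; apply: eq_bigr => i _; rewrite -sumrB; apply: eq_bigr => j _.
    exact: (tBr tP).
  by rewrite (tBr tP) (t11 tP); nc_ring.
apply: le_trans (nuB nT _ _) _; have := nuB nT
  (\sum_i \sum_j t (w i j) (g (z i j) - G i j))
  (\sum_i \sum_j t (w i j) (g (z i j)) - t 1 (g 1)).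
have := dY; have := Y0; have := d0; move: h2 h3 h4.
(* The hypothesis [dY] absorbs the defect Y^2 d of the products together with the defect d of the
   unit. *)
have -> : d * (1 + Y) ^+ 2 = d + 2 * (Y * d) + Y ^+ 2 * d by ring.
move=> h2 h3 h4 d0' Y0'; have : 0 <= Y * d by rewrite mulr_ge0// ltW.
move: h2 h3 h4; lra.
Qed.

Let X_unitary : cnorm (1 - star X * X) <= 3 * e /\ cnorm (1 - X * star X) <= 3 * e.
Proof.
have Xu : cnorm (X - u) <= e by rewrite (nuBC nT).
have sXu : cnorm (star X - star u) <= e by rewrite -starB (nuJ nT).
have u1 := nu_isometry nT uP.1.
have su1 : cnorm (star u) <= 1 by rewrite (nuJ nT) u1.
have sX2 : cnorm (star X) <= 2 by rewrite (nuJ nT).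
split.
  have -> : 1 - star X * X = - ((star X * (X - u)) + (star X - star u) * u).
    by rewrite -uP.1; nc_ring.
  rewrite (nuN nT); apply: le_trans (nuD nT _ _) _.
  have := nuM_le nT sX2 Xu; have := nuM_le nT sXu (lexx (cnorm u)); rewrite u1.
  by have := e32; lra.
have -> : 1 - X * star X = - (((X - u) * star X) + u * (star X - star u)).
  by rewrite -uP.2; nc_ring.
rewrite (nuN nT); apply: le_trans (nuD nT _ _) _.
have := nuM_le nT Xu sX2; have := nuM_le nT (lexx (cnorm u)) sXu; rewrite u1.
by have := e32; lra.
Qed.

Lemma XX_unitary : cnorm (1 - star XX * XX) <= 4 * e /\ cnorm (1 - XX * star XX) <= 4 * e.
Proof.
have [h1 h2] := X_unitary; rewrite !(t_sum_star tP) !(t_sum_mul tP) in h1 h2 *.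
split; apply: square_estimate.
- exact: h1.
- by move=> i j; rewrite (nuM_le nD)// (nuJ nD).
- by move=> i j; rewrite -gJ.
- exact: h2.
- by move=> i j; rewrite (nuM_le nD)// (nuJ nD).
- by move=> i j; rewrite -gJ.
Qed.

Lemma g_contr a : cnorm (g a) <= cnorm a.
Proof.
have := @gc 'I_1 (fun=> a) (fun=> 1) (cnorm a); rewrite !big_ord1 (tr_iso tP) (tl_iso tP).
exact.
Qed.

(** X (1 (x) a) - (b (x) 1) X is small and is one sum of simple tensors. Its flipped image is the
    desired difference, up to the multiplicativity defects of g at b and the x_i. *)
Lemma XX_intertwines a b (M : R) : 1 <= M -> cnorm a <= M -> cnorm b <= M ->
  cnorm (u * t 1 a - t b 1 * u) <= e ->
  (forall i, cnorm (g (b * x i) - g b * g (x i)) <= d) ->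
  cnorm (XX * t a 1 - t 1 (g b) * XX) <= (2 * M + 2) * e.
Proof.
move=> M1 aM bM uab gb.
pose x1 (s : 'I_n + 'I_n) := match s with inl i => x i | inr i => b * x i end.
pose y1 (s : 'I_n + 'I_n) := match s with inl i => y i * a | inr i => - y i end.
have h1 : cnorm (\sum_s t (x1 s) (y1 s)) <= (2 * M + 1) * e.
  have -> : \sum_s t (x1 s) (y1 s) = X * t 1 a - t b 1 * X.
    rewrite big_sumType /= mulr_suml mulr_sumr -sumrN.
    congr (_ + _); apply: eq_bigr => i _; rewrite (tM tP) ?mulr1 ?mul1r//.
    by rewrite (tNr tP).
  have -> : X * t 1 a - t b 1 * X = - ((u - X) * t 1 a) + (u * t 1 a - t b 1 * u)
     + t b 1 * (u - X) by nc_ring.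
  have ta : cnorm (t 1 a) <= M by rewrite (tr_iso tP).
  have tb : cnorm (t b 1) <= M by rewrite (tl_iso tP).
  apply: le_trans (nuD nT _ _) _.
  have := nuD nT (- ((u - X) * t 1 a)) (u * t 1 a - t b 1 * u); rewrite (nuN nT).
  have := nuM_le nT uX ta; have := nuM_le nT tb uX; move: uab; lra.
have := gc h1; rewrite big_sumType /= => h2.
have h3 : cnorm (\sum_i t (y i) (g (b * x i) - g b * g (x i))) <= Y * d.
  apply: le_trans (nu_sum nT _ _ _) _; rewrite /Y mulr_suml; apply: ler_sum => i _.
  apply: le_trans (t_norm tP _ _) _; apply: ler_pM => //; exact: (nu_ge0 nD).
have -> : XX * t a 1 - t 1 (g b) * XX
  = (\sum_i t (y i * a) (g (x i)) + \sum_i t (- y i) (g (b * x i)))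
    + \sum_i t (y i) (g (b * x i) - g b * g (x i)).
  rewrite mulr_suml mulr_sumr -addrA -big_split -sumrN /=.
  congr (_ + _); apply: eq_bigr => i _; rewrite (tM tP) ?mulr1 ?mul1r//.
  by rewrite (tBr tP) (tNl tP) addrA addNr add0r.
apply: le_trans (nuD nT _ _) _; have := dY; have := Y0; have := d0; move: h2 h3.
have -> : d * (1 + Y) ^+ 2 = d + 2 * (Y * d) + d * Y ^+ 2 by ring.
move=> h2 h3 d0' Y0'; have yd0 : 0 <= Y * d by rewrite mulr_ge0// ltW.
have : 0 <= d * Y ^+ 2 by rewrite mulr_ge0 ?sqr_ge0// ltW.
move: h2 h3 yd0; lra.
Qed.

End Estimates.

Context {phi : D -> T} {psi : T -> D}.
Hypotheses (phiP : star_hom phi) (psiP : star_hom psi).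
Hypotheses (phiK : cancel phi psi) (psiK : cancel psi phi).
Hypothesis phi_iso : forall a, cnorm (phi a) = cnorm a.
Hypothesis phi_approx : exists w : nat -> T, (forall n, unitary (w n)) /\
  forall a (e : R), 0 < e -> exists N, forall n, (N <= n)%N ->
    cnorm (w n * phi a * star (w n) - t a 1) < e.

Lemma local_matrix_approximation (F : seq D) (e : R) (m : nat) : 0 < e ->
  exists N (E : 'I_N.+1 -> 'I_N.+1 -> D), [/\ munits E, (m.+1 %| N.+1)%N &
    forall a, a \in F -> exists x, cnorm (a - lin E x) <= e].
Proof.
move=> e0; pose M : R := 1 + \sum_(a <- F) cnorm a.
have M1 : 1 <= M by rewrite lerDl sumr_ge0// => a _; exact: (nu_ge0 nD).
have FM a : a \in F -> cnorm a <= M.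
  move=> aF; rewrite /M (perm_big _ (perm_to_rem aF)) big_cons /=.
  rewrite addrCA lerDl addr_ge0// sumr_ge0// => b _; exact: (nu_ge0 nD).
(* [polar] needs 4 e1 <= 1/8. The total error is 37 M e1: twice 16 M e1 for replacing XX by its
   polar part U, (2M + 2) e1 <= 4 M e1 for [XX_intertwines], and e1 for conjugating phi a by u. *)
pose e1 := Num.min 32^-1 (e / (37 * M)).
have e10 : 0 < e1 by rewrite lt_min invr_gt0 divr_gt0//=; lra.
have e132 : 32 * e1 <= 1 by rewrite -ler_pdivlMl// mulr1 ge_min lexx.
have e1M : 37 * M * e1 <= e.
  by rewrite mulrC -ler_pdivlMr ?ge_min ?lexx ?orbT//; lra.
pose beta a := psi (t 1 a).
have beta_norm a : cnorm (beta a) = cnorm a by rewrite -phi_iso psiK (tr_iso tP).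
have [w [wU wphi]] := phi_approx.
have [N0 N0P] : exists N, forall n, (N <= n)%N -> forall a, a \in F ->
    cnorm (w n * phi a * star (w n) - t a 1) < e1 /\
    cnorm (w n * phi (beta a) * star (w n) - t (beta a) 1) < e1.
  elim: (F) => [|a s [N NP]]; first by exists 0%N.
  have [N1 N1P] := wphi a _ e10; have [N2 N2P] := wphi (beta a) _ e10.
  exists (maxn N (maxn N1 N2)) => n; rewrite !geq_max => /and3P[Nn N1n N2n] b.
  by rewrite in_cons => /predU1P[->|/(NP n Nn)//]; split; [exact: N1P|exact: N2P].
pose u := w N0; have uU : unitary u := wU N0.
have uF a : a \in F -> cnorm (phi a - star u * t a 1 * u) <= e1.
  move=> aF; have [/ltW h _] := N0P N0 (leqnn _) a aF.
  apply: le_trans h; have -> : phi a - star u * t a 1 * u =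
      star u * (u * phi a * star u - t a 1) * star (star u).
    by rewrite starK mulrBr mulrBl !mulrA uU.1 mul1r -(mulrA (phi a)) uU.1 mulr1.
  exact: (nu_conj nT _ (unitary_star uU)).
have uB a : a \in F -> cnorm (u * t 1 a - t (beta a) 1 * u) <= e1.
  move=> aF; have [_ /ltW] := N0P N0 (leqnn _) a aF; rewrite psiK -/u => h.
  have -> : u * t 1 a - t (beta a) 1 * u = (u * t 1 a * star u - t (beta a) 1) * u.
    by rewrite mulrBl -!mulrA uU.1 mulr1.
  by rewrite -[e1]mulr1 -(nu_isometry nT uU.1) (nuM_le nT).
have [n [x [y /ltW uX]]] := t_dense u e10.
pose Y : R := \sum_i cnorm (y i).
have Y0 : 0 <= Y by apply: sumr_ge0 => i _; exact: (nu_ge0 nD).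
have Y1 : 0 < (1 + Y) ^+ 2 by rewrite exprn_gt0//; lra.
pose d := e1 / (1 + Y) ^+ 2; have d0 : 0 < d by rewrite divr_gt0.
have dY : d * (1 + Y) ^+ 2 <= e1 by rewrite /d mulfVK ?gt_eqF.
pose P := [seq (star (x i), x j) | i <- enum 'I_n, j <- enum 'I_n]
  ++ [seq (x i, star (x j)) | i <- enum 'I_n, j <- enum 'I_n]
  ++ [seq (beta a, x i) | a <- F, i <- enum 'I_n].
have [k kP] := flip_maps P d0.
(* The values of g are placed in a block copy L inside a matrix algebra whose size is also a
   multiple of m+1. *)
have [N kmN] : exists N, N.+1 = (k.+1 * m.+1)%N.
  by exists (k.+1 * m.+1).-1; rewrite prednK ?muln_gt0.
have [E0 E0P] := allD N.
have [|L LP] := @munits_div R k N; first by rewrite kmN dvdn_mulr.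
have EP := munits_lin E0P LP.
have [g [gE gJ g1 gP gc]] := kP _ EP.
have gxx i j : cnorm (g (star (x i) * x j) - g (star (x i)) * g (x j)) <= d.
  apply: gP; rewrite mem_cat; apply/orP; left.
  by apply: (allpairs_f (fun i j => (star (x i), x j))); rewrite mem_enum.
have gxx' i j : cnorm (g (x i * star (x j)) - g (x i) * g (star (x j))) <= d.
  apply: gP; rewrite !mem_cat; apply/or3P; apply: Or32.
  by apply: (allpairs_f (fun i j => (x i, star (x j)))); rewrite mem_enum.
have gb a i : a \in F -> cnorm (g (beta a * x i) - g (beta a) * g (x i)) <= d.
  move=> aF; apply: gP; rewrite !mem_cat; apply/or3P; apply: Or33.
  by apply: (allpairs_f (fun a i => (beta a, x i))); rewrite ?mem_enum.
have [XX1 XX2] := XX_unitary uU e132 uX gJ g1 gxx gxx' d0 dY gc.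
set XX := \sum_i t (y i) (g (x i)) in XX1 XX2.
have XXn : cnorm XX <= 2 by exact: (XX_le2 uU e132 uX gc).
have [|U [UU UXX _]] := polar nT XX1 XX2; first by lra.
have {}UXX : cnorm (U - XX) <= 16 * e1.
  apply: le_trans UXX _; have : cnorm XX * (2 * (4 * e1)) <= 2 * (2 * (4 * e1)).
    by rewrite ler_pM2r// !mulr_gt0.
  lra.
have UF a : a \in F -> cnorm (U * t a 1 - t 1 (g (beta a)) * U) <= 36 * M * e1.
  move=> aF; have aM := FM a aF; have bM : cnorm (beta a) <= M by rewrite beta_norm.
  have h := XX_intertwines uX d0 dY gc M1 aM bM (uB a aF) (fun i => gb a i aF).
  have -> : U * t a 1 - t 1 (g (beta a)) * U = (U - XX) * t a 1
      + (XX * t a 1 - t 1 (g (beta a)) * XX) - t 1 (g (beta a)) * (U - XX) by nc_ring.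
  have ta : cnorm (t a 1) <= M by rewrite (tl_iso tP).
  have tg : cnorm (t 1 (g (beta a))) <= M.
    by rewrite (tr_iso tP) (le_trans (g_contr gc _)).
  apply: le_trans (nuB nT _ _) _.
  have := nuD nT ((U - XX) * t a 1) (XX * t a 1 - t 1 (g (beta a)) * XX).
  have := nuM_le nT UXX ta; have := nuM_le nT tg UXX.
  have : e1 <= M * e1 by rewrite ler_peMl ?(ltW e10).
  move: h; rewrite -/XX; lra.
pose v := U * u; have vU : unitary v := unitaryM UU uU.
pose conjv z := star v * z * v; have cvP : star_hom conjv := conj_hom vU.
(* A unital endomorphism of D; it carries the units [E0] to those whose span approximates F. *)
pose f z := psi (conjv (t 1 z)).
have fP : star_hom f := star_hom_comp (star_hom_comp (tr_hom tP) cvP) psiP.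
exists N, (fun i j => f (E0 i j)); split.
- exact: (munits_hom fP E0P).
- by rewrite kmN dvdn_mull.
move=> a aF; have [z gz] := gE (beta a).
exists (lin L z); rewrite -(lin_comp E0 _ fP) (lin_comp L z (lin_hom E0P)) -gz.
rewrite -phi_iso (shB phiP) psiK.
have -> : phi a - conjv (t 1 (g (beta a))) = (phi a - star u * t a 1 * u)
   + star u * (star U * (U * t a 1 - t 1 (g (beta a)) * U)) * star (star u).
  rewrite starK mulrBr (mulrA (star U)) UU.1 mul1r mulrBr mulrBl addrA subrK.
  by rewrite /conjv /v starM !mulrA.
apply: le_trans (nuD nT _ _) _.
have h1 := uF a aF.
have h2 := nu_conj nT (star U * (U * t a 1 - t 1 (g (beta a)) * U)) (unitary_star uU).
have h3 : cnorm (star U * (U * t a 1 - t 1 (g (beta a)) * U)) <= 36 * M * e1.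
  apply: le_trans (nuM nT _ _) _.
  by rewrite (nu_isometry nT (unitary_star UU).1) mul1r UF.
have : e1 <= M * e1 by rewrite ler_peMl ?(ltW e10).
lra.
Qed.

End FromFlipMaps.

End LocalApproximation.

(** * Perturbation of matrix units *)

Lemma nu_mul_near (R : realType) (W : starAlgType R) (nu : W -> R) a a' b b' (r s : R) :
  star_norm nu -> nu (a - a') <= r -> nu (b - b') <= s -> nu a' <= 1 -> nu b' <= 1 ->
  r <= 1 -> nu (a * b - a' * b') <= r + 2 * s.
Proof.
move=> nuP ar bs a1 b1 r1.
have -> : a * b - a' * b' = a * (b - b') + (a - a') * b' by nc_ring.
apply: le_trans (nuD nuP _ _) _.
have a2 : nu a <= 2 by have := nu_le_add nuP a a'; lra.
have := nuM_le nuP a2 bs; have := nuM_le nuP ar b1; lra.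
Qed.

Lemma projection_nu_le1 (R : realType) (W : starAlgType R) (nu : W -> R) (p : W) :
  cstar_norm nu -> p * p = p -> star p = p -> nu p <= 1.
Proof.
move=> nuP pp ps; have := nuC nuP p; rewrite ps pp.
by have := nu_ge0 nuP p; set r := nu p; nra.
Qed.

(** As the v_i v_i^* add up to 1, the matrix D of defects is idempotent, and an idempotent with
    small entries is 0: the sum s of the norms of its entries satisfies s <= s/2. *)
Lemma orthogonal_isometries (R : realType) (W : starAlgType R) (nu : W -> R) n
    (v : 'I_n.+1 -> W) (p : W) (k : R) :
  star_norm nu -> p * p = p -> star p = p -> (forall i, v i * p = v i) ->
  \sum_i v i * star (v i) = 1 ->
  (forall i j, nu (p *+ (i == j) - star (v i) * v j) <= k) -> n.+1%:R * k <= 2^-1 ->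
  forall i j, star (v i) * v j = p *+ (i == j).
Proof.
move=> nuP pp ps vp vv vk nk.
have pv i : p * star (v i) = star (v i) by rewrite -{1}ps -starM vp.
pose D i j := p *+ (i == j) - star (v i) * v j.
have DD i j : \sum_l D i l * D l j = D i j.
  have -> : \sum_l D i l * D l j = \sum_l (p * p *+ (l == j) *+ (i == l)
      - (p * (star (v l) * v j)) *+ (i == l) - (star (v i) * v l * p) *+ (l == j)
      + star (v i) * (v l * star (v l)) * v j).
    apply: eq_bigr => l _; rewrite /D mulrBl !mulrBr !mulrnAl !mulrnAr.
    by rewrite opprB addrA addrAC !mulrA.
  rewrite big_split /= -mulr_suml -mulr_sumr vv mulr1 !sumrB.
  rewrite !sum_delta sum_delta_sym pp.
  by rewrite mulrA pv -mulrA vp subrK.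
suff D0 i j : D i j = 0 by move=> i j; apply/esym/eqP; rewrite -subr_eq0 -/(D i j) D0.
pose s : R := \sum_i \sum_j nu (D i j).
have D_ge0 i' j' : 0 <= nu (D i' j') by exact: nu_ge0 nuP _.
have le_s : s <= n.+1%:R * k * s.
  rewrite {1}/s; apply: le_trans (_ : \sum_i \sum_(j < n.+1) \sum_l
      nu (D i l) * k <= _).
    apply: ler_sum => i' _; apply: ler_sum => j' _; rewrite -DD.
    apply: le_trans (nu_sum nuP _ _ _) _; apply: ler_sum => l _.
    by rewrite (nuM_le nuP)//; exact: vk.
  under eq_bigr do rewrite sumr_const card_ord -[_ *+ n.+1]mulr_natl -mulr_suml.
  by rewrite -mulr_sumr -mulr_suml -/s [s * _]mulrC mulrA.
have s0 : 0 <= s by do 2 (apply: sumr_ge0 => ? _).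
have s_le0 : s <= 0 by have := ler_wpM2r s0 nk; clear -le_s; lra.
apply: (nu_eq0 nuP); apply/eqP; rewrite eq_le D_ge0 andbT (le_trans _ s_le0)//.
rewrite /s (bigD1 i)//= (bigD1 j)//= -addrA lerDl addr_ge0 ?sumr_ge0// => l _.
by rewrite sumr_ge0.
Qed.

Lemma munits_of_isometries (R : realType) (W : starAlgType R) n (v : 'I_n -> W) (p : W) :
  p * p = p -> star p = p -> (forall i, v i * p = v i) ->
  \sum_i v i * star (v i) = 1 -> (forall i j, star (v i) * v j = p *+ (i == j)) ->
  munits (fun i j => v i * star (v j)).
Proof.
move=> pp ps vp vv vvp; split=> [i k l m|i k|//].
  rewrite -mulrA (mulrA (star (v k))) vvp mulrnAl mulrnAr mulrA vp.
  by [].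
by rewrite starM starK.
Qed.

(** The real part of y is almost idempotent, with defect 4Cd, and [near_projection] applies, giving
    4 * 4Cd * 5C + d <= 81 C^2 d. The constant C is there because the norm of a projection may
    exceed 1 without the C*-identity. *)
Lemma near_proj_hom (R : realType) (A W : starAlgType R) (nu : A -> R) (j : W -> A)
    (p : A) (y : W) (C d : R) :
  star_norm nu -> star_hom j -> star_norm (fun w => nu (j w)) ->
  1 <= C -> nu 1 <= C -> nu p <= C -> p * p = p -> star p = p ->
  nu (j y - p) <= d -> 0 < d -> 128 * (C * d) <= 1 ->
  exists q, [/\ q * q = q, star q = q & nu (j q - p) <= 81 * (C * C * d)].
Proof.
move=> nuP jP mu C1 n1 np pp ps yd d0 Cd.
have C0 : 0 <= C by lra.
have dC : d <= C * d by rewrite ler_peMl// ltW.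
have CdCC : C * d <= C * C * d by rewrite -mulrA ler_peMl ?mulr_ge0// ltW.
pose b := 2^-1 *: (y + star y).
have bs : star b = b by rewrite star_half starD starK addrC.
have be : nu (j b - p) <= d.
  have -> : j b - p = 2^-1 *: ((j y - p) + star (j y - p)).
    rewrite (shZ jP) (shD jP) (shJ jP) -{1}(scale_half2 p) -scalerBr; congr (_ *: _).
    by rewrite starB ps; nc_ring.
  rewrite (nu_half nuP) ler_pdivrMr//; have := nuD nuP (j y - p) (star (j y - p)).
  by rewrite (nuJ nuP); move: yd; clear; lra.
have d1 : d <= 1 by move: Cd dC; clear; lra.
have jbC : nu (j b) <= C + d by have := nu_le_add nuP (j b) p; move: be np; clear; lra.
have bb : nu (j (b * b - b)) <= 4 * (C * d).
  have -> : j (b * b - b) = j b * (j b - p) + (j b - p) * p - (j b - p).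
    by rewrite (shB jP) (shM jP) -{4}pp; nc_ring.
  apply: le_trans (nuB nuP _ _) _; have := nuD nuP (j b * (j b - p)) ((j b - p) * p).
  have := nuM_le nuP jbC be; have := nuM_le nuP be np.
  have dd : d * d <= d by rewrite ler_piMr// ltW.
  by move: be dC dd; clear; lra.
have [|q [qq qs qb]] := near_projection mu bs bb.
  by move: Cd; clear; lra.
have b5 : nu (j (b + b - 1)) <= 5 * C.
  rewrite (shB jP) (shD jP) (sh1 jP).
  have := nuB nuP (j b + j b) 1; have := nuD nuP (j b) (j b).
  by move: jbC n1 d1 C1; clear; lra.
exists q; split=> //.
have CC0 : 0 <= 4 * (4 * (C * d)) by rewrite !mulr_ge0// ltW.
have h := le_trans qb (ler_wpM2l CC0 b5); rewrite (shB jP) in h.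
by have := nu_tri nuP (j b) (j q) p; move: h be CdCC dC; clear; lra.
Qed.

(** Only the first column of E is approximated, by elements a_i = x_i p with p a projection near
    E_00. Multiplying by the inverse root of the sum S of the a_i a_i^* makes the ranges add up to
    1, and orthogonality is then automatic. Errors: 163 = 1 + 2 * 81 for a_i, 489 = 3 * 163 for S,
    2119 = 2 * 978 + 163 for v_i, 6357 = 3 * 2119 for the units; 13116 exceeds 2 * (6357 + 81). *)
Lemma near_munits (R : realType) (A W : starAlgType R) (nu : A -> R) (j : W -> A)
    n (E : 'I_n.+1 -> 'I_n.+1 -> A) (d c : R) :
  cstar_norm nu -> star_hom j -> cstar_norm (fun w => nu (j w)) ->
  munits E -> c = n.+1%:R -> 0 < d -> 13116 * (c * c * d) <= 1 ->
  (forall k l, exists x, nu (E k l - j x) <= d) ->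
  exists K : 'I_n.+1 -> 'I_n.+1 -> W, munits K /\
  forall k l, nu (E k l - j (K k l)) <= 6357 * (c * d).
Proof.
move=> nuP jP mu EP cE d0 dc EF.
have c1 : 1 <= c by rewrite cE ler1n.
have cd : c * d <= c * c * d.
  by rewrite -mulrA ler_peMl// mulr_ge0// ?(ltW d0)//; clear -c1; lra.
have dcd : d <= c * d by rewrite ler_peMl// (ltW d0).
have E1 k l : nu (E k l) <= 1 := munits_nu_le1 EP k l nuP.
have EE k l : E k l = E k ord0 * E ord0 l by rewrite (muM EP) eqxx mulr1n.
have /choice[x xE] : forall i, exists x, nu (E i ord0 - j x) <= d by move=> i; exact: EF.
have {}xE i : nu (j (x i) - E i ord0) <= d by rewrite (nuBC nuP).
have [||||p [pp ps pE]] :=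
  near_proj_hom (y := x ord0) nuP jP mu (lexx 1) _ (E1 ord0 ord0) _ _ (xE ord0) d0.
- by rewrite (nu1 nuP).
- by rewrite -EE.
- by rewrite (muJ EP).
- by rewrite mul1r; clear -dc cd dcd; lra.
rewrite !mul1r in pE.
have p1 : nu (j p) <= 1 by apply: (projection_nu_le1 mu).
pose a i := x i * p.
have ap i : a i * p = a i by rewrite /a -mulrA pp.
have aE i : nu (j (a i) - E i ord0) <= 163 * d.
  rewrite (shM jP) EE.
  apply: le_trans (nu_mul_near nuP (xE i) pE (E1 _ _) (E1 _ _) _) _;
    by clear -dc cd dcd; lra.
have aE' i : nu (j (star (a i)) - E ord0 i) <= 163 * d.
  by rewrite (shJ jP) -(muJ EP i ord0) -starB (nuJ nuP).
pose S := \sum_i a i * star (a i).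
have S1 : nu (j (1 - S)) <= 489 * (c * d).
  rewrite (shB jP) (sh1 jP) (sh_sum jP) -(mu1 EP) -sumrB.
  apply: le_trans (nu_sum nuP _ _ _) _.
  apply: le_trans (_ : \sum_(i < n.+1) 489 * d <= _).
    apply: ler_sum => i _; rewrite (nuBC nuP) (shM jP) (EE i i).
    by apply: le_trans (nu_mul_near nuP (aE i) (aE' i) (E1 _ _) (E1 _ _) _) _;
      clear -dc cd dcd; lra.
  by rewrite sumr_const card_ord -[_ *+ n.+1]mulr_natl -cE mulrCA.
have [|z [zE nz [zs zc]]] := inv_sqrt1B mu (x := 1 - S).
  by clear -S1 dc cd; lra.
rewrite subKr in zE.
have Ss : star S = S.
  by rewrite star_sum; apply: eq_bigr => i _; rewrite starM starK.
have {}zs : star z = z by apply: zs; rewrite starB star1 Ss.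
have Sz : S * (1 + z) = (1 + z) * S.
  apply: (commrD (commr1 S)); apply: zc.
  by rewrite mulrBr mulrBl mulr1 mul1r.
pose v i := (1 + z) * a i.
have vp i : v i * p = v i by rewrite /v -mulrA ap.
have vv : \sum_i v i * star (v i) = 1.
  rewrite -[RHS]zE; under eq_bigr => i _.
    rewrite /v starM starD star1 zs mulrA -(mulrA (1 + z)); over.
  by rewrite -mulr_suml -mulr_sumr -/S -Sz mulrA.
have vE i : nu (j (v i) - E i ord0) <= 2119 * (c * d).
  have -> : j (v i) - E i ord0 = j z * j (a i) + (j (a i) - E i ord0).
    by rewrite /v mulrDl mul1r (shD jP) (shM jP); nc_ring.
  apply: le_trans (nuD nuP _ _) _.
  have a2 : nu (j (a i)) <= 2.
    have := nu_le_add nuP (j (a i)) (E i ord0); have := aE i; have := E1 i ord0.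
    by clear -dc cd dcd; lra.
  by have := nuM_le nuP nz a2; have := aE i; clear -S1 dcd; lra.
have vE' i : nu (j (star (v i)) - E ord0 i) <= 2119 * (c * d).
  by rewrite (shJ jP) -(muJ EP i ord0) -starB (nuJ nuP).
have small : 2119 * (c * d) <= 1 by clear -dc cd dcd d0; lra.
have vvp : forall k l, star (v k) * v l = p *+ (k == l).
  apply: (orthogonal_isometries mu pp ps vp vv (k := 6438 * (c * d))) => [k l|].
    have -> : j (p *+ (k == l) - star (v k) * v l) = (j p - E ord0 ord0) *+ (k == l)
        - (j (star (v k)) * j (v l) - E ord0 k * E l ord0).
      rewrite (muM EP) (shB jP) (shM jP) mulrnBl; case: (k == l); last first.
        by rewrite !mulr0n (sh0 jP); nc_ring.
      by rewrite !mulr1n; nc_ring.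
    apply: le_trans (nuB nuP _ _) _.
    have h1 : nu (j (star (v k)) * j (v l) - E ord0 k * E l ord0) <=
        2119 * (c * d) + 2 * (2119 * (c * d)).
      exact: (nu_mul_near nuP (vE' k) (vE l)).
    have h2 : nu ((j p - E ord0 ord0) *+ (k == l)) <= 81 * (c * d).
      case: (k == l); rewrite ?mulr1n ?mulr0n ?(nu0 nuP).
        by clear -pE dcd; lra.
      by clear -d0 dcd; lra.
    by clear -h1 h2; lra.
  by rewrite -cE mulrCA mulrA; clear -dc; lra.
exists (fun k l => v k * star (v l)); split; first exact: munits_of_isometries vvp.
move=> k l; rewrite (nuBC nuP) (shM jP) EE.
have -> : 6357 * (c * d) = 2119 * (c * d) + 2 * (2119 * (c * d)) by clear; ring.
exact: (nu_mul_near nuP (vE k) (vE' l)).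
Qed.

(** z intertwines the two systems exactly and is close to 1; its polar part keeps both properties.
    With c = (n+1)d, z is within 3c of being unitary, so u is within 12c of z and 13c of 1. *)
Lemma near_munits_conj (R : realType) (A : starAlgType R) (nu : A -> R) n
    (E E' : 'I_n.+1 -> 'I_n.+1 -> A) (d : R) :
  cstar_norm nu -> munits E -> munits E' ->
  (forall i j, nu (E i j - E' i j) <= d) -> 24 * (n.+1%:R * d) <= 1 ->
  exists u, [/\ unitary u, nu (u - 1) <= 13 * (n.+1%:R * d) &
    forall i j, u * E' i j = E i j * u].
Proof.
move=> nuP EP EP' EE' dn; pose z := \sum_i E i ord0 * E' ord0 i.
have d0 : 0 <= n.+1%:R * d.
  by rewrite mulr_ge0// (le_trans _ (EE' ord0 ord0))// (nu_ge0 nuP).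
have zE' k l : z * E' k l = E k l * z.
  transitivity (E k ord0 * E' ord0 l).
    rewrite mulr_suml; under eq_bigr => i _.
      rewrite -mulrA (muM EP') mulrnAr; over.
    exact: sum_delta_sym.
  rewrite mulr_sumr; under [RHS]eq_bigr => i _.
    rewrite mulrA (muM EP) mulrnAl; over.
  by rewrite sum_delta.
have z1 : nu (1 - z) <= n.+1%:R * d.
  rewrite -(mu1 EP) -sumrB; apply: le_trans (nu_sum nuP _ _ _) _.
  apply: le_trans (_ : \sum_(i < n.+1) d <= _).
    apply: ler_sum => i _.
    have -> : E i i - E i ord0 * E' ord0 i = E i ord0 * (E ord0 i - E' ord0 i).
      by rewrite mulrBr (muM EP) eqxx mulr1n.
    by rewrite -[d]mul1r (nuM_le nuP)// (munits_nu_le1 EP _ _ nuP).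
  by rewrite sumr_const card_ord mulr_natl.
set c := n.+1%:R * d in dn d0 z1 *.
have z1' : nu (1 - star z) <= c by rewrite -star1 -starB (nuJ nuP).
have z2 : nu z <= 1 + c.
  by have := nu_le_add nuP z 1; rewrite (nuBC nuP) (nu1 nuP); clear -z1; lra.
have z2' : nu (star z) <= 1 + c by rewrite (nuJ nuP).
have c2 : (1 + c) * c <= 2 * c by rewrite ler_wpM2r//; clear -dn; lra.
have [||| u [uU uz uE]] := polar nuP (z := z) (d := 3 * c).
- have -> : 1 - star z * z = (1 - star z) + star z * (1 - z) by nc_ring.
  apply: le_trans (nuD nuP _ _) _; have := nuM_le nuP z2' z1.
  by clear -z1' c2; lra.
- have -> : 1 - z * star z = (1 - z) + z * (1 - star z) by nc_ring.
  apply: le_trans (nuD nuP _ _) _; have := nuM_le nuP z2 z1'.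
  by clear -z1 c2; lra.
- by clear -dn; lra.
exists u; split=> //.
  have : nu z * (2 * (3 * c)) <= 2 * (2 * (3 * c)).
    by rewrite ler_wpM2r//; clear -d0 z2 dn; lra.
  have := nu_tri nuP z u 1; rewrite [nu (z - 1)](nuBC nuP).
  by clear -uz z1; lra.
by move=> i k; apply: uE => //; rewrite (muJ EP') (muJ EP).
Qed.

(** * Locally matricial algebras *)

(** Carrying the proof [fP] gives the function a name to which the morphism structures can be
    attached. *)
Definition star_hom_fun (R : realType) (A B : starAlgType R) (f : A -> B)
  (fP : star_hom f) : A -> B := f.

Section StarHomBundle.
Context {R : realType} {A B : starAlgType R} (f : A -> B) (fP : star_hom f).

Fact star_hom_linear : linear (star_hom_fun fP).
Proof. by move=> c x y; rewrite /star_hom_fun (shD fP) (shZ fP). Qed.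

HB.instance Definition _ :=
  GRing.isLinear.Build R[i] A B *:%R (star_hom_fun fP) star_hom_linear.

Fact star_hom_monoid : monoid_morphism (star_hom_fun fP).
Proof. by split; [exact: (sh1 fP)|exact: (shM fP)]. Qed.

HB.instance Definition _ :=
  GRing.isMonoidMorphism.Build A B (star_hom_fun fP) star_hom_monoid.

Definition star_hom_bundle : {lrmorphism A -> B} := star_hom_fun fP.

End StarHomBundle.

Definition locally_matricial (R : realType) (D : cstarAlgType R) :=
  forall (F : seq D) (e : R) (m : nat), 0 < e ->
  exists N (E : 'I_N.+1 -> 'I_N.+1 -> D), [/\ munits E, (m.+1 %| N.+1)%N &
    forall a, a \in F -> exists x, cnorm (a - lin E x) <= e].

(** Approximates F together with the units E, finds units near E inside the approximating algebra,
    and conjugates that algebra by a unitary near 1 so that it contains E exactly. *)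
Lemma locally_matricial_above (R : realType) (D : cstarAlgType R) n
    (E : 'I_n.+1 -> 'I_n.+1 -> D) (F : seq D) (e : R) (m : nat) :
  locally_matricial D -> munits E -> 0 < e ->
  exists N (E' : 'I_N.+1 -> 'I_N.+1 -> D), [/\ munits E', (m.+1 %| N.+1)%N,
    exists K : 'I_n.+1 -> 'I_n.+1 -> 'M[R[i]]_N.+1, forall i j, E i j = lin E' (K i j) &
    forall a, a \in F -> exists x, cnorm (a - lin E' x) <= e].
Proof.
move=> Dmat EP e0; have nD := cnorm_cstar_norm D.
pose M : R := 1 + \sum_(a <- F) cnorm a.
have M1 : 1 <= M by rewrite lerDl sumr_ge0// => a _; exact: (nu_ge0 nD).
have FM a : a \in F -> cnorm a <= M.
  move=> aF; rewrite /M (perm_big _ (perm_to_rem aF)) big_cons /=.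
  rewrite addrCA lerDl addr_ge0// sumr_ge0// => b _; exact: (nu_ge0 nD).
pose c : R := n.+1%:R; have c1 : 1 <= c by rewrite ler1n.
(* Any k above 2 * 13 * 6357 + 1 would do: moving by u costs 13 * 6357 * X * M on each side. *)
pose k : R := 100 * 100 * 40; have k0 : 0 < k by rewrite !mulr_gt0.
pose d := Num.min 1 e / (k * (c * c * M)).
have cc1 : 1 <= c * c by rewrite -[leLHS]mulr1 ler_pM.
have ccM : 1 <= c * c * M by rewrite -[leLHS]mulr1 ler_pM.
have den0 : 0 < k * (c * c * M) by rewrite mulr_gt0// (lt_le_trans ltr01).
have d0 : 0 < d by rewrite divr_gt0// lt_min ltr01.
have dM : k * (c * c * d * M) = Num.min 1 e.
  have -> : k * (c * c * d * M) = d * (k * (c * c * M)) by ring.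
  by rewrite /d mulfVK ?gt_eqF.
have dM1 : k * (c * c * d * M) <= 1 by rewrite dM ge_min lexx.
have dMe : k * (c * c * d * M) <= e by rewrite dM ge_min lexx orbT.
have dX : d <= c * c * d by rewrite ler_peMl// ltW.
have X0 : 0 < c * c * d by rewrite (lt_le_trans d0).
have XM : c * c * d <= c * c * d * M by rewrite ler_peMr// ltW.
set X := c * c * d in dM1 dMe dX X0 XM.
have [N [E0 [E0P mN E0F]]] := Dmat (F ++ [seq E i j | i <- enum 'I_n.+1, j <- enum 'I_n.+1]) d m d0.
have EE0 i j : exists x, cnorm (E i j - lin E0 x) <= d.
  apply: E0F; rewrite mem_cat; apply/orP; right.
  by apply: (allpairs_f (fun i j => E i j)); rewrite mem_enum.
have [|K [KP EK]] := near_munits nD (lin_hom E0P) (lin_cstar_norm E0P nD) EP (erefl c) d0 _ EE0.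
  rewrite -/X; by move: dM1; rewrite /k; clear -XM X0; lra.
have [|u [uU u1 uE]] := near_munits_conj nD EP (munits_lin E0P KP) EK.
  rewrite -/c (_ : c * (6357 * (c * d)) = 6357 * X); last by rewrite /X; ring.
  by move: dM1; rewrite /k; clear -XM X0; lra.
rewrite -/c (_ : c * (6357 * (c * d)) = 6357 * X) in u1; last by rewrite /X; ring.
have cvP := conj_hom (unitary_star uU).
exists N, (fun i j => star (star u) * E0 i j * star u); split => //.
- exact: munits_hom cvP E0P.
- exists K => i j; rewrite -(lin_comp E0 (K i j) cvP) starK uE -mulrA uU.2 mulr1.
  by [].
move=> a aF; have [|x xE] := E0F a; first by rewrite mem_cat aF.
exists x; rewrite -(lin_comp E0 x cvP) starK.
have -> : a - u * lin E0 x * star u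
    = (1 - u) * a + u * (a * (1 - star u)) + u * (a - lin E0 x) * star u.
  by rewrite mulrBr mulrBl mul1r mulr1 mulrBr mulrBr mulrBl mulrA; nc_ring.
have u1' : cnorm (1 - u) <= 13 * (6357 * X) by rewrite (nuBC nD).
have u1'' : cnorm (1 - star u) <= 13 * (6357 * X) by rewrite -star1 -starB (nuJ nD).
have un := nu_isometry nD uU.1.
have h1 := nuM_le nD u1' (FM a aF).
have h2 := nuM_le nD (lexx (cnorm u)) (nuM_le nD (FM a aF) u1''); rewrite un mul1r in h2.
have h3 := le_trans (nu_conj nD (a - lin E0 x) uU) xE.
apply: le_trans (nuD nD _ _) _; have := nuD nD ((1 - u) * a) (u * (a * (1 - star u))).
have := dMe; have XM0 : 0 < X * M by rewrite (lt_le_trans X0).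
by move: (le_trans dX XM) XM0; rewrite /k; clear -h1 h2 h3; lra.
Qed.

Record unit_system (R : realType) (D : cstarAlgType R) := UnitSystem {
  us_size : nat;
  us_units : 'I_us_size.+1 -> 'I_us_size.+1 -> D;
  us_munits : munits us_units
}.

Lemma locally_matricial_universal_uhf (R : realType) (D : cstarAlgType R) :
  cstar_separable D -> locally_matricial D -> universal_uhf D.
Proof.
move=> [a aP] Dmat; have nD := cnorm_cstar_norm D.
pose step (ms : nat * unit_system D) (s' : unit_system D) :=
  [/\ (ms.1.+1 %| (us_size s').+1)%N,
    exists K : _ -> _ -> 'M[R[i]]_((us_size s').+1),
      forall i j, us_units (u := ms.2) i j = lin (us_units (u := s')) (K i j) &
    forall i, (i <= ms.1)%N ->
      exists x, cnorm (a i - lin (us_units (u := s')) x) <= ms.1.+1%:R^-1].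
have /choice[next nextP] : forall ms, exists s', step ms s'.
  move=> [m [n E EP]].
  have m0 : 0 < m.+1%:R^-1 :> R by rewrite invr_gt0.
  have [N [E' [E'P mN EE' aE']]] :=
    locally_matricial_above [seq a i | i <- iota 0 m.+1] m Dmat EP m0.
  exists (UnitSystem E'P); split => // i im /=.
  by apply: aE'; apply: map_f; rewrite mem_iota add0n ltnS.
have [N0 [E0 [E0P _ _]]] := Dmat [::] 1 0%N ltr01.
pose s := fix s m := if m is m'.+1 then next (m', s m') else UnitSystem E0P.
have sP m : step (m, s m) (s m.+1) by exact: nextP.
pose sE m := lin (us_units (u := s m)).
have sH m : star_hom (sE m) := lin_hom (us_munits (s m)).
exists (fun m => us_size (s m)); split; last first.
  move=> p j p_prime; have pj : (0 < p ^ j)%N by rewrite expn_gt0 prime_gt0.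
  (* The step from stage m makes m+1 divide the next size, so the size at stage p^j is a multiple of
     p^j. *)
  exists (p ^ j)%N; have [+ _ _] := sP (p ^ j).-1.
  by rewrite prednK.
exists (fun m => star_hom_bundle (sH m)); split.
- by move=> m x; exact: (shJ (sH m)).
- move=> m _ [x _ <-]; have [_ [K KE] _] := sP m.
  exists (lin K x) => //; rewrite /= /star_hom_fun /sE.
  rewrite (lin_comp K x (lin_hom (us_munits (s m.+1)))); apply: eq_bigr => i _.
  by apply: eq_bigr => j _; rewrite -KE.
move=> b e e0; have e2 : 0 < e / 2 by rewrite divr_gt0.
have [i bi] := aP b _ e2.
have [m [im me]] : exists m, (i <= m)%N /\ m.+1%:R^-1 < e / 2.
  have [m _ mP] := near_infty_natSinv_lt (PosNum e2).
  by exists (maxn i m); split; [rewrite leq_maxl|apply: mP; exact: leq_maxr].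
have [_ _ /(_ i im)[x xE]] := sP m.
exists m.+1, x; apply: le_lt_trans (nu_tri nD (a i) _ _) _.
by rewrite [ltRHS](splitr e) ltr_leD// (le_trans xE)// ltW.
Qed.

(** * Uniqueness of the universal UHF algebra *)

Definition unit_family (A : Type) (n : nat) := 'I_n.+1 -> 'I_n.+1 -> A.

Section IntertwiningIso.
Context {R : realType} {A B : cstarAlgType R} {n : nat -> nat}.
Unset Implicit Arguments.
Context {E : forall m, unit_family A (n m)} {F : forall m, unit_family B (n m)}.
Set Implicit Arguments.
Hypotheses (EP : forall m, munits (E m)) (FP : forall m, munits (F m)).
Hypothesis up : forall m x, exists x',
  lin (E m) x = lin (E m.+1) x' /\ lin (F m) x = lin (F m.+1) x'.

Let nA := cnorm_cstar_norm A.
Let nB := cnorm_cstar_norm B.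

(** The graph of the isomorphism: a and b are approximated by the same matrix at the same stage. It
    is symmetric in A and B, so the inverse map needs no separate construction. *)
Definition limit_graph (a : A) (b : B) := forall e : R, 0 < e ->
  exists m x, cnorm (a - lin (E m) x) <= e /\ cnorm (b - lin (F m) x) <= e.

Let up_le m m' : (m <= m')%N -> forall x, exists x',
  lin (E m) x = lin (E m') x' /\ lin (F m) x = lin (F m') x'.
Proof.
elim: m' => [|m' IH]; first by rewrite leqn0 => /eqP -> x; exists x.
rewrite leq_eqVlt => /predU1P[<- x|]; first by exists x.
rewrite ltnS => /IH{}IH x; have [x1 [E1 F1]] := IH x; have [x2 [E2 F2]] := up x1.
by exists x2; rewrite E1 F1.
Qed.

Let common m x m' x' : exists M y y',
  [/\ lin (E m) x = lin (E M) y, lin (F m) x = lin (F M) y,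
      lin (E m') x' = lin (E M) y' & lin (F m') x' = lin (F M) y'].
Proof.
have [y [y1 y2]] := @up_le m (maxn m m') (leq_maxl _ _) x.
have [y' [y'1 y'2]] := @up_le m' (maxn m m') (leq_maxr _ _) x'.
by exists (maxn m m'), y, y'.
Qed.

(** At a common stage both sides are norms of one matrix, which do not depend on the units. *)
Let iso_diff m x m' x' :
  cnorm (lin (F m) x - lin (F m') x') = cnorm (lin (E m) x - lin (E m') x').
Proof.
have [M [y [y' [-> -> -> ->]]]] := common x x'.
rewrite -(shB (lin_hom (EP M))) -(shB (lin_hom (FP M))).
exact: (lin_nu_eq _ (FP M) (EP M) nB nA).
Qed.

Lemma limit_graph_dist a b a' b' : limit_graph a b -> limit_graph a' b' ->
  cnorm (b - b') <= cnorm (a - a').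
Proof.
move=> ab ab'; apply/ler_addgt0Pl => e e0.
have e4 : 0 < e / 4 by rewrite divr_gt0.
have [m [x [ax bx]]] := ab _ e4; have [m' [x' [ax' bx']]] := ab' _ e4.
have := iso_diff x x'.
have := nu_tri nB (lin (F m) x) b b'; have := nu_tri nB (lin (F m') x') (lin (F m) x) b'.
have := nu_tri nA a (lin (E m) x) (lin (E m') x'); have := nu_tri nA a' a (lin (E m') x').
rewrite (nuBC nB b') in bx'; rewrite (nuBC nA a) in ax.
by move: ax bx ax' bx'; lra.
Qed.

Lemma limit_graph_exists : (forall a (e : R), 0 < e -> exists m x, cnorm (a - lin (E m) x) < e) ->
  forall a, exists b, limit_graph a b.
Proof.
move=> dense a.
have /choice[mx mxP] (i : nat) : exists mx : {m & 'M[R[i]]_((n m).+1)},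
    cnorm (a - lin (E (tag mx)) (tagged mx)) < i.+1%:R^-1.
  have [|m [x mx]] := dense a i.+1%:R^-1; first by rewrite invr_gt0.
  by exists (Tagged (fun m => 'M[R[i]]_((n m).+1)) x).
have small e : 0 < e -> exists N, forall i, (N <= i)%N -> i.+1%:R^-1 < e :> R.
  by move=> e0; have [N _ NP] := near_infty_natSinv_lt (PosNum e0); exists N.
have [|b bP] := nu_complete nB (u := fun i => lin (F (tag (mx i))) (tagged (mx i))).
  move=> e e0; have e2 : 0 < e / 2 by rewrite divr_gt0.
  have [N NP] := small _ e2; exists N => i j Ni Nj; rewrite iso_diff.
  have := nu_tri nA a (lin (E (tag (mx i))) (tagged (mx i))) (lin (E (tag (mx j))) (tagged (mx j))).
  rewrite (nuBC nA (lin (E (tag (mx i))) _) a).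
  by have := lt_trans (mxP i) (NP i Ni); have := lt_trans (mxP j) (NP j Nj); lra.
exists b => e e0; have [N NP] := small e e0; have [M MP] := bP e e0.
exists (tag (mx (maxn N M))), (tagged (mx (maxn N M))); split.
  by apply/ltW/(lt_trans (mxP _))/NP; rewrite leq_maxl.
by rewrite (nuBC nB); apply/ltW/MP; rewrite leq_maxr.
Qed.

Lemma limit_graphD a b a' b' : limit_graph a b -> limit_graph a' b' ->
  limit_graph (a + a') (b + b').
Proof.
move=> ab ab' e e0; have e2 : 0 < e / 2 by rewrite divr_gt0.
have [m [x [ax bx]]] := ab _ e2; have [m' [x' [ax' bx']]] := ab' _ e2.
have [M [y [y' [Ey Fy Ey' Fy']]]] := common x x'.
exists M, (y + y'); rewrite (shD (lin_hom (EP M))) (shD (lin_hom (FP M))).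
rewrite -Ey -Fy -Ey' -Fy'.
have subDD (V : zmodType) (p q p' q' : V) : p + p' - (q + q') = (p - q) + (p' - q').
  by rewrite opprD addrACA.
rewrite !subDD; split.
  by apply: le_trans (nuD nA _ _) _; lra.
by apply: le_trans (nuD nB _ _) _; lra.
Qed.

Lemma limit_graphZ (c : R[i]) a b : limit_graph a b -> limit_graph (c *: a) (c *: b).
Proof.
move=> ab e e0; have c0 : 0 <= Normc.normc c by exact: normr_ge0 (c : Rcomplex R).
have k0 : 0 < Normc.normc c + 1 by lra.
have [m [x [ax bx]]] := ab _ (divr_gt0 e0 k0).
have le_e r : r <= e / (Normc.normc c + 1) -> Normc.normc c * r <= e.
  move=> re; apply: le_trans (ler_wpM2l c0 re) _.
  rewrite mulrCA ler_piMr ?(ltW e0)// ler_pdivrMr// mul1r; lra.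
exists m, (c *: x); rewrite (shZ (lin_hom (EP m))) (shZ (lin_hom (FP m))) -!scalerBr.
by rewrite (nuZ nA) (nuZ nB) !le_e.
Qed.

Lemma limit_graphJ a b : limit_graph a b -> limit_graph (star a) (star b).
Proof.
move=> ab e /ab[m [x [ax bx]]]; exists m, (star x).
by rewrite (shJ (lin_hom (EP m))) (shJ (lin_hom (FP m))) -!starB (nuJ nA) (nuJ nB).
Qed.

Lemma limit_graph1 : limit_graph 1 1.
Proof.
move=> e e0; exists 0%N, 1.
by rewrite (sh1 (lin_hom (EP 0))) (sh1 (lin_hom (FP 0))) !subrr (nu0 nA) (nu0 nB) ltW.
Qed.

Lemma limit_graphM a b a' b' : limit_graph a b -> limit_graph a' b' ->
  limit_graph (a * a') (b * b').
Proof.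
move=> ab ab' e e0; pose k := cnorm a + cnorm a' + cnorm b + cnorm b' + 1.
have k1 : 1 <= k.
  have := nu_ge0 nA a; have := nu_ge0 nA a'; have := nu_ge0 nB b.
  by have := nu_ge0 nB b'; rewrite /k; lra.
pose d := Num.min 1 (e / (2 * k)).
have d0 : 0 < d by rewrite lt_min ltr01 divr_gt0//; lra.
have d1 : d <= 1 by rewrite ge_min lexx.
have dk : 2 * k * d <= e.
  by rewrite mulrC -ler_pdivlMr ?ge_min ?lexx ?orbT//; lra.
have [m [x [ax bx]]] := ab _ d0; have [m' [x' [ax' bx']]] := ab' _ d0.
have [M [y [y' [Ey Fy Ey' Fy']]]] := common x x'.
exists M, (y * y'); rewrite (shM (lin_hom (EP M))) (shM (lin_hom (FP M))).
rewrite -Ey -Fy -Ey' -Fy' {Ey Fy Ey' Fy'}.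
have gen (W : cstarAlgType R) (p q p' q' : W) : cnorm (p - q) <= d -> cnorm (p' - q') <= d ->
    cnorm p <= k -> cnorm p' + 1 <= k -> cnorm (p * p' - q * q') <= e.
  have nW := cnorm_cstar_norm W; move=> pq pq' pk pk'.
  have -> : p * p' - q * q' = p * (p' - q') + (p - q) * q' by nc_ring.
  have qk : cnorm q' <= k.
    by have := nu_le_add nW q' p'; rewrite (nuBC nW q'); move: pq' pk' d1; lra.
  apply: le_trans (nuD nW _ _) _; have := nuM_le nW pk pq'; have := nuM_le nW pq qk.
  by move: dk; lra.
have a0 := nu_ge0 nA a; have a'0 := nu_ge0 nA a'; have b0 := nu_ge0 nB b.
have b'0 := nu_ge0 nB b'.
by split; apply: gen => //; rewrite /k; lra.
Qed.

End IntertwiningIso.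

Lemma intertwining_iso (R : realType) (A B : cstarAlgType R) (n : nat -> nat)
    (E : forall m, unit_family A (n m)) (F : forall m, unit_family B (n m)) :
  (forall m, munits (E m)) -> (forall m, munits (F m)) ->
  (forall m x, exists x',
     lin (E m) x = lin (E m.+1) x' /\ lin (F m) x = lin (F m.+1) x') ->
  (forall a (e : R), 0 < e -> exists m x, cnorm (a - lin (E m) x) < e) ->
  (forall b (e : R), 0 < e -> exists m x, cnorm (b - lin (F m) x) < e) ->
  star_isomorphic A B.
Proof.
move=> EP FP up Edense Fdense.
have up' m x : exists x', lin (F m) x = lin (F m.+1) x' /\ lin (E m) x = lin (E m.+1) x'.
  by have [x' [? ?]] := up m x; exists x'.
have sym a b : limit_graph (E := E) (F := F) a b -> limit_graph (E := F) (F := E) b a.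
  by move=> ab e /ab[m [x [? ?]]]; exists m, x.
have nA := cnorm_cstar_norm A; have nB := cnorm_cstar_norm B.
have uniq a b b' : limit_graph (E := E) (F := F) a b ->
    limit_graph (E := E) (F := F) a b' -> b = b'.
  move=> ab ab'; apply/eqP; rewrite -subr_eq0; apply/eqP/(nu_eq0 nB)/eqP.
  rewrite eq_le (nu_ge0 nB) andbT.
  by have := limit_graph_dist EP FP up ab ab'; rewrite subrr (nu0 nA).
have uniq' a a' b : limit_graph (E := E) (F := F) a b ->
    limit_graph (E := E) (F := F) a' b -> a = a'.
  move=> /sym ab /sym ab'; apply/eqP; rewrite -subr_eq0; apply/eqP/(nu_eq0 nA)/eqP.
  rewrite eq_le (nu_ge0 nA) andbT.
  by have := limit_graph_dist FP EP up' ab ab'; rewrite subrr (nu0 nB).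
have [f fP] := choice (limit_graph_exists EP FP up Edense).
have [g gP] := choice (limit_graph_exists FP EP up' Fdense).
have fH : star_hom f.
  split=> [x y|c x|x y|x|].
  - exact: (uniq _ _ _ (fP _) (limit_graphD EP FP up (fP x) (fP y))).
  - exact: (uniq _ _ _ (fP _) (limit_graphZ EP FP c (fP x))).
  - exact: (uniq _ _ _ (fP _) (limit_graphM EP FP up (fP x) (fP y))).
  - exact: (uniq _ _ _ (fP _) (limit_graphJ EP FP (fP x))).
  - exact: (uniq _ _ _ (fP _) (limit_graph1 EP FP)).
exists (star_hom_bundle fH); split; last by move=> a; exact: (shJ fH).
have gP' b : limit_graph (E := E) (F := F) (g b) b.
  by move=> e e0; have [m [x [? ?]]] := gP b e e0; exists m, x.
exists g => [a|b]; rewrite /= /star_hom_fun.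
  exact: (uniq' _ _ _ (gP' _) (fP a)).
exact: (uniq _ _ _ (fP _) (gP' b)).
Qed.

(** * Projections and matrix units in complex matrix algebras *)

Section ComplexMatrixUnits.
Context {R : realType}.

Definition adjc m n (q : 'M[R[i]]_(m, n)) : 'M[R[i]]_(n, m) := (map_mx Num.conj q)^T.

Lemma adjcM m n k (p : 'M[R[i]]_(m, n)) (q : 'M[R[i]]_(n, k)) :
  adjc (p *m q) = adjc q *m adjc p.
Proof. by rewrite /adjc map_mxM trmx_mul. Qed.

Lemma adjcK m n (q : 'M[R[i]]_(m, n)) : adjc (adjc q) = q.
Proof. by apply/matrixP => i j; rewrite !mxE conjCK. Qed.

Lemma star_adjc n (x : 'M[R[i]]_n.+1) : star x = adjc x.
Proof. by []. Qed.

Lemma projection_factor N (P : 'M[R[i]]_N.+1) : P * P = P -> star P = P ->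
  exists r (q : 'M[R[i]]_(r, N.+1)), q *m adjc q = 1%:M /\ adjc q *m q = P.
Proof.
move=> PP Ps; have [r [g [go gP]]] := mx_projection_orthonormal PP Ps.
exists r, (\matrix_(j, t) (g j t : R[i])^*); split; apply/matrixP => a b; rewrite !mxE.
  transitivity (ipn ip_complex (g b) (g a)).
    by apply: eq_bigr => t _; rewrite !mxE conjCK mulrC.
  by rewrite go eq_sym.
have := gP [ffun j => 1 *+ (b == j)] => /ffunP/(_ a).
rewrite ffunE; under eq_bigr do rewrite ffunE mulrnAr mulr1.
rewrite sum_delta => ->; rewrite sum_ffunE; apply: eq_bigr => j _.
rewrite !mxE conjCK ffunE mulrC; congr (_ * _).
rewrite /ipn; under eq_bigr do rewrite ffunE /ip_complex mulrnAl mul1r.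
by rewrite sum_delta.
Qed.

Lemma projection_trace N (P : 'M[R[i]]_N.+1) : P * P = P -> star P = P ->
  exists r : nat, \tr P = r%:R.
Proof.
move=> PP Ps; have [r [q [qq <-]]] := projection_factor PP Ps; exists r.
by rewrite mxtrace_mulC qq mxtrace1.
Qed.

(** The trace is the number of rows in the factorisation P = q^* q with q q^* = 1, so both
    factorisations have the same shape and y = q'^* q. *)
Lemma projection_equiv N (P P' : 'M[R[i]]_N.+1) :
  P * P = P -> star P = P -> P' * P' = P' -> star P' = P' -> \tr P = \tr P' ->
  exists y : 'M[R[i]]_N.+1, [/\ star y * y = P, y * star y = P', y * P = y & P' * y = y].
Proof.
move=> PP Ps PP' Ps'; have [r [q [qq qP]]] := projection_factor PP Ps.
have [r' [q' [qq' qP']]] := projection_factor PP' Ps'.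
rewrite -qP -qP' mxtrace_mulC qq mxtrace1 mxtrace_mulC qq' mxtrace1.
move=> /eqP; rewrite eqr_nat => /eqP rr'; case: _ / rr' q' qq' qP' => q' qq' qP'.
exists (adjc q' *m q); rewrite star_adjc adjcM adjcK /GRing.mul /=; split.
- by rewrite -mulmxA (mulmxA q') qq' mul1mx.
- by rewrite -mulmxA (mulmxA q) qq mul1mx.
- by rewrite -mulmxA (mulmxA q) qq mul1mx.
- by rewrite -mulmxA (mulmxA q') qq' mul1mx.
Qed.

Lemma munits_trace n N (K : 'I_n.+1 -> 'I_n.+1 -> 'M[R[i]]_N.+1) : munits K ->
  n.+1%:R * \tr (K ord0 ord0) = N.+1%:R.
Proof.
move=> KP; have trK i : \tr (K i i) = \tr (K ord0 ord0).
  have -> : K i i = K i ord0 * K ord0 i by rewrite (muM KP) eqxx mulr1n.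
  by rewrite [LHS]mxtrace_mulC [_ *m _](muM KP) eqxx mulr1n.
rewrite -(mxtrace1 _ N.+1) -[1%:M](mu1 KP) raddf_sum /=.
by under eq_bigr do rewrite trK; rewrite sumr_const card_ord mulr_natl.
Qed.

Lemma munits_proj (W : starAlgType R) n (K : 'I_n.+1 -> 'I_n.+1 -> W) i : munits K ->
  K i i * K i i = K i i /\ star (K i i) = K i i.
Proof. by move=> KP; rewrite (muM KP) eqxx mulr1n (muJ KP). Qed.

(** The quotient is the rank of a diagonal unit, a natural number by [projection_trace]. *)
Lemma munits_dvd n N (K : 'I_n.+1 -> 'I_n.+1 -> 'M[R[i]]_N.+1) : munits K ->
  (n.+1 %| N.+1)%N.
Proof.
move=> KP; have [KK Ks] := munits_proj ord0 KP.
have [r trK] := projection_trace KK Ks; have := munits_trace KP.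
rewrite trK -natrM => /eqP; rewrite eqr_nat => /eqP <-; exact: dvdn_mulr.
Qed.

(** The corners K_00 and K'_00 have equal trace, and a partial isometry y between them is spread
    over the diagonal by the units. *)
Lemma munits_mx_conj n N (K K' : 'I_n.+1 -> 'I_n.+1 -> 'M[R[i]]_N.+1) :
  munits K -> munits K' -> exists u, unitary u /\ forall i j, u * K i j * star u = K' i j.
Proof.
move=> KP KP'; have [KK Ks] := munits_proj ord0 KP; have [KK' Ks'] := munits_proj ord0 KP'.
have [|y [y1 y2 yK Ky]] := projection_equiv KK Ks KK' Ks'.
  by apply: (@mulfI _ n.+1%:R); rewrite ?pnatr_eq0// !munits_trace.
pose u := \sum_i K' i ord0 * y * K ord0 i.
have uK i j : u * K i j = K' i ord0 * y * K ord0 j.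
  rewrite mulr_suml; under eq_bigr do rewrite -!mulrA (muM KP) !mulrnAr.
  by rewrite sum_delta_sym mulrA.
have su : star u = \sum_i K i ord0 * star y * K' ord0 i.
  rewrite star_sum; apply: eq_bigr => i _.
  by rewrite !starM (muJ KP) (muJ KP') mulrA.
have uKu i j : u * K i j * star u = K' i j.
  rewrite uK su mulr_sumr (bigD1 j)//= [X in _ + X]big1 ?addr0 => [|l lj].
    rewrite !mulrA -(mulrA _ (K ord0 j)) (muM KP) eqxx mulr1n -(mulrA _ y) yK.
    by rewrite -(mulrA _ y) y2 (muM KP') eqxx mulr1n (muM KP') eqxx mulr1n.
  rewrite !mulrA -(mulrA _ (K ord0 j)) (muM KP) eq_sym (negPf lj) mulr0n.
  by rewrite mulr0 !mul0r.
exists u; split => //; split; last first.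
  have -> : u * star u = \sum_i u * K i i * star u by rewrite -mulr_suml -mulr_sumr (mu1 KP) mulr1.
  by rewrite -(mu1 KP'); apply: eq_bigr => i _.
rewrite su mulr_suml -(mu1 KP); apply: eq_bigr => i _.
rewrite /u mulr_sumr (bigD1 i)//= [X in _ + X]big1 ?addr0 => [|l li].
  rewrite !mulrA -(mulrA _ (K' ord0 i)) (muM KP') eqxx mulr1n -(mulrA _ (K' ord0 ord0)) Ky.
  by rewrite -(mulrA _ (star y)) y1 (muM KP) eqxx mulr1n (muM KP) eqxx mulr1n.
rewrite !mulrA -(mulrA _ (K' ord0 i)) (muM KP') eq_sym (negPf li) mulr0n.
by rewrite mulr0 !mul0r.
Qed.

End ComplexMatrixUnits.

(** * Towers of matrix units and their interlacing *)

Record uhf_tower (R : realType) (A : cstarAlgType R) := UhfTower {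
  tw_size : nat -> nat;
  tw_units : forall m, unit_family A (tw_size m);
  tw_munits : forall m, munits (@tw_units m);
  tw_up : forall m x, exists x', lin (@tw_units m) x = lin (@tw_units m.+1) x';
  tw_dense : forall a (e : R), 0 < e -> exists m x, cnorm (a - lin (@tw_units m) x) < e;
  tw_prime_power : forall p j, prime p -> exists m, (p ^ j %| (tw_size m).+1)%N
}.
Arguments tw_units {R A} _ m.

Lemma universal_uhf_tower (R : realType) (A : cstarAlgType R) :
  universal_uhf A -> exists t : uhf_tower A, True.
Proof.
move=> [k [[phi [phiJ phi_up phi_dense]] kp]].
have deltaP n : munits (fun i j => delta_mx i j : 'M[R[i]]_n.+1).
  split=> [i j l m|i j|]; first by rewrite [_ * _]mul_delta_mx_cond.
    by apply/matrixP => a b; rewrite !mxE rmorph_nat andbC.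
  by rewrite -mx1_sum_delta.
have phiP m := star_hom_lrmorphism (phiJ m).
have linE m x : lin (fun i j => phi m (delta_mx i j)) x = phi m x.
  rewrite -(lin_comp _ _ (phiP m)); congr (phi m _).
  by rewrite [RHS]matrix_sum_delta.
unshelve eexists (@UhfTower R A k (fun m i j => phi m (delta_mx i j)) _ _ _ kp) => //.
- by move=> m; exact: munits_hom (phiP m) (deltaP _).
- move=> m x; have [x' _ xE] := phi_up m (phi m x) (imageT _ x).
  by exists x'; rewrite !linE.
- move=> a e e0; have [m [x xa]] := phi_dense a e e0.
  by exists m, x; rewrite linE.
Qed.

Section Tower.
Context {R : realType} {A : cstarAlgType R} (t : uhf_tower A).

Lemma tw_above m m' : (m <= m')%N ->
  forall x, exists x', lin (tw_units t m) x = lin (tw_units t m') x'.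
Proof.
elim: m' => [|m' IH]; first by rewrite leqn0 => /eqP -> x; exists x.
rewrite leq_eqVlt => /predU1P[-> x|]; first by exists x.
rewrite ltnS => /IH{}IH x; have [x1 ->] := IH x; exact: tw_up.
Qed.

Lemma munits_in_lin N (E : unit_family A N) n (F : unit_family A n) :
  munits E -> munits F -> (forall x, exists x', lin F x = lin E x') ->
  exists K : unit_family 'M[R[i]]_N.+1 n, munits K /\ forall i j, F i j = lin E (K i j).
Proof.
move=> EP FP FE; have nA := cnorm_cstar_norm A.
have KE' (ij : 'I_n.+1 * 'I_n.+1) : exists x, F ij.1 ij.2 = lin E x.
  by have [x xE] := FE (delta_mx ij.1 ij.2); exists x; rewrite -xE lin_delta.
have [k kE] := choice KE'; pose K i j := k (i, j); have KE i j : F i j = lin E (K i j) := kE (i, j).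
have inj := lin_inj EP nA; have EH := lin_hom EP.
exists K; split => //; split=> [i j l m|i j|]; apply: inj.
- rewrite (shM EH) -!KE (muM FP); case: (j == l); rewrite ?mulr1n ?mulr0n ?KE//.
  by rewrite (sh0 EH).
- by rewrite (shJ EH) -!KE (muJ FP).
- by rewrite (sh_sum EH) (sh1 EH) -(mu1 FP); apply: eq_bigr => i _; rewrite KE.
Qed.

Lemma tw_size_dvd m m' : (m <= m')%N -> ((tw_size t m).+1 %| (tw_size t m').+1)%N.
Proof.
move=> mm; have [K [KP _]] := munits_in_lin (tw_munits t m') (tw_munits t m) (tw_above mm).
exact: munits_dvd KP.
Qed.

Lemma tw_dvd n m0 : exists m, (m0 <= m)%N /\ (n.+1 %| (tw_size t m).+1)%N.
Proof.
have pP p : exists m, prime p -> (p ^ logn p n.+1 %| (tw_size t m).+1)%N.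
  have [pp|_] := boolP (prime p); last by exists 0%N.
  by have [m mP] := tw_prime_power t (logn p n.+1) pp; exists m.
(* Prime factors of n+1 are below n+2, and sizes only grow under divisibility, so one stage serves
   all prime powers. *)
have [f fP] := choice pP; exists (maxn m0 (\max_(p < n.+2) f p)); split; first exact: leq_maxl.
apply/dvdn_partP => // p; rewrite mem_primes => /and3P[pp _ pn].
rewrite p_part; apply: dvdn_trans (fP p pp) (tw_size_dvd _).
apply: leq_trans (leq_maxr _ _); have pn' : (p < n.+2)%N by rewrite ltnS dvdn_leq.
exact: (leq_bigmax (Ordinal pn')).
Qed.

End Tower.

Section Interlacing.
Context {R : realType}.

(** A state of the back-and-forth: one matrix algebra with a copy in each of A and B, each copy
    inside some stage of its tower. *)
Record interlace (A B : cstarAlgType R) (tA : uhf_tower A) (tB : uhf_tower B) := Interlace {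
  il_size : nat;
  il_l : unit_family A il_size;
  il_r : unit_family B il_size;
  il_lP : munits il_l;
  il_rP : munits il_r;
  il_l_in : exists m, forall x, exists x', lin il_l x = lin (tw_units tA m) x';
  il_r_in : exists m, forall x, exists x', lin il_r x = lin (tw_units tB m) x'
}.

Arguments il_l {A B tA tB} _ _ _.
Arguments il_r {A B tA tB} _ _ _.

Definition il_le (A B : cstarAlgType R) (tA : uhf_tower A) (tB : uhf_tower B)
    (s s' : interlace tA tB) := forall x, exists x',
  lin (il_l s) x = lin (il_l s') x' /\ lin (il_r s) x = lin (il_r s') x'.

(** The copy in A is enlarged to a whole stage. A stage of B with size divisible by that one
    contains some copy of the same matrix algebra, which is conjugated so as to extend the old copy
    in B. *)
Lemma il_step (A B : cstarAlgType R) (tA : uhf_tower A) (tB : uhf_tower B)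
    (s : interlace tA tB) m0 : exists s', il_le s s' /\
  forall x, exists x', lin (tw_units tA m0) x = lin (il_l s') x'.
Proof.
case: s => n E F EP FP [mE EmE] [mF FmF] /=.
pose m := maxn m0 mE; pose E' := tw_units tA m; have E'P : munits E' := tw_munits tA m.
have [|K [KP KE]] := munits_in_lin E'P EP.
  move=> x; have [x1 ->] := EmE x; apply: tw_above; exact: leq_maxr.
have [l [ml dl]] := tw_dvd tB (tw_size tA m) mF.
pose G := tw_units tB l; have GP : munits G := tw_munits tB l.
have [|L [LP LE]] := munits_in_lin GP FP.
  by move=> x; have [x1 ->] := FmF x; apply: tw_above.
have [K2 K2P] := munits_div (R := R) dl.
(* The old units sit in stage l of B in two ways: through the block copy [K2], and as given by
   [L]. *)
have [u [uU uE]] := munits_mx_conj (munits_lin K2P KP) LP.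
have cvP := conj_hom (unitary_star uU).
have F'P := munits_lin GP (munits_hom cvP K2P).
unshelve eexists (Interlace E'P F'P _ _).
- by exists m => x; exists x.
- exists l => x; exists (lin (fun i j => star (star u) * K2 i j * star u) x).
  by rewrite (lin_comp _ _ (lin_hom GP)).
split=> /= x; last first.
  by have [x' xE] := tw_above (t := tA) (leq_maxl m0 mE) x; exists x'.
exists (lin K x); split.
  rewrite (lin_comp _ _ (lin_hom E'P)); congr (lin _ x).
  by apply: funext => i; apply: funext => j; exact: KE.
rewrite (lin_comp _ _ (lin_hom F'P)); congr (lin _ x).
apply: funext => i; apply: funext => j.
by rewrite [LHS]LE -uE -(lin_comp _ _ (lin_hom GP)) -(lin_comp _ _ cvP) starK.
Qed.

(** The second step is [il_step] with A and B exchanged. *)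
Lemma il_step2 (A B : cstarAlgType R) (tA : uhf_tower A) (tB : uhf_tower B)
    (s : interlace tA tB) m : exists s', [/\ il_le s s',
  forall x, exists x', lin (tw_units tA m) x = lin (il_l s') x' &
  forall x, exists x', lin (tw_units tB m) x = lin (il_r s') x'].
Proof.
have [[n E F EP FP Ein Fin] [ss /= sA]] := il_step s m.
have [[n' F' E' F'P E'P F'in E'in] [/= le sB]] := il_step (Interlace FP EP Fin Ein) m.
exists (Interlace E'P F'P E'in F'in); split=> // x.
  have [x1 /= [-> ->]] := ss x; have [x2 /= [-> ->]] := le x1.
  by exists x2.
by have [x1 ->] := sA x; have [x2 /= [_ ->]] := le x1; exists x2.
Qed.

Lemma universal_uhf_unique (A B : cstarAlgType R) :
  universal_uhf A -> universal_uhf B -> star_isomorphic A B.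
Proof.
move=> /universal_uhf_tower[tA _] /universal_uhf_tower[tB _].
have oneP (W : starAlgType R) : munits ((fun _ _ => 1) : unit_family W 0).
  split=> [i j k l|i j|]; last by rewrite big_ord1.
    by rewrite mulr1 !ord1 mulr1n.
  exact: star1.
have one_in (W : cstarAlgType R) (t : uhf_tower W) : exists m, forall x, exists x',
    lin ((fun _ _ => 1) : unit_family W 0) x = lin (tw_units t m) x'.
  exists 0%N => x; exists (x 0 0)%:M; rewrite (lin_scalar (tw_munits t 0)).
  by rewrite /lin !big_ord1.
have [next nextP] := choice (fun sm : interlace tA tB * nat => il_step2 sm.1 sm.2).
pose s := fix s m := if m is m'.+1 then next (s m', m')
  else Interlace (oneP A) (oneP B) (one_in A tA) (one_in B tB).
have sP m := nextP (s m, m).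
apply: (@intertwining_iso R A B (fun m => il_size (s m)) (fun m => il_l (s m)) (fun m => il_r (s m))).
- by move=> m; exact: il_lP.
- by move=> m; exact: il_rP.
- by move=> m x; have [le _ _] := sP m; exact: le.
- move=> a e /(tw_dense tA a)[m [x ax]]; have [_ up _] := sP m; have [x' xE] := up x.
  by exists m.+1, x'; rewrite -xE.
- move=> a e /(tw_dense tB a)[m [x ax]]; have [_ _ up] := sP m; have [x' xE] := up x.
  by exists m.+1, x'; rewrite -xE.
Qed.

End Interlacing.

Lemma strongly_self_absorbing_locally_matricial (R : realType) (D : cstarAlgType R) :
  strongly_self_absorbing D -> quasidiagonal D ->
  (forall n, exists E : 'I_n.+1 -> 'I_n.+1 -> D, munits E) -> locally_matricial D.
Proof.
move=> [_ [T [t [phi [[[H1 [H2 [K [h [piA [piB [piT [hP piAP piBP piTP tE]]]]]]]] t_dense]]]]]].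
move=> [psi phiK psiK] phiJ [w [wU wP]] Dqd allD.
have tP := tensor_productP hP piAP piBP piTP tE t_dense.
have phiP := star_hom_lrmorphism phiJ.
have psiP : star_hom psi.
  by split=> [a b|c a|a b|a|]; apply: (can_inj phiK);
    rewrite ?(shD phiP) ?(shZ phiP) ?(shM phiP) ?(shJ phiP) ?(sh1 phiP) !psiK.
have phi_iso a : cnorm (phi a) = cnorm a.
  apply: (faithful_rep_nu_eq (cnorm_cstar_norm D) (cnorm_cstar_norm T) (@inner_prehilbert R K)
    (rho := fun a => piT (phi a)) (rho' := piT)) => //; last exact: representation_faithful_rep.
  apply: (faithful_rep_pullback phiP); last exact: representation_faithful_rep.
  by move=> b b0; rewrite -(phiK b) b0 -(phiK 0) (sh0 phiP).
move=> F e m; apply: (local_matrix_approximation tP allD t_dense _ phiP psiP psiK phi_iso).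
  exact: (qd_flip_maps tP allD hP piAP piBP piTP tE Dqd).
exists w; split=> // a; exact: cvg0_eps (wP a).
Qed.

(** * K0 of the universal UHF algebra *)

(** x goes to z/N whenever N x = z u with N nonzero. Torsion-freeness of u makes the fraction unique
    and, as x and u have a common divisor e, makes G torsion-free. *)
Lemma divisible_rank1_rat (G : zmodType) (u : G) :
  (forall n : nat, exists e, e *+ n.+1 = u) ->
  (forall x, exists (n : nat) e (z : int), e *+ n.+1 = u /\ x = e *~ z) ->
  (forall n : nat, u *+ n.+1 <> 0) ->
  exists f : {additive G -> rat}, bijective f.
Proof.
move=> udiv G1 u0.
have uz0 (z : int) : u *~ z = 0 -> z = 0.
  case: z => [[|n]|n] //=; first by rewrite -pmulrn => /u0.
  by rewrite NegzE mulrNz => /eqP; rewrite oppr_eq0 => /eqP /u0.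
have G1' x : exists N z e, [/\ N != 0 :> int, e *~ N = u & x = e *~ z].
  by have [n [e [z [eu ez]]]] := G1 x; exists n.+1%:Z, z, e.
have swap (e : G) N z : e *~ N *~ z = e *~ z *~ N by rewrite -!mulrzA mulrC.
have GT (x : G) (N : int) : N != 0 -> x *~ N = 0 -> x = 0.
  move=> N0; have [M [z [e [_ eu ->]]]] := G1' x => ez.
  have /uz0/eqP : u *~ (z * N) = 0 by rewrite mulrzA -eu (swap e) (swap (e *~ z)) ez mul0rz.
  by rewrite mulf_eq0 (negPf N0) orbF => /eqP->; rewrite mulr0z.
pose val (x : G) (q : rat) := exists N z : int,
  [/\ N != 0, x *~ N = u *~ z & q = z%:~R / N%:~R].
have val_ex x : exists q, val x q.
  have [N [z [e [N0 eu ->]]]] := G1' x; exists (z%:~R / N%:~R), N, z; split => //.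
  by rewrite -eu swap.
have val_uniq x q q' : val x q -> val x q' -> q = q'.
  move=> [N [z [N0 xz ->]]] [N' [z' [N'0 xz' ->]]].
  apply/eqP; rewrite eqr_div ?intr_eq0// -!rmorphM /= eqr_int -subr_eq0; apply/eqP/uz0.
  by rewrite mulrzBr !mulrzA -xz -xz' swap subrr.
have [f fP] := choice val_ex.
have fB : zmod_morphism f.
  move=> x y; apply: (val_uniq _ _ _ (fP _)).
  have [N [z [N0 xz ->]]] := fP x; have [N' [z' [N'0 yz ->]]] := fP y.
  exists (N * N'), (z * N' - z' * N); split; first by rewrite mulf_neq0.
    by rewrite mulrzBl mulrzBr !mulrzA xz (swap y) yz.
  have Nq : N%:~R != 0 :> rat by rewrite intr_eq0.
  have N'q : N'%:~R != 0 :> rat by rewrite intr_eq0.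
  by rewrite rmorphB !rmorphM /=; field; rewrite Nq N'q.
pose F : {additive G -> rat} := HB.pack f (GRing.isZmodMorphism.Build G rat f fB).
have finj : injective F.
  move=> x y xy; apply/eqP; rewrite -subr_eq0; apply/eqP.
  have [N [z [N0 xyz]]] := fP (x - y); rewrite -[f _]/(F _) raddfB xy subrr => /esym/eqP.
  rewrite mulf_eq0 invr_eq0 !intr_eq0 (negPf N0) orbF => /eqP z0.
  by apply: (GT _ N) => //; rewrite xyz z0.
have fsur q : exists x, F x = q.
  have [e eu] := udiv `|denq q|.-1; exists (e *~ numq q).
  apply: (val_uniq _ _ _ (fP _)); exists (denq q), (numq q); split => //.
    rewrite -eu pmulrn prednK ?absz_gt0 ?denq_neq0// absz_denq.
    exact: swap.
  by rewrite divq_num_den.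
have [g gP] := choice fsur.
exists F; exists g => x; last exact: gP.
by apply: finj; rewrite gP.
Qed.

Section ScalarProjections.
Context {R : realType} {A : starAlgType R}.

Fact is_mxproj_scalar (e : A) n : e * e = e -> star e = e -> is_mxproj (e%:M : 'M[A]_n).
Proof.
move=> ee es; rewrite /is_mxproj -scalar_mxM ee eqxx.
apply/eqP/matrixP => i j; rewrite !mxE eq_sym.
by case: (i == j); rewrite ?mulr1n ?mulr0n ?es ?star0.
Qed.

Lemma K0class_mvn (p q : mxproj A) : mvn_equiv p q -> K0class p = K0class q.
Proof. by move=> /mvn_eq pq; rewrite /K0class pq. Qed.

Lemma mxproj0_mvn n (p : 'M[A]_n) (pP : is_mxproj p) : n = 0%N -> mvn_equiv (mkproj pP) zeroproj.
Proof.
case: n p pP => // p pP _; exists 0; split; apply/matrixP => -[] //.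
Qed.

Lemma K0class_scalar (e : A) (ee : e * e = e) (es : star e = e) n :
  K0class (mkproj (is_mxproj_scalar n ee es)) = K0class (mkproj (is_mxproj_scalar 1 ee es)) *+ n.
Proof.
elim: n => [|n IH]; first by apply: K0class_mvn; exact: mxproj0_mvn.
rewrite mulrS -IH -K0class_addproj; apply: K0class_mvn.
exists (e%:M : 'M[A]_n.+1) => /=.
have -> : adjmx (e%:M : 'M[A]_n.+1) = e%:M by case/andP: (is_mxproj_scalar n.+1 ee es) => _ /eqP.
by rewrite -scalar_mxM ee; split=> //; exact: (scalar_mx_block 1 n e).
Qed.

Lemma K0class_eq (p q : mxproj A) : K0class p = K0class q ->
  exists r, mvn_equiv (addproj p r) (addproj q r).
Proof.
move=> /eqP; rewrite eqmodE => /asboolP /= [c].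
rewrite !addr0 -[c]reprK => pq; exists (repr c); apply: eq_mvn.
by rewrite !pi_addproj.
Qed.

End ScalarProjections.

Section MapProjections.
Context {R : realType} {A B : starAlgType R} (f : {rmorphism A -> B}).
Hypothesis fJ : star_preserving f.

Lemma adjmx_map m n (M : 'M[A]_(m, n)) : adjmx (map_mx f M) = map_mx f (adjmx M).
Proof. by apply/matrixP => i j; rewrite !mxE fJ. Qed.

Fact is_mxproj_map (p : mxproj A) : is_mxproj (map_mx f (projmx p)).
Proof. by rewrite /is_mxproj adjmx_map -map_mxM projmxM projmxJ !eqxx. Qed.

Definition map_proj p : mxproj B := mkproj (is_mxproj_map p).

Lemma map_proj_mvn p q : mvn_equiv p q -> mvn_equiv (map_proj p) (map_proj q).
Proof.
by move=> [v [v1 v2]]; exists (map_mx f v); rewrite adjmx_map -!map_mxM v1 v2.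
Qed.

Lemma map_proj_add p q : mvn_equiv (map_proj (addproj p q)) (addproj (map_proj p) (map_proj q)).
Proof.
apply: (@mvn_cast _ _ _ _ _ _ _ _ erefl).
by rewrite castmx_id /= map_block_mx !map_mx0.
Qed.

(** Equality in K0 of A is only stable equivalence; the stabilising projection is removed after
    mapping to B. *)
Lemma map_proj_mvn_cancel p q : cancellation_of_projections B ->
  K0class p = K0class q -> mvn_equiv (map_proj p) (map_proj q).
Proof.
move=> Bcancel /K0class_eq[r /map_proj_mvn pq]; apply: Bcancel.
apply: (addIr (K0class (map_proj r))); rewrite -!K0class_addproj; apply: K0class_mvn.
exact: mvn_trans (mvn_sym (map_proj_add p r)) (mvn_trans pq (map_proj_add q r)).
Qed.

(** Otherwise the identity matrix of size n+1 over B would be equivalent to the projection of size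
    0, that is, factor through an empty matrix. *)
Lemma K0one_torsion_free n : cancellation_of_projections B -> K0one A *+ n.+1 <> 0.
Proof.
move=> Bcancel K0.
have /(map_proj_mvn_cancel Bcancel)[v [vv _]] :
    K0class (mkproj (is_mxproj_scalar n.+1 (mulr1 (1 : A)) star1)) = K0class zeroproj.
  rewrite K0class_scalar (_ : mkproj _ = oneproj A) //.
  by rewrite /oneproj /mkproj; congr exist; exact: bool_irrelevance.
move: vv => /matrixP/(_ ord0 ord0)/eqP.
by rewrite !mxE big_ord0 eqxx mulr1n rmorph1 eq_sym oner_eq0.
Qed.

End MapProjections.

(** z intertwines p and p' exactly, and 1 - z^* z = p(p - p')p - (1 - p)(p - p')(1 - p) has norm at
    most C^2 d + 4 C^2 d, so its polar part does the job. *)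
Lemma near_projections_equiv (R : realType) (W : starAlgType R) (nu : W -> R) (p p' : W) (C d : R) :
  star_norm nu -> nu 1 <= C -> nu p <= C -> nu p' <= C -> nu (p - p') <= d ->
  40 * (C * C * d) <= 1 ->
  p * p = p -> star p = p -> p' * p' = p' -> star p' = p' ->
  exists u, unitary u /\ u * p = p' * u.
Proof.
move=> nuP n1 np np' pp'd Cd pp ps pp' ps'.
pose z := p' * p + (1 - p') * (1 - p).
have zs : star z = p * p' + (1 - p) * (1 - p').
  by rewrite /z starD !starM !starB star1 ps ps'.
have C0 : 0 <= C := le_trans (nu_ge0 nuP 1) n1.
have d0 : 0 <= d := le_trans (nu_ge0 nuP _) pp'd.
have bound (q q' : W) : nu q <= C -> nu (q - q') <= d ->
    nu (q * (q - q') * q - (1 - q) * (q - q') * (1 - q)) <= 5 * (C * C * d).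
  move=> nq qq'.
  have n1q : nu (1 - q) <= C + C.
    by rewrite (le_trans (nuD nuP _ _))// (nuN nuP) lerD.
  have h1 := nuM_le nuP (nuM_le nuP nq qq') nq.
  have h2 := nuM_le nuP (nuM_le nuP n1q qq') n1q.
  apply: le_trans (nuD nuP _ _) _; rewrite (nuN nuP).
  by move: h1 h2; clear; lra.
have key (q q' : W) : q * q = q -> q' * q' = q' ->
    1 - (q * q' + (1 - q) * (1 - q')) * (q' * q + (1 - q') * (1 - q))
    = q * (q - q') * q - (1 - q) * (q - q') * (1 - q).
  move=> qq qq'.
  have e1 : (q * q' + (1 - q) * (1 - q')) * (q' * q + (1 - q') * (1 - q))
      = q * (q' * q') * q + q * (q' - q' * q') * (1 - q) + (1 - q) * (q' - q' * q') * q
        + (1 - q) * (1 - q' - q' + q' * q') * (1 - q) by nc_ring.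
  rewrite e1 qq' subrr !mulr0 !mul0r !addr0.
  have e2 : 1 = q * q + (1 - q) * (1 - q) + (q - q * q) *+ 2 by nc_ring.
  have e3 : q * q * q = q by rewrite !qq.
  have e4 : (1 - q) * q * (1 - q) = 0 by rewrite mulrBl mul1r qq subrr mul0r.
  rewrite [X in X - _]e2 qq subrr mul0rn addr0.
  have -> : q * (q - q') * q = q * q * q - q * q' * q by nc_ring.
  have -> : (1 - q) * (q - q') * (1 - q) = (1 - q) * q * (1 - q) - (1 - q) * q' * (1 - q) by nc_ring.
  by rewrite e3 e4; nc_ring.
have [|||u [uU _ uE]] := polar nuP (z := z) (d := 5 * (C * C * d)).
- by rewrite zs key//; exact: bound.
- rewrite zs key//; apply: bound => //; by rewrite (nuBC nuP).
- by move: Cd; clear; lra.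
have zp : z * p = p' * z.
  have -> : z * p = p' * p * p + (1 - p') * (p - p * p) by rewrite /z; nc_ring.
  have -> : p' * z = p' * p' * p + (p' - p' * p') * (1 - p) by rewrite /z; nc_ring.
  by rewrite pp pp' !subrr mulr0 mul0r !addr0 -mulrA pp.
by exists u; split=> //; apply: uE; rewrite ?ps ?ps'.
Qed.

(** [near_proj_hom] gives q within 81 C^2 d, and [near_projections_equiv] with norm bound 2C then
    needs 40 * 4 * 81 C^4 d <= 1, where 40 * 4 * 81 = 12960. *)
Lemma near_projection_in (R : realType) (A W : starAlgType R) (nu : A -> R) (j : W -> A)
    (p : A) (y : W) (C d : R) :
  star_norm nu -> star_hom j -> star_norm (fun w => nu (j w)) ->
  1 <= C -> nu 1 <= C -> nu p <= C -> p * p = p -> star p = p ->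
  nu (j y - p) <= d -> 0 < d -> 100 * 130 * (C * C * (C * C * d)) <= 1 ->
  exists q u, [/\ q * q = q, star q = q, unitary u & u * p = j q * u].
Proof.
move=> nuP jP mu C1 n1 np pp ps yd d0 Cd.
have C0 : 0 <= C by lra.
have CC1 : 1 <= C * C by rewrite -[leLHS]mulr1 ler_pM.
have CdCC : C * d <= C * C * d by rewrite -mulrA ler_peMl ?mulr_ge0// ltW.
have CC4 : C * C * d <= C * C * (C * C * d).
  by rewrite ler_peMl// !mulr_ge0// ltW.
have [|q [qq qs]] := near_proj_hom nuP jP mu C1 n1 np pp ps yd d0.
  by move: Cd CC4 CdCC; clear; lra.
rewrite (nuBC nuP) => qp.
have jq : nu (j q) <= 2 * C.
  have := nu_le_add nuP (j q) p; rewrite (nuBC nuP (j q)).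
  by move: qp np C1 Cd CC4; clear; lra.
have [|||||u [uU up]] := near_projections_equiv nuP (C := 2 * C) _ _ jq qp _ pp ps.
- by move: n1 C1; clear; lra.
- by move: np C1; clear; lra.
- by move: Cd; clear; lra.
- by rewrite -(shM jP) qq.
- by rewrite -(shJ jP) qs.
by exists q, u.
Qed.

(** P is a complex projection of size (n+1)(N+1). Each vector of an orthonormal basis of its range,
    written with the units E_b0, becomes a column of v, so P is equivalent to r copies of E_00. *)
Lemma finite_level_projection_factor (R : realType) (A : starAlgType R) N n
    (E : unit_family A N) (P : cmat 'M[R[i]]_N.+1 n) :
  munits E -> P * P = P -> star P = P ->
  exists r (v : 'M[A]_(n.+1, r)),
    v *m adjmx v = map_mx (lin E) P /\ adjmx v *m v = (E ord0 ord0)%:M.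
Proof.
move=> EP PP Ps; have V1 := ipn_prehilbert (n := N) (ip_complex_prehilbert (R := R)).
have V2 := ipn_prehilbert (n := n) V1.
have rP := rhon_faithful (n := n) V1 (mx_rep_faithful (R := R) N).
pose basis (ab : 'I_n.+1 * 'I_N.+1) : {ffun 'I_n.+1 -> {ffun 'I_N.+1 -> (R[i])^o}} :=
  [ffun a => [ffun b => ((ab.1 == a) && (ab.2 == b))%:R]].
have basisP (x : {ffun 'I_n.+1 -> {ffun 'I_N.+1 -> (R[i])^o}}) :
    x = \sum_ab (x ab.1 ab.2 : R[i]) *: basis ab.
  apply/ffunP => a; apply/ffunP => b; rewrite !sum_ffunE.
  rewrite (bigD1 (a, b))//= [X in _ + X]big1 ?addr0 => [|[a' b'] /= ne].
    by rewrite !ffunE !eqxx /GRing.scale /= mulr1.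
  rewrite !ffunE /=; have -> : (a' == a) && (b' == b) = false.
    by apply: contraNF ne => /andP[/eqP-> /eqP->].
  by rewrite /GRing.scale /= mulr0.
have [|||||r [g [go gP]]] := proj_orthonormal V2 (p := rhon (@mx_rep R N) P) (v := basis).
- exact: (rhoD rP).
- exact: (rhoZ rP).
- by move=> x; rewrite -(rhoM rP) PP.
- by move=> x y; rewrite -(rhoJ rP) Ps.
- move=> x; exists (fun ab => rhon (@mx_rep R N) P x ab.1 ab.2); exact: basisP.
have PE a a' b b' : P a a' b b' = \sum_s (g s a b : R[i]) * (g s a' b' : R[i])^*.
  have dsum (F : 'I_n.+1 -> 'I_N.+1 -> R[i]) :
      \sum_c \sum_k ((a' == c) && (b' == k))%:R * F c k = F a' b'.
    rewrite (bigD1 a')//= [X in _ + X]big1 ?addr0 => [|c ca]; last first.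
      by rewrite big1// => k _; rewrite eq_sym (negPf ca) mul0r.
    rewrite (bigD1 b')//= [X in _ + X]big1 ?addr0 => [|k kb]; first by rewrite !eqxx mul1r.
    by rewrite (eq_sym b') (negPf kb) andbF mul0r.
  have := gP (basis (a', b')) => /ffunP/(_ a)/ffunP/(_ b).
  rewrite ffunE /span_proj !sum_ffunE.
  under eq_bigr do (rewrite ffunE; under eq_bigr do rewrite !ffunE mulrC).
  rewrite (dsum (fun c k => P a c b k)) => ->.
  apply: eq_bigr => s _; rewrite !ffunE mulrC; congr (_ * _).
  rewrite -(dsum (fun c k => (g s c k : R[i])^*)); apply: eq_bigr => c _.
  by apply: eq_bigr => k _; rewrite !ffunE.
have muE := muM EP.
exists r, (\matrix_(a, s) \sum_b (g s a b : R[i]) *: E b ord0); split.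
  apply/matrixP => a a'; rewrite !mxE.
  under eq_bigr => s _.
    rewrite !mxE star_sum mulr_suml; under eq_bigr => b _.
      rewrite mulr_sumr; under eq_bigr => b' _ do
        rewrite starZ (muJ EP) -scalerAl -scalerAr scalerA muE eqxx mulr1n.
      over.
    over.
  rewrite exchange_big; apply: eq_bigr => b _ /=; rewrite exchange_big.
  by apply: eq_bigr => b' _; rewrite -scaler_suml -PE.
apply/matrixP => s s'; rewrite !mxE.
under eq_bigr => a _.
  rewrite !mxE star_sum mulr_suml; under eq_bigr => b _.
    rewrite mulr_sumr; under eq_bigr => b' _ do
      rewrite starZ (muJ EP) -scalerAl -scalerAr scalerA muE -scalerMnr.
    rewrite sum_delta; over.
  rewrite -scaler_suml; over.
rewrite -scaler_suml; have := go s' s; rewrite /ipn => goE.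
have -> : \sum_a \sum_b (g s a b : R[i])^* * (g s' a b : R[i]) = (s == s')%:R.
  rewrite eq_sym -goE; apply: eq_bigr => a _; apply: eq_bigr => b _.
  by rewrite /ip_complex mulrC.
by rewrite scaler_nat.
Qed.

Lemma map_cmat_hom (R : realType) (A W : starAlgType R) n (f : W -> A) : star_hom f ->
  star_hom (map_mx f : cmat W n -> cmat A n).
Proof.
move=> fP; split=> [X Y|c X|X Y|X|]; apply/matrixP => a b.
- by rewrite !mxE (shD fP).
- by rewrite !mxE (shZ fP).
- by rewrite !mxE (sh_sum fP); apply: eq_bigr => k _; rewrite !mxE (shM fP).
- by rewrite !mxE (shJ fP).
- by rewrite !mxE; case: (a == b); rewrite ?mulr1n ?mulr0n ?(sh1 fP) ?(sh0 fP).
Qed.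

Section UniversalK0.
Context {R : realType} {A : cstarAlgType R} (t : uhf_tower A).
Let nA := cnorm_cstar_norm A.

Definition tw_class m : K0 A :=
  let e := munits_proj ord0 (tw_munits t m) in K0class (mkproj (is_mxproj_scalar 1 e.1 e.2)).

Lemma tw_class_size m : tw_class m *+ (tw_size t m).+1 = K0one A.
Proof.
have EP := tw_munits t m; set E := tw_units t m in EP.
rewrite /tw_class -K0class_scalar; apply/esym/K0class_mvn.
exists (\row_i E i ord0); split; apply/matrixP => i j; rewrite !mxE.
  under eq_bigr do rewrite !mxE (muJ EP) (muM EP) eqxx mulr1n.
  by rewrite (mu1 EP) !ord1.
by rewrite big_ord1 !mxE (muJ EP) (muM EP) -/E.
Qed.

(** A projection with entries close to a matrix algebra is unitarily equivalent to one over it. All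
    later stages are included so that two projections can be compared at a common one. *)
Lemma tw_classP (p : mxproj A) : exists m, forall m', (m <= m')%N ->
  exists r, K0class p = tw_class m' *+ r.
Proof.
case: p => [[[|n] M] MP]; first by exists 0%N => m' _; exists 0%N; apply: K0class_mvn; exact: mxproj0_mvn.
have [MM Ms] : (M : cmat A n) * M = M /\ star (M : cmat A n) = M.
  by case/andP: (MP) => /eqP ? /eqP ?.
have nM := nu_entries_star_norm n (cstar_norm_star nA).
pose C : R := 1 + nu_entries cnorm (1 : cmat A n) + nu_entries cnorm (M : cmat A n).
have n10 := nu_ge0 nM 1; have nM0 := nu_ge0 nM M.
have C1 : 1 <= C by rewrite /C -addrA lerDl addr_ge0.
have C0 : 0 < C by rewrite (lt_le_trans ltr01).
(* The largest tolerance allowed by [near_projection_in]; [d'] distributes it over the entries. *)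
pose d : R := (100 * 130 * (C * C * (C * C)))^-1.
have d0 : 0 < d by rewrite invr_gt0 !mulr_gt0.
pose d' : R := d / (n.+1%:R * n.+1%:R).
have d'0 : 0 < d' by rewrite divr_gt0// mulr_gt0.
have [f fP] := choice (fun ab : 'I_n.+1 * 'I_n.+1 => tw_dense t (M ab.1 ab.2) d'0).
exists (\max_ab f ab) => m' fm'; set E := tw_units t m'; have EP : munits E := tw_munits t m'.
have yE (ab : 'I_n.+1 * 'I_n.+1) : exists x, cnorm (lin E x - M ab.1 ab.2) <= d'.
  have [x xE] := fP ab; have [x' x'E] := tw_above (t := t) (leq_trans (leq_bigmax ab) fm') x.
  by exists x'; rewrite -x'E (nuBC nA) ltW.
have [y yP] := choice yE; pose Y : cmat 'M[R[i]]_((tw_size t m').+1) n := \matrix_(a, b) y (a, b).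
have jP := map_cmat_hom n (lin_hom EP).
have mu : star_norm (fun X : cmat 'M[R[i]]_((tw_size t m').+1) n =>
    nu_entries cnorm (map_mx (lin E) X : cmat A n)).
  have := nu_entries_star_norm n (cstar_norm_star (lin_cstar_norm EP nA)).
  congr star_norm; apply: funext => X; apply: eq_bigr => a _; apply: eq_bigr => b _.
  by rewrite mxE.
have [||||q [u [qq qs [u1 u2] uM]]] :=
  near_projection_in (C := C) (d := d) (y := Y) nM jP mu C1 _ _ MM Ms _ d0.
- by rewrite /C; move: n10 nM0; clear; lra.
- by rewrite /C; move: n10 nM0; clear; lra.
- apply: le_trans (_ : \sum_(a < n.+1) \sum_(b < n.+1) d' <= _).
    apply: ler_sum => a _; apply: ler_sum => b _; rewrite !mxE; exact: (yP (a, b)).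
  by rewrite !sumr_const card_ord -!mulrnA -mulr_natr natrM /d' mulfVK//.
- have -> : 100 * 130 * (C * C * (C * C * d)) = (100 * 130 * (C * C * (C * C))) * d by ring.
  by rewrite /d mulfV// !mulf_neq0 ?gt_eqF.
have jqP : is_mxproj (map_mx (lin E) q : 'M[A]_n.+1).
  apply/andP; split; apply/eqP.
    by have := shM jP q q; rewrite qq => /esym.
  by have := shJ jP q; rewrite qs => /esym.
have [r [v [v1 v2]]] := finite_level_projection_factor EP qq qs.
have [e1 e2] := munits_proj ord0 EP.
exists r; rewrite /tw_class -K0class_scalar; apply: K0class_mvn.
apply: (@mvn_trans _ _ (mkproj jqP)); last by exists v.
exists ((M : cmat A n) * star u); split.
  have -> : adjmx ((M : cmat A n) * star u) = u * (M : cmat A n) by rewrite [LHS]starM starK Ms.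
  by rewrite [LHS]mulrA -(mulrA (M : cmat A n)) u1 mulr1 MM.
have -> : adjmx ((M : cmat A n) * star u) = u * (M : cmat A n) by rewrite [LHS]starM starK Ms.
by rewrite [LHS]mulrA -(mulrA u) MM uM -mulrA u2 mulr1.
Qed.

Lemma tw_K0P (x : K0 A) : exists (n : nat) e (z : int), e *+ n.+1 = K0one A /\ x = e *~ z.
Proof.
have [p [q ->]] : exists p q, x = K0class p - K0class q.
  rewrite -[x]gdiff_repr; case: (repr x) => a b; exists (repr a), (repr b).
  rewrite /K0class !reprK; apply/eqP; rewrite eq_sym subr_eq; apply/eqP.
  by rewrite [RHS](gadd_diff (_, _) (_, _)); apply: gdiff_eq; exists 0 => /=; rewrite !addr0.
have [m mP] := tw_classP p; have [m' m'P] := tw_classP q.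
have [r ->] := mP (maxn m m') (leq_maxl _ _); have [s ->] := m'P (maxn m m') (leq_maxr _ _).
exists (tw_size t (maxn m m')), (tw_class (maxn m m')), (r%:Z - s%:Z).
by rewrite tw_class_size mulrzBr -!pmulrn.
Qed.

Lemma tw_K0_divisible n : exists e, e *+ n.+1 = K0one A.
Proof.
have [m [_ /dvdnP[k mk]]] := tw_dvd t n 0; exists (tw_class m *+ k).
by rewrite -mulrnA -mk tw_class_size.
Qed.

End UniversalK0.

Lemma universal_uhf_K0 (R : realType) (A B : cstarAlgType R) (f : {lrmorphism A -> B}) :
  universal_uhf A -> star_preserving f -> cancellation_of_projections B ->
  exists g : {additive K0 A -> rat}, bijective g.
Proof.
move=> /universal_uhf_tower[t _] fJ Bcancel.
apply: (divisible_rank1_rat (tw_K0_divisible t) (tw_K0P t)) => n.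
exact: (K0one_torsion_free fJ).
Qed.

Theorem proposition3p9 (R : realType) (D : cstarAlgType R)
    (Dsep : cstar_separable D)
    (Dssa : strongly_self_absorbing D)
    (Dqd : quasidiagonal D)
    (Dcancel : cancellation_of_projections D)
    (Dunit : forall n : nat, (1 <= n)%N ->
       [set x *+ n | x in K0pos D] (K0one D)) :
  (exists Q : cstarAlgType R, universal_uhf Q) /\
  forall Q : cstarAlgType R, universal_uhf Q ->
    star_isomorphic D Q /\
    exists f : {additive K0 Q -> rat}, bijective f.
Proof.
have Duhf : universal_uhf D.
  apply: (locally_matricial_universal_uhf Dsep).
  exact: strongly_self_absorbing_locally_matricial Dssa Dqd (munits_of_K0 Dcancel Dunit).
split; first by exists D.
move=> Q Quhf; split; first exact: universal_uhf_unique.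
(* The map goes from Q to D because cancellation is a hypothesis on D. *)
have [f [_ fJ]] := universal_uhf_unique Quhf Duhf.
exact: (universal_uhf_K0 (f := f)).
Qed.
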